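(* There is exactly one combinatorial type of polyhedron of genus $\mathfrak{g}\geq 2$ which can be embedded into $\mathbb{E}^3$ with vertex-transitive (rotational) tetrahedral symmetry. A polyhedron of this combinatorial type has genus $3$; it has $12$ vertices, $48$ edges and $32$ faces, all of which are triangles, and it is of Schläfli type $\{3,8\}$, i.e. exactly $8$ triangles meet at each vertex. Moreover, this combinatorial type is realized, with vertex-transitive tetrahedral symmetry, by a polyhedron whose convex hull is combinatorially isomorphic to the snub tetrahedron.
   Context: $\mathbb{E}^3$ denotes Euclidean $3$-space. A polyhedron $P$ is a closed, connected, orientable surface embedded in $\mathbb{E}^3$ (in particular, without self-intersections), tiled by finitely many plane simple polygons in a face-to-face manner. These polygons are called the faces of $P$, and their vertices and edges are called the vertices and edges of $P$. The genus of $P$ is the genus of the surface. Thus $P$ is a polyhedral realization (an embedding into $3$-space with plane polygonal faces) of an underlying polyhedral map $M$ on a closed orientable surface; here a polyhedral map is a decomposition of the surface into vertices, edges and closed polygonal disks (faces) such that any two distinct faces intersect in the empty set, in a single common vertex, or in a single common edge. The combinatorial type of $P$ is the isomorphism class of $M$, where an isomorphism of maps is an incidence-preserving bijection taking vertices to vertices, edges to edges and faces to faces (it need not preserve any orientation). The geometric symmetry group $G$ of $P$ is the group of all linear isometries of $\mathbb{E}^3$ that map $P$ to itself and induce an automorphism of the underlying map $M$. The tetrahedral rotation group $T$ is the group, of order $12$, of all rotations (orientation-preserving linear isometries) of $\mathbb{E}^3$ mapping a regular tetrahedron centered at the origin to itself. A polyhedron $P$ has vertex-transitive (rotational) tetrahedral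 symmetry if its geometric symmetry group $G$ is the rotation group $T$ of some regular tetrahedron centered at the origin and $G$ acts transitively on the vertices of $P$. The snub tetrahedron is the convex polyhedron with $12$ vertices and $20$ triangular faces, five meeting at each vertex, which is combinatorially isomorphic to the regular icosahedron. *)

(* Defs.v *)
From HB Require Import structures.
From mathcomp Require Import all_boot.

Set Implicit Arguments.
Unset Strict Implicit.
Unset Printing Implicit Defensive.

(* A map is given by its vertices, its faces, and the cyclic sequence of
   vertices around each face; where this sequence starts, and in which of the
   two directions it runs, is irrelevant.  Edges are the 2-element sets of
   cyclically consecutive vertices of some face: in a polyhedral map an edge is
   determined by its endpoints. *)
Record map_data := MapData {
  vert : finType;
  face : finType;
  bdry : face -> seq vert }.

Section Combinatorics.
Variable M : map_data.
Implicit Types (f g : face M) (u v : vert M).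
Local Open Scope set_scope.

Definition face_verts f : {set vert M} := [set v in bdry f].

Definition face_edges f : {set {set vert M}} :=
  [set [set u; next (bdry f) u] | u in bdry f].

Definition edges : {set {set vert M}} := \bigcup_f face_edges f.

Definition adjacent : rel (vert M) := fun u v => [set u; v] \in edges.

Definition common_edge f g u v : bool :=
  [set u; v] \in face_edges f :&: face_edges g.

Definition adjacent_at v : rel (face M) := fun f g =>
  [exists u, common_edge f g u v].

(* The surface obtained by gluing the faces is a closed 2-manifold: every edge
   is on exactly two faces, so the faces around a vertex form disjoint cycles,
   and connectedness for [adjacent_at v] says that there is a single cycle. *)
Definition closed_surface : Prop :=
  [/\ forall v, exists f, v \in bdry f,
      forall e, e \in edges -> #|[set f | e \in face_edges f]| = 2
    & forall v f g, v \in bdry f -> v \in bdry g -> connect (adjacent_at v) f g].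

Definition connected_map : Prop :=
  0 < #|vert M| /\ forall u v, connect adjacent u v.

(* The face boundaries can be directed so that the two faces on an edge
   traverse it in opposite directions, i.e. no directed edge occurs twice. *)
Definition orientable : Prop :=
  exists flip : face M -> bool,
    let cyc f := if flip f then rev (bdry f) else bdry f in
    forall f g u, u \in bdry f -> u \in bdry g ->
      next (cyc f) u = next (cyc g) u -> f = g.

Definition polyhedral_map : Prop :=
  [/\ forall f, uniq (bdry f) /\ 3 <= size (bdry f),
      closed_surface, connected_map, orientable
    & forall f g, f != g ->
        let I := face_verts f :&: face_verts g in
        #|I| <= 1 \/ I \in face_edges f :&: face_edges g].

(* V - E + F = 2 - 2g *)
Definition has_genus (g : nat) : Prop :=
  #|vert M| + #|face M| + g.*2 = #|edges| + 2.

(* Cells are represented by their sets of vertices, which in a polyhedral map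
   identifies the face poset with a set of vertex sets ordered by inclusion. *)
Definition cell (c : {set vert M}) : Prop :=
  [\/ exists v, c = [set v], c \in edges | exists f, c = face_verts f].

End Combinatorics.

(* The bijection on edges is the one induced by phi. *)
Definition is_map_iso (M N : map_data)
    (phi : vert M -> vert N) (psi : face M -> face N) : Prop :=
  [/\ bijective phi, bijective psi
    & forall f, face_edges (psi f) =
                [set phi @: (e : {set vert M}) | e in face_edges f]].

Definition map_isomorphic (M N : map_data) : Prop :=
  exists (phi : vert M -> vert N) (psi : face M -> face N), is_map_iso phi psi.

(* The boundary complex of the regular icosahedron: poles 0 and 11, upper ring
   1, ..., 5, lower ring 6, ..., 10, with i adjacent to i+5 and to i+4 (resp. 10
   for i = 1). *)
Definition icosahedron_table : seq (seq nat) :=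
  [:: [:: 0; 1; 2];   [:: 0; 2; 3];   [:: 0; 3; 4];   [:: 0; 4; 5];  [:: 0; 5; 1];
      [:: 1; 2; 6];   [:: 2; 3; 7];   [:: 3; 4; 8];   [:: 4; 5; 9];  [:: 5; 1; 10];
      [:: 2; 6; 7];   [:: 3; 7; 8];   [:: 4; 8; 9];   [:: 5; 9; 10]; [:: 1; 10; 6];
      [:: 11; 6; 7];  [:: 11; 7; 8];  [:: 11; 8; 9];  [:: 11; 9; 10];
      [:: 11; 10; 6]].

Definition icosahedron : map_data :=
  @MapData 'I_12 'I_20
    (fun f => [seq inord i | i <- nth [::] icosahedron_table f]).

From mathcomp Require Import all_order all_algebra.
From mathcomp Require Import all_classical all_reals all_analysis.
Import Order.TTheory GRing.Theory Num.Theory.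
Import numFieldNormedType.Exports.

Local Open Scope classical_set_scope.
Local Open Scope ring_scope.

Section Euclidean.
Variable R : realType.
Local Notation E3 := 'rV[R]_3.

Definition dot (x y : E3) : R := (x *m y^T) 0 0.

Definition segment (a b : E3) : set E3 :=
  [set (1 - t) *: a + t *: b | t in `[0, 1]].

Definition convex_hull (A : set E3) : set E3 :=
  \bigcap_(C in [set C : set E3 | convex_set C /\ A `<=` C]) C.

(* Linear maps act on row vectors from the right. *)
Definition linear_isometry (A : 'M[R]_3) : Prop :=
  forall x y : E3, dot (x *m A) (y *m A) = dot x y.

Definition act (A : 'M[R]_3) (S : set E3) : set E3 := [set x *m A | x in S].

(* Four points at equal positive mutual distance. *)
Definition regular_tetrahedron (t : 'I_4 -> E3) : Prop :=
  exists2 d : R, 0 < d & forall i j, i != j -> dot (t i - t j) (t i - t j) = d.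

Definition centered (t : 'I_4 -> E3) : Prop := \sum_i t i = 0.

Definition tetrahedral_rotation (t : 'I_4 -> E3) (A : 'M[R]_3) : Prop :=
  [/\ linear_isometry A, \det A = 1
    & act A (convex_hull (range t)) = convex_hull (range t)].

Definition exposed_face (K F : set E3) : Prop :=
  exists (a : E3) (b : R),
    (forall x, K x -> dot a x <= b) /\ F = [set x | K x /\ dot a x = b].

Definition proper_face (K F : set E3) : Prop :=
  [/\ exposed_face K F, F !=set0 & F <> K].

(* An isomorphism between the poset of cells of N and the poset of proper faces
   of the convex polytope K. *)
Definition combinatorially_isomorphic (K : set E3) (N : map_data) : Prop :=
  exists Phi : {set vert N} -> set E3,
    (forall c d, cell c -> cell d -> (Phi c `<=` Phi d <-> c \subset d)) /\
    (forall F, proper_face K F <-> exists2 c, cell c & Phi c = F).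

Section Realization.
Variables (M : map_data) (p : vert M -> E3).
Implicit Types (f g : face M) (u v : vert M).

Definition edge_segment f u : set E3 := segment (p u) (p (next (bdry f) u)).

Definition polygon f : set E3 := \bigcup_(u in [set` bdry f]) edge_segment f u.

Definition simple_polygon f : Prop :=
  forall u v, u \in bdry f -> v \in bdry f -> u != v ->
    edge_segment f u `&` edge_segment f v =
    p @` ([set u; next (bdry f) u] `&` [set v; next (bdry f) v]).

Definition planar f : Prop :=
  exists (a : E3) (b : R), a != 0 /\ forall v, v \in bdry f -> dot a (p v) = b.

(* The affine hull of the vertices of f, as an intersection of planes. *)
Definition face_plane f : set E3 :=
  [set x | forall (a : E3) (b : R),
    (forall v, v \in bdry f -> dot a (p v) = b) -> dot a x = b].

(* The polygonal disk: the Jordan curve [polygon f] with the bounded component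
   of its complement in its plane. *)
Definition region f : set E3 :=
  polygon f `|`
  [set x | (face_plane f `\` polygon f) x /\
           bounded_set (connected_component (face_plane f `\` polygon f) x)].

Definition body : set E3 := \bigcup_(f in [set: face M]) region f.

Definition face_to_face : Prop :=
  forall f g, f != g ->
    [\/ region f `&` region g = set0,
        exists v, [/\ v \in bdry f, v \in bdry g
                    & region f `&` region g = [set p v]]
      | exists u v, common_edge f g u v /\
                    region f `&` region g = segment (p u) (p v)].

(* p realizes M as a polyhedron, with point set [body]. *)
Definition polyhedron : Prop :=
  [/\ polyhedral_map M, injective p,
      forall f, planar f /\ simple_polygon f
    & face_to_face].

(* The geometric symmetry group G. *)
Definition symmetry (A : 'M[R]_3) : Prop :=
  [/\ linear_isometry A, act A body = body
    & exists (phi : vert M -> vert M) (psi : face M -> face M),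
        [/\ is_map_iso phi psi,
            forall v, p (phi v) = p v *m A
          & forall f, region (psi f) = act A (region f)]].

Definition vertex_transitive_tetrahedral : Prop :=
  (exists t : 'I_4 -> E3,
     [/\ regular_tetrahedron t, centered t
       & forall A, symmetry A <-> tetrahedral_rotation t A]) /\
  (forall u v, exists2 A, symmetry A & p u *m A = p v).

End Realization.

(* The combinatorial types in question. *)
Definition tetrahedral_type (M : map_data) : Prop :=
  (exists2 g, (2 <= g)%N & has_genus M g) /\
  exists p : vert M -> E3, polyhedron p /\ vertex_transitive_tetrahedral p.

End Euclidean.

(* Main.v *)
(* The vertices are an orbit, so they lie on a sphere and faces are convex polygons
   inscribed in circles; two vertex sets with crossing convex hulls are never
   contained in two faces.  In a suitable frame the vertices are the twelve images,
   under cyclic shifts and even sign changes, of a point (a, b, c) with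
   a >= b >= c >= 0, and the faces are a union of orbits of label sets.  The signs of
   five determinants cut the chamber b > c into eight pieces.  In each piece Radon
   partitions of five points exclude pairs of orbits of faces; together with the
   conditions that an edge is on 0 or 2 faces and that the genus is at least 2 they
   leave two unions of orbits, one of which is not a surface at the vertices.  The
   case b = c is similar, and the orbits with less than 12 points have too few faces.
   The remaining union of orbits, 32 triangles, is realized by (a, b, c) = (5, 2, 1),
   with separating planes for each pair of triangles. *)
Require Import Defs.
From mathcomp Require Import all_boot all_order all_algebra.
From mathcomp Require Import all_classical all_reals all_analysis.
From mathcomp Require Import ring lra zify.

Set Implicit Arguments.
Unset Strict Implicit.
Unset Printing Implicit Defensive.
Import Order.TTheory GRing.Theory Num.Theory.
Import numFieldNormedType.Exports.
Local Open Scope classical_set_scope.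
Local Open Scope ring_scope.

(** * Vectors and convex hulls *)

(** Two things are unknown: the shape of the faces and the position of the vertices. The sphere
    settles the shape: the line of a side contains no third vertex and leaves the ball at the ends
    of the side, so a simple polygon that turned both ways would cross itself. As points of a sphere
    are extreme, two faces meeting in a common vertex or edge cannot contain disjoint vertex sets
    with intersecting hulls. Labels settle the position: twelve distinct vertices are a copy of the
    rotation group acting on itself by multiplication, so possible faces are subsets of the group
    (21 orbits of triples), and geometry enters only through signs of polynomials in the coordinates
    of one point. Reflected frames are allowed because the full octahedral group normalizes the
    tetrahedral one, whence a >= b >= c >= 0; writing a = c + v + u, b = c + v turns sign questions
    into the inspection of coefficients. The genus acts through Euler's formula: the sum of (size -
    2) over the faces is 2E - 2F = 2V + 4g - 4, at least 28 for twelve vertices and g >= 2. *)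

Section Vectors.
Variable R : realType.
Local Notation E3 := 'rV[R]_3.
Implicit Types (u v w x y z n : E3) (s t : R).

Definition i0 : 'I_3 := @Ordinal 3 0 isT.
Definition i1 : 'I_3 := @Ordinal 3 1 isT.
Definition i2 : 'I_3 := @Ordinal 3 2 isT.

Definition vec (a b c : R) : E3 := \row_(i < 3) nth 0 [:: a; b; c] i.

Definition cross u v : E3 :=
  vec (u 0 i1 * v 0 i2 - u 0 i2 * v 0 i1) (u 0 i2 * v 0 i0 - u 0 i0 * v 0 i2)
      (u 0 i0 * v 0 i1 - u 0 i1 * v 0 i0).

Definition triple u v w : R := dot u (cross v w).

Lemma big_ord3 (V : nmodType) (F : 'I_3 -> V) :
  \sum_i F i = F i0 + F i1 + F i2.
Proof.
rewrite !big_ord_recl big_ord0 addr0 addrA.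
by congr (F _ + F _ + F _); apply/val_inj.
Qed.

Lemma ord3P (P : 'I_3 -> Prop) : P i0 -> P i1 -> P i2 -> forall i, P i.
Proof.
move=> P0 P1 P2 [[|[|[|//]]] h].
- by rewrite (_ : Ordinal h = i0) //; apply/val_inj.
- by rewrite (_ : Ordinal h = i1) //; apply/val_inj.
- by rewrite (_ : Ordinal h = i2) //; apply/val_inj.
Qed.

Lemma dotE u v : dot u v = u 0 i0 * v 0 i0 + u 0 i1 * v 0 i1 + u 0 i2 * v 0 i2.
Proof. by rewrite /dot mxE big_ord3 !mxE. Qed.

Lemma vecP u v :
  u 0 i0 = v 0 i0 -> u 0 i1 = v 0 i1 -> u 0 i2 = v 0 i2 -> u = v.
Proof. by move=> h0 h1 h2; apply/rowP; apply: ord3P. Qed.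

Lemma dotC u v : dot u v = dot v u.
Proof. by rewrite !dotE; ring. Qed.
Lemma dotDr u v w : dot u (v + w) = dot u v + dot u w.
Proof. by rewrite !dotE !mxE; ring. Qed.
Lemma dotZr u t v : dot u (t *: v) = t * dot u v.
Proof. by rewrite !dotE !mxE; ring. Qed.
Lemma dotBr u v w : dot u (v - w) = dot u v - dot u w.
Proof. by rewrite !dotE !mxE; ring. Qed.
Lemma dot0r u : dot u 0 = 0.
Proof. by rewrite !dotE !mxE; ring. Qed.
Lemma dotDl u v w : dot (v + w) u = dot v u + dot w u.
Proof. by rewrite !(dotC _ u) dotDr. Qed.
Lemma dotBl u v w : dot (v - w) u = dot v u - dot w u.
Proof. by rewrite !(dotC _ u) dotBr. Qed.
Lemma dotZl u t v : dot (t *: v) u = t * dot v u.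
Proof. by rewrite !(dotC _ u) dotZr. Qed.

Lemma dotNl u v : dot (- v) u = - dot v u.
Proof. by rewrite -scaleN1r dotZl mulN1r. Qed.

Lemma dot_sumr (I : finType) (P : pred I) u (F : I -> E3) :
  dot u (\sum_(i | P i) F i) = \sum_(i | P i) dot u (F i).
Proof.
by elim/big_rec2: _ => [|i y x _ <-]; rewrite ?dot0r // dotDr.
Qed.

Lemma dot_ge0 u : 0 <= dot u u.
Proof. by rewrite dotE; nra. Qed.

Lemma dot_eq0 u : (dot u u == 0) = (u == 0).
Proof.
apply/eqP/eqP => [|->]; last by rewrite dot0r.
rewrite dotE => h; apply: vecP; rewrite !mxE; nra.
Qed.

Lemma dot_gt0 u : (0 < dot u u) = (u != 0).
Proof. by rewrite lt_def dot_ge0 andbT dot_eq0. Qed.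

Lemma tripleDr n u v w : triple n u (v + w) = triple n u v + triple n u w.
Proof. by rewrite /triple !dotE !mxE /= ?mxE; ring. Qed.
Lemma tripleBr n u v w : triple n u (v - w) = triple n u v - triple n u w.
Proof. by rewrite /triple !dotE !mxE /= ?mxE; ring. Qed.
Lemma tripleZr n u t v : triple n u (t *: v) = t * triple n u v.
Proof. by rewrite /triple !dotE !mxE /= ?mxE; ring. Qed.
Lemma triplevv n u : triple n u u = 0.
Proof. by rewrite /triple !dotE !mxE /=; ring. Qed.
Lemma tripleNl n u v : triple (- n) u v = - triple n u v.
Proof. by rewrite /triple !dotE !mxE /=; ring. Qed.

(* In the plane orthogonal to [n], [triple n] is the area form. *)
Lemma triple_eq0 n u v : n != 0 -> u != 0 -> dot n u = 0 -> dot n v = 0 ->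
  triple n u v = 0 -> v = (dot u v / dot u u) *: u.
Proof.
move=> n0 u0 nu nv t0.
have nn : dot n n != 0 by rewrite dot_eq0.
have uu : dot u u != 0 by rewrite dot_eq0.
have c0 : cross u v = 0.
  have h : dot n n *: cross u v =
      triple n u v *: n + dot n u *: cross n v + dot n v *: cross u n.
    by rewrite /triple; apply: vecP; rewrite !dotE !mxE /= ?mxE; ring.
  by move: h; rewrite t0 nu nv !scale0r !addr0 => /eqP; rewrite scaler_eq0 (negPf nn) => /eqP.
have h : dot u u *: v - dot u v *: u = cross (cross u v) u.
  by apply: vecP; rewrite !dotE !mxE /= ?mxE /=; ring.
have z : cross (cross u v) u = 0.
  by rewrite c0; apply: vecP; rewrite !mxE /= ?mxE; ring.
rewrite mulrC -scalerA; apply: (@scalerI _ _ (dot u u)) => //.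
rewrite [RHS]scalerA divff // scale1r; apply/eqP; rewrite -subr_eq0 h; exact/eqP.
Qed.

(** Cramer's rule for [n], [d], [e] in space. Its component along [n] is removed by pairing the
    identity with [n], to which everything else is orthogonal. *)
Lemma triple_cramer n d e y : n != 0 ->
  dot n d = 0 -> dot n e = 0 -> dot n y = 0 ->
  triple n d e *: y = triple n y e *: d + triple n d y *: e.
Proof.
move=> n0 nd ne ny.
have nn : dot n n != 0 by rewrite dot_eq0.
have h : triple n d e *: y =
    triple y d e *: n + triple n y e *: d + triple n d y *: e.
  by rewrite /triple; apply: vecP; rewrite !dotE !mxE /= ?mxE; ring.
suff -> : triple n d e *: y = 0 *: n + triple n y e *: d + triple n d y *: e.
  by rewrite scale0r add0r.
rewrite h; congr (_ *: _ + _ + _).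
have := congr1 (dot n) h; rewrite !dotDr !dotZr nd ne ny !mulr0 !addr0.
by move/esym/eqP; rewrite mulf_eq0 (negPf nn) orbF => /eqP.
Qed.

Lemma continuous_dot n : continuous (dot n : E3 -> R).
Proof.
rewrite (_ : dot n =
  (fun x => n 0 i0 * x 0 i0 + n 0 i1 * x 0 i1 + n 0 i2 * x 0 i2)); last first.
  by apply/funext => x; rewrite dotE.
have c j x : (fun y : E3 => n 0 j * y 0 j) @ x --> n 0 j * x 0 j.
  by apply: cvgMl_tmp; [exact: nbhs_filter|exact: coord_continuous].
by move=> x; exact: (cvgD (cvgD (c _ x) (c _ x)) (c _ x)).
Qed.

Lemma triple_dot n u v : triple n u v = dot (cross n u) v.
Proof. by rewrite /triple !dotE !mxE /=; ring. Qed.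

(** The power of a point of the secant through [u] and [v]: for distinct [u], [v] the secant meets
    the sphere only at [t = 0] and [t = 1], and the ball only for [t] between them. *)
Lemma sphere_chord r u v t : dot u u = r -> dot v v = r ->
  dot (u + t *: (v - u)) (u + t *: (v - u)) = r - t * (1 - t) * dot (v - u) (v - u).
Proof.
move=> hu hv.
rewrite !(dotBl, dotBr, dotDl, dotDr, dotZl, dotZr) hu hv (dotC v u); ring.
Qed.

End Vectors.

Section Hull.
Variables (R : realType) (I : finType) (p : I -> 'rV[R]_3).
Local Notation E3 := 'rV[R]_3.
Implicit Types (S : {set I}) (l : I -> R) (x n : E3).

(** Weights are defined on all of [I] and vanish off [S], so that one function can serve as weight
    for several sets and its support can be narrowed. *)
Definition weights S l : Prop :=
  [/\ forall i, 0 <= l i, forall i, i \notin S -> l i = 0 & \sum_i l i = 1].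

Definition bary l : E3 := \sum_i l i *: p i.

Definition hull S : set E3 := [set x | exists2 l, weights S l & x = bary l].

Definition pt_weight i : I -> R := fun j => (j == i)%:R.

Lemma bary_pt i : bary (pt_weight i) = p i.
Proof.
rewrite /bary (bigD1 i) //= /pt_weight eqxx scale1r big1 ?addr0 // => j /negPf->.
by rewrite scale0r.
Qed.

Lemma weights_pt S i : i \in S -> weights S (pt_weight i).
Proof.
move=> iS; split=> [j|j jS|]; first exact: ler0n.
  by rewrite /pt_weight; case: eqP jS iS => // -> /negP.
by rewrite (bigD1 i) //= /pt_weight eqxx big1 ?addr0 // => j /negPf->.
Qed.

Lemma hull_pt S i : i \in S -> hull S (p i).
Proof. by move=> iS; exists (pt_weight i); rewrite ?bary_pt //; apply: weights_pt. Qed.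

Lemma weightsS S1 S2 l : S1 \subset S2 -> weights S1 l -> weights S2 l.
Proof.
move=> S12 [l0 lS l1]; split=> // i iS; apply: lS.
by apply: contraNN iS => /(fintype.subsetP S12).
Qed.

Lemma hullS S1 S2 : S1 \subset S2 -> hull S1 `<=` hull S2.
Proof. by move=> S12 x [l wl ->]; exists l => //; apply: weightsS wl. Qed.

Lemma weights0 S l : weights S l -> S != finset.set0.
Proof.
case=> _ lS l1; apply/eqP => S0; move: l1; rewrite big1.
  by move/esym/eqP; rewrite oner_eq0.
by move=> i _; apply: lS; rewrite S0 inE.
Qed.

Lemma weights_conv S l l' t : 0 <= t <= 1 -> weights S l -> weights S l' ->
  weights S (fun i => (1 - t) * l i + t * l' i).
Proof.
move=> /andP[t0 t1] [a0 aS a1] [b0 bS b1]; split.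
- by move=> i; rewrite addr_ge0 // mulr_ge0 // subr_ge0.
- by move=> i iS; rewrite aS // bS // !mulr0 addr0.
by rewrite big_split /= -!mulr_sumr a1 b1; ring.
Qed.

Lemma bary_conv l l' t :
  bary (fun i => (1 - t) * l i + t * l' i) = (1 - t) *: bary l + t *: bary l'.
Proof.
rewrite /bary !scaler_sumr -big_split /=; apply: eq_bigr => i _.
by rewrite [LHS]scalerDl -!scalerA.
Qed.

Lemma hull_convex S x y t : 0 <= t <= 1 -> hull S x -> hull S y ->
  hull S ((1 - t) *: x + t *: y).
Proof.
move=> t01 [l wl ->] [l' wl' ->].
by exists (fun i => (1 - t) * l i + t * l' i); [exact: weights_conv|rewrite bary_conv].
Qed.

Definition convexly_closed (C : set E3) : Prop :=
  forall x y t, 0 <= t <= 1 -> C x -> C y -> C ((1 - t) *: x + t *: y).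

Lemma convex_setP (C : set E3) : convex_set C <-> convexly_closed C.
Proof.
split=> [cC x y t /andP[t0 t1] Cx Cy|cC x y t /[!inE] Cx Cy].
  have t0' : 0 <= 1 - t by rewrite subr_ge0.
  have t1' : 1 - t <= 1 by rewrite gerBl.
  have h : C ((1 - t) *: x + (1 - (1 - t)) *: y).
    by have := cC x y (Itv01 t0' t1'); rewrite !inE => /(_ Cx Cy).
  by move: h; rewrite subKr.
suff: C (t%:num *: x + (1 - t%:num) *: y) by [].
have -> : t%:num *: x = (1 - (1 - t%:num)) *: x by rewrite subKr.
by apply: cC => //; rewrite subr_ge0 le1 /= gerBl ge0.
Qed.

(** Induction on the size of [S]: a weight other than 1 is split off and the others are divided by
    [1 - l i], which leaves a combination of two points. *)
Lemma hull_sub_convex S (C : set E3) :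
  convexly_closed C -> (forall i, i \in S -> C (p i)) -> hull S `<=` C.
Proof.
move=> cC; elim: {S}_.+1 {-2}S (ltnSn #|S|) => // k IH S Sk CS x [l wl ->].
have [i iS] := set0Pn _ (weights0 wl); case: (wl) => l0 lS l1.
have [li1|li1] := eqVneq (l i) 1.
  rewrite (_ : bary l = p i); first exact: CS.
  rewrite -bary_pt; apply: eq_bigr => j _; congr (_ *: _); rewrite /pt_weight.
  have [->//|ji] := eqVneq j i; move: l1; rewrite (bigD1 i) //= li1.
  move=> l1'; apply: (psumr_eq0P (P := fun j => j != i) (F := l)) => //.
  by apply: (@addrI _ 1); rewrite addr0.
have sum1 : \sum_(j | j != i) l j = 1 - l i.
  by rewrite -l1 [X in _ = X - _](bigD1 i) //= addrAC subrr add0r.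
have li0 : 0 < 1 - l i.
  rewrite lt_def subr_eq0 eq_sym li1 -sum1; exact: sumr_ge0.
pose m j := if j == i then 0 else l j / (1 - l i).
have wm : weights (S :\ i)%SET m.
  split=> [j|j|]; rewrite ?/m.
  - by case: eqP => // _; rewrite divr_ge0 // ltW.
  - by rewrite finset.in_setD1; case: eqP => //= _ jS; rewrite lS // mul0r.
  rewrite (bigD1 i) //= eqxx add0r.
  rewrite (eq_bigr (fun j => l j / (1 - l i))) => [|j /negPf-> //].
  by rewrite -mulr_suml sum1 divff // gt_eqF.
rewrite (_ : bary l = (1 - (1 - l i)) *: p i + (1 - l i) *: bary m).
  apply: cC; [by rewrite ltW //= lerBlDr lerDl l0 | exact: CS |].
  apply: (IH (S :\ i)%SET); last by exists m.
    by move: Sk; rewrite (cardsD1 i) iS.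
  by move=> j; rewrite finset.in_setD1 => /andP[_ /CS].
rewrite /bary (bigD1 i) //= subKr; congr (_ + _).
rewrite scaler_sumr [RHS](bigD1 i) //= /m eqxx scale0r scaler0 add0r.
apply: eq_bigr => j /negPf->; rewrite scalerA mulrC divfK //.
by rewrite gt_eqF.
Qed.

Lemma convex_hull_eq S (A : set E3) :
  (forall i, i \in S -> A (p i)) -> A `<=` hull S -> convex_hull A = hull S.
Proof.
move=> AS SA; apply/seteqP; split=> x.
  by apply; split=> //; apply/convex_setP => ? ? ?; apply: hull_convex.
move=> hx C [/convex_setP cC AC]; apply: (hull_sub_convex cC) hx => i iS.
exact/AC/AS.
Qed.

Lemma dot_bary n l : dot n (bary l) = \sum_i l i * dot n (p i).
Proof. by rewrite dot_sumr; apply: eq_bigr => i _; rewrite dotZr. Qed.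

Lemma dot_bary_le S n b l : weights S l ->
  (forall i, i \in S -> dot n (p i) <= b) -> dot n (bary l) <= b.
Proof.
move=> [l0 lS l1] h; rewrite dot_bary -[b]mul1r -l1 mulr_suml.
apply: ler_sum => i _; have [/h|/lS->] := boolP (i \in S); last by rewrite !mul0r.
exact: ler_wpM2l.
Qed.

Lemma dot_bary_eq S n b l : weights S l ->
  (forall i, i \in S -> dot n (p i) = b) -> dot n (bary l) = b.
Proof.
move=> [l0 lS l1] h; rewrite dot_bary -[b]mul1r -l1 mulr_suml.
by apply: eq_bigr => i _; have [/h->|/lS->] := boolP (i \in S); rewrite ?mul0r.
Qed.

(** An average of numbers at most [b] equals [b] only if all numbers of nonzero weight do. This
    makes the faces of a hull spanned by vertices. *)
Lemma dot_bary_supp S n b l : weights S l ->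
  (forall i, i \in S -> dot n (p i) <= b) -> dot n (bary l) = b ->
  forall i, l i != 0 -> dot n (p i) = b.
Proof.
move=> [l0 lS l1] h e i li0.
have : \sum_i l i * (b - dot n (p i)) = 0.
  rewrite (eq_bigr (fun i => l i * b - l i * dot n (p i))) => [|j _]; last by rewrite mulrBr.
  by rewrite sumrB -mulr_suml l1 mul1r -dot_bary e subrr.
move/eqP; rewrite psumr_eq0 => [|j _]; last first.
  have [/h hj|/lS->] := boolP (j \in S); last by rewrite mul0r.
  by rewrite mulr_ge0 // subr_ge0.
move/allP/(_ i); rewrite mem_index_enum => /(_ isT) /=.
by rewrite mulf_eq0 (negPf li0) /= subr_eq0 => /eqP.
Qed.

Lemma dot_bary_ge S n b l : weights S l ->
  (forall i, i \in S -> b <= dot n (p i)) -> b <= dot n (bary l).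
Proof.
move=> wl h; rewrite -lerN2 -dotNl; apply: dot_bary_le wl _ => i iS.
by rewrite dotNl lerN2 h.
Qed.

Lemma dot_bary_supp_ge S n b l : weights S l ->
  (forall i, i \in S -> b <= dot n (p i)) -> dot n (bary l) = b ->
  forall i, l i != 0 -> dot n (p i) = b.
Proof.
move=> wl h e i li; apply: oppr_inj; rewrite -dotNl.
apply: (dot_bary_supp wl _ _ li) => [j jS|]; last by rewrite dotNl e.
by rewrite dotNl lerN2 h.
Qed.

Lemma weights_supp S (P : pred I) l : weights S l -> (forall i, l i != 0 -> P i) ->
  weights [set i in S | P i]%SET l.
Proof.
move=> [l0 lS l1] h; split=> // i; rewrite inE negb_and => /orP[/lS //|Pi].
by apply/eqP; apply: contraNT Pi => /h.
Qed.

Lemma hull_exposed S n b x : (forall i, i \in S -> dot n (p i) <= b) ->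
  hull S x -> dot n x = b -> hull [set i in S | dot n (p i) == b]%SET x.
Proof.
move=> h [l wl ->] e; exists l => //; apply: weights_supp => // i li.
exact/eqP/(dot_bary_supp wl h e).
Qed.

Lemma hull1 i : hull [set i]%SET = [set p i].
Proof.
apply/seteqP; split=> [x [l [l0 lS l1] ->]|x ->]; last by apply: hull_pt; rewrite inE.
have z j : j != i -> l j = 0 by move=> ji; apply: lS; rewrite inE.
have li : l i = 1 by rewrite -l1 (bigD1 i) //= big1 ?addr0 // => j /z.
by rewrite /bary (bigD1 i) //= big1 ?addr0 ?li ?scale1r // => j /z ->; rewrite scale0r.
Qed.

Lemma bary2 u v l : u != v -> weights [set u; v]%SET l ->
  l u = 1 - l v /\ bary l = (1 - l v) *: p u + l v *: p v.
Proof.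
move=> uv [l0 lS l1].
have z j : (j != u) && (j != v) -> l j = 0.
  by case/andP=> ju jv; apply: lS; rewrite !inE negb_or ju.
have lu : l u = 1 - l v.
  by rewrite -l1 (bigD1 u) //= (bigD1 v) 1?eq_sym //= big1 ?addr0 ?addrK // => j /z.
split=> //; rewrite /bary (bigD1 u) //= (bigD1 v) 1?eq_sym //= big1 ?addr0 ?lu //.
by move=> j /z ->; rewrite scale0r.
Qed.

Lemma segment_hull u v : segment (p u) (p v) = hull [set u; v]%SET.
Proof.
apply/seteqP; split=> [x [t + <-]|x].
  rewrite /= in_itv /= => t01; apply: hull_convex => //; apply: hull_pt;
  by rewrite !inE eqxx ?orbT.
have [->|uv [l wl ->]] := eqVneq u v.
  rewrite finset.setUid hull1 => ->; exists 0; rewrite ?subr0 ?scale1r ?scale0r ?addr0 //=.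
  by rewrite in_itv /= lexx ler01.
have [lu ->] := bary2 uv wl; exists (l v) => //=.
case: wl => l0 _ _; rewrite in_itv /= l0 -subr_ge0 -lu; exact: l0.
Qed.

Lemma hull2P u v x : hull [set u; v]%SET x <->
  exists2 t, 0 <= t <= 1 & x = p u + t *: (p v - p u).
Proof.
rewrite -segment_hull; split=> [[t + <-]|[t t01 ->]]; last exists t => /=.
- rewrite /= in_itv /= => t01; exists t => //.
  by rewrite scalerBr scalerBl scale1r -addrA; congr (_ + _); rewrite addrC.
- by rewrite in_itv.
by rewrite scalerBr scalerBl scale1r -addrA; congr (_ + _); rewrite addrC.
Qed.

(** * Points of a sphere are extreme *)

Section Sphere.
Variable r : R.
Hypothesis pr : forall i, dot (p i) (p i) = r.

(** Huygens' formula for the mean squared distance to the barycentre. Nonnegativity puts the hull in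
    the ball; vanishing forces every point of nonzero weight to be the barycentre itself. *)
Lemma sphere_bary S l : weights S l ->
  \sum_i l i * dot (p i - bary l) (p i - bary l) = r - dot (bary l) (bary l).
Proof.
move=> [l0 lS l1].
transitivity (\sum_i (l i * (r + dot (bary l) (bary l)) - l i * dot (bary l) (p i) *+ 2)).
  apply: eq_bigr => i _; rewrite dotBl !dotBr pr (dotC (p i)); ring.
rewrite sumrB -mulr_suml l1 sumrMnl -dot_bary; ring.
Qed.

Lemma sphere_ball S x : hull S x -> dot x x <= r.
Proof.
move=> [l wl ->]; rewrite -subr_ge0 -(sphere_bary wl).
by case: wl => l0 _ _; apply: sumr_ge0 => i _; rewrite mulr_ge0 // dot_ge0.
Qed.

Lemma sphere_extreme S l : weights S l -> dot (bary l) (bary l) = r ->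
  forall i, l i != 0 -> p i = bary l.
Proof.
move=> wl e i li; have := sphere_bary wl; rewrite e subrr => /eqP.
rewrite psumr_eq0 => [|j _]; last by case: wl => l0 _ _; rewrite mulr_ge0 // dot_ge0.
move/allP/(_ i); rewrite mem_index_enum => /(_ isT) /=.
by rewrite mulf_eq0 (negPf li) /= dot_eq0 subr_eq0 => /eqP.
Qed.

Lemma weights_neq0 S l : weights S l -> exists2 i, i \in S & l i != 0.
Proof.
move=> [l0 lS l1].
have [/existsP[i li]|/existsPn h] := boolP [exists i, l i != 0].
  by exists i => //; apply: contraNT li => /lS ->.
move: l1; rewrite big1 => [/esym/eqP|i _]; first by rewrite oner_eq0.
by apply/eqP; have := h i; rewrite negbK.
Qed.

Lemma sphere_hull_mem S i : injective p -> hull S (p i) -> i \in S.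
Proof.
move=> pI [l wl e]; have [j jS lj] := weights_neq0 wl.
have := @sphere_extreme _ _ wl; rewrite -e => /(_ (pr i) _ lj) /pI <-.
exact: jS.
Qed.

End Sphere.
End Hull.

(** * Polyhedra inscribed in a sphere *)

Section CyclicSequences.
Variable T : eqType.
Implicit Types (s : seq T) (u : T).

(** Starting the cycle at [u] turns walks around a face into inductions along a [path] while
    [next s] stays the same function. *)
Lemma next_unfold s u : uniq s -> (3 <= size s)%N -> u \in s ->
  exists v w t, [/\ next s u = v, next s v = w, uniq [:: u, v, w & t],
     s =i [:: u, v, w & t] & fcycle (next s) [:: u, v, w & t]].
Proof.
move=> us ss us'; have [i s' e] := rot_to us'.
have := size_rot i s; rewrite e; case: s' e => [|v [|w t]] e /= sz;
  try by rewrite -sz in ss.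
have uu : uniq [:: u, v, w & t] by rewrite -e rot_uniq.
exists v, w, t; rewrite -[next s]/(next s); split=> //.
- by rewrite -(next_rot i us) e /= eqxx.
- rewrite -(next_rot i us) e /= eqxx; case: eqP => // uv.
  by move: uu; rewrite uv /= inE eqxx.
- by move=> x; rewrite -e mem_rot.
apply: sub_cycle (cycle_next uu) => x y.
by rewrite -e /= next_rot.
Qed.

Lemma next_neq s u : uniq s -> (3 <= size s)%N -> u \in s ->
  [/\ next s u != u, next s (next s u) != u & next s (next s u) != next s u].
Proof.
move=> us ss /(next_unfold us ss)[v [w [t [-> -> h _ _]]]].
move: h; rewrite /= !inE !negb_or -!andbA => /and5P[a b _ c _].
by rewrite !(eq_sym _ u) a b eq_sym; split.
Qed.

Lemma perm_map_next s : uniq s -> perm_eq (map (next s) s) s.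
Proof.
move=> us; have ni := can_inj (prev_next us).
apply: uniq_perm => //; first by rewrite map_inj_uniq.
move=> x; apply/mapP/idP => [[y ys ->]|xs]; first by rewrite mem_next.
by exists (prev s x); rewrite ?mem_prev // next_prev.
Qed.

End CyclicSequences.

(** * Inscribed simple polygons are convex *)

Section Polygon.
Variables (R : realType) (M : map_data) (p : vert M -> 'rV[R]_3) (r : R).
Local Notation E3 := 'rV[R]_3.
Hypothesis pI : injective p.
Hypothesis pr : forall v, dot (p v) (p v) = r.
Implicit Types (f : face M) (u v w : vert M) (n x : E3).

(** Up to the length of [n], twice the signed area of the triangle on the side at [u] with apex [x];
    in the plane of the face it vanishes on the line of that side. *)
Definition side_form n f u x : R :=
  triple n (p (next (bdry f) u) - p u) (x - p u).

(* The normal [n] is such that the polygon turns left around it: the polygon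
   is convex. *)
Definition convex_normal n b f : Prop :=
  [/\ n != 0, forall v, v \in bdry f -> dot n (p v) = b &
     forall u w, u \in bdry f -> w \in bdry f -> w != u ->
       w != next (bdry f) u -> 0 < side_form n f u (p w)].

Section OneFace.
Variable f : face M.
Local Notation s := (bdry f).
Local Notation nx := (next s).
Hypothesis us : uniq s.
Hypothesis ss : (3 <= size s)%N.

Section Signs.
Hypothesis sp : simple_polygon p f.
Variables (n : E3) (b : R).
Hypothesis n0 : n != 0.
Hypothesis nb : forall v, v \in s -> dot n (p v) = b.
Local Notation el := (side_form n f).

Let nxs u : u \in s -> nx u \in s. Proof. by rewrite mem_next. Qed.

Let nd u v : u \in s -> v \in s -> dot n (p v - p u) = 0.
Proof. by move=> hu hv; rewrite dotBr !nb // subrr. Qed.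

Let d0 u : u \in s -> p (nx u) - p u != 0.
Proof.
move=> hu; rewrite subr_eq0; apply/eqP => /pI e.
by have [] := next_neq us ss hu; rewrite e eqxx.
Qed.

Lemma on_side_line u x : u \in s -> dot n x = b -> el u x = 0 ->
  exists t, x = p u + t *: (p (nx u) - p u).
Proof.
move=> hu nx0 e; have h : dot n (x - p u) = 0 by rewrite dotBr nx0 nb // subrr.
have := triple_eq0 n0 (d0 hu) (nd hu (nxs hu)) h e.
set t := (_ / _) => e'; exists t.
by rewrite -e' addrC subrK.
Qed.

(** A line meets the sphere in at most two points, and the line of the side already has its two ends
    there. *)
Lemma side_form_neq0 u w : u \in s -> w \in s -> w != u -> w != nx u ->
  el u (p w) != 0.
Proof.
move=> hu hw wu wv; apply/eqP => /(on_side_line hu (nb hw))[t e].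
have := sphere_chord t (pr u) (pr (nx u)); rewrite -e pr => /eqP.
rewrite -subr_eq0 opprB addrC subrK !mulf_eq0 dot_eq0 (negPf (d0 hu)) orbF.
case/orP => /eqP h; move: e.
  by rewrite h scale0r addr0 => /pI e; rewrite e eqxx in wu.
have -> : t = 1 by apply/esym/eqP; rewrite -subr_eq0 h.
by rewrite scale1r addrC subrK => /pI e; rewrite e eqxx in wv.
Qed.

(** By [sphere_chord], the part of the line of a side inside the ball is the side. *)
Lemma side_line_ball u x : u \in s -> dot n x = b -> el u x = 0 ->
  dot x x <= r -> hull p [set u; nx u]%SET x.
Proof.
move=> hu nxb e xr; have [t xt] := on_side_line hu nxb e.
apply/hull2P; exists t => //; move: xr.
rewrite xt (sphere_chord _ (pr _) (pr _)) gerBl => h.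
have dd : 0 < dot (p (nx u) - p u) (p (nx u) - p u) by rewrite dot_gt0 d0.
move: h; rewrite (pmulr_lge0 _ dd) => h; nra.
Qed.

Lemma side_form_aff u x y t :
  el u (x + t *: (y - x)) = (1 - t) * el u x + t * el u y.
Proof. by rewrite /side_form !tripleBr tripleDr tripleZr tripleBr; ring. Qed.

(** A side with ends on different sides of the line of [u] crosses that line at a point of the ball,
    hence on the side at [u]; in a simple polygon two sides without a common end do not meet. *)
Lemma side_form_same_sign u w : u \in s -> w \in s ->
  w != u -> w != nx u -> nx w != u -> nx w != nx u ->
  0 < el u (p w) * el u (p (nx w)).
Proof.
move=> hu hw wu wv w'u w'v; rewrite lt_def mulf_neq0 ?side_form_neq0 ?nxs //=.
rewrite leNgt; apply/negP => neg.
set E := el u (p w) in neg *; set E' := el u (p (nx w)) in neg *.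
have EE' : E - E' != 0 by apply/eqP => h; nra.
(* The parameter at which the affine function with end values [E] and [E'] vanishes. *)
pose t := E / (E - E'); have tE : t * (E - E') = E by rewrite /t divfK.
have t01 : 0 <= t <= 1.
  have q : 0 < (E - E') ^+ 2 by rewrite lt_def sqr_ge0 andbT sqrf_eq0.
  have h1 : t * (E - E') ^+ 2 = E * (E - E') by rewrite expr2 mulrA tE.
  by apply/andP; split; nra.
pose z := p w + t *: (p (nx w) - p w).
have hz : hull p [set w; nx w]%SET z by apply/hull2P; exists t.
have ez : el u z = 0.
  by rewrite side_form_aff -/E -/E'; move: tE; lra.
have nz : dot n z = b.
  by rewrite /z dotDr dotZr dotBr !nb ?nxs // subrr mulr0 addr0.
have := side_line_ball hu nz ez (sphere_ball pr hz).
rewrite -segment_hull => h1; rewrite -segment_hull in hz.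
have uw : u != w by rewrite eq_sym.
have [+ _] := (seteqP (edge_segment p f u `&` edge_segment p f w) _).1 (sp hu hw uw).
case/(_ z); first by split.
move=> y [[]-> []e _].
- by rewrite e eqxx in wu.
- by rewrite e eqxx in w'u.
- by rewrite e eqxx in wv.
- by rewrite e eqxx in w'v.
Qed.

Lemma side_form_path u w t : u \in s -> path (frel nx) w t ->
  {subset w :: t <= [predD s & [:: u; nx u]]} ->
  forall y, y \in w :: t -> 0 < el u (p w) * el u (p y).
Proof.
move=> hu; elim: t w => [|w' t IH] w /=.
  move=> _ /(_ w); rewrite !inE eqxx => /(_ isT) /andP[+ ws] y /[!inE]/eqP->.
  rewrite negb_or => /andP[a b'].
  by rewrite -expr2 lt_def sqr_ge0 sqrf_eq0 side_form_neq0.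
case/andP=> /eqP ww' pt sub y.
have [wu ws] : w \notin [:: u; nx u] /\ w \in s.
  by have := sub w; rewrite inE eqxx => /(_ isT)/[!inE]/andP[].
have [wu' ws'] : w' \notin [:: u; nx u] /\ w' \in s.
  by have := sub w'; rewrite !inE eqxx orbT => /(_ isT)/andP[].
move: wu wu'; rewrite !inE !negb_or => /andP[a1 a2] /andP[a3 a4].
case/predU1P => [->|yt].
  by rewrite -expr2 lt_def sqr_ge0 sqrf_eq0 side_form_neq0.
have h1 : 0 < el u (p w) * el u (p w').
  by rewrite -ww' side_form_same_sign // ww'.
have sub' : {subset w' :: t <= [predD s & [:: u; nx u]]}.
  by move=> x xt; apply: sub; rewrite inE xt orbT.
have h2 := IH _ pt sub' _ yt.
have := mulr_gt0 h1 h2; rewrite mulrACA [X in X * _]mulrC -mulrA => h.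
have q : 0 < el u (p w') ^+ 2.
  by rewrite lt_def sqr_ge0 sqrf_eq0 side_form_neq0.
by nra.
Qed.

Let sg u := el u (p (nx (nx u))).

Lemma side_form_others u w : u \in s -> w \in s -> w != u -> w != nx u ->
  0 < sg u * el u (p w).
Proof.
move=> hu hw wu wv; have [v [w0 [t [e1 e2 ut st ct]]]] := next_unfold us ss hu.
rewrite /sg e1 e2; move: ct => /= /and3P[_ _]; rewrite rcons_path => /andP[pt _].
apply: (side_form_path hu pt).
  move=> x xt; rewrite inE /= !inE e1 st !inE.
  rewrite inE in xt; rewrite xt !orbT andbT.
  move: ut; rewrite /= !inE !negb_or -!andbA => /and5P[a b' c d /andP[f' _]].
  case/predU1P: xt => [->|xt]; first by rewrite !(eq_sym w0) b' d.
  by apply/andP; split; apply: contraTneq xt => ->.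
by move: hw; rewrite st !inE (negPf wu) -e1 (negPf wv).
Qed.

(** Three consecutive vertices span a triangle whose signed area is the same seen from the first or
    the second side. So the direction of turning passes from one side to the next. *)
Lemma side_sign_next u : u \in s -> 0 < sg u * sg (nx u).
Proof.
move=> hu; have hv := nxs hu; have [a1 a2 a3] := next_neq us ss hu.
have := side_form_others hv hu; rewrite eq_sym a1 eq_sym a2 => /(_ isT isT).
suff -> : el (nx u) (p u) = sg u by rewrite mulrC.
rewrite /sg /side_form !tripleBr.
set A := p u; set B := p (nx u); set C := p (nx (nx u)).
by rewrite /triple !dotE !mxE /= ?mxE; ring.
Qed.

Lemma side_sign_all u w : u \in s -> w \in s -> 0 < sg u * sg w.
Proof.
move=> hu; have [v [w0 [t [_ _ ut st ct]]]] := next_unfold us ss hu.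
rewrite st; move: ct; rewrite /= -/(path (frel nx) u (v :: rcons (w0 :: t) u)).
move=> ct wt.
have sq (x : vert M) : x \in s -> 0 < sg x * sg x.
  move=> hx; have [a1 a2 a3] := next_neq us ss hx.
  by rewrite -expr2 lt_def sqr_ge0 sqrf_eq0 side_form_neq0 // !nxs.
have gen (x : vert M) q : path (frel nx) x q -> {subset x :: q <= s} ->
    forall y, y \in x :: q -> 0 < sg x * sg y.
  elim: q x => [|x' q IH] x /=.
    by move=> _ sub y /[!inE]/eqP->; apply: sq; apply: sub; rewrite inE.
  case/andP=> /eqP xx' pq sub y /predU1P[->|yq].
    by apply: sq; apply: sub; rewrite inE eqxx.
  have xs : x \in s by apply: sub; rewrite inE eqxx.
  have h1 := side_sign_next xs; rewrite xx' in h1.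
  have sub' : {subset x' :: q <= s} by move=> z zq; apply: sub; rewrite inE zq orbT.
  have h2 := IH _ pq sub' _ yq.
  have h3 : 0 < sg x' * sg x' by apply: sq; apply: sub'; rewrite inE eqxx.
  by have := mulr_gt0 h1 h2; nra.
apply: (gen u (v :: rcons (w0 :: t) u)) => //.
  move=> x; rewrite st !inE mem_rcons !inE.
  by case/or3P => [->|->|/or3P[->|->|->]]; rewrite ?orbT.
by move: wt; rewrite !inE mem_rcons !inE => /or4P[->|->|->|->]; rewrite ?orbT.
Qed.

End Signs.

Hypothesis sp : simple_polygon p f.
Hypothesis pl : planar p f.

Lemma exists_convex_normal : exists n b, convex_normal n b f.
Proof.
have [n [b [n0 nb]]] := pl.
have [u0 hu0] : exists u, u \in s.
  by case: (s) ss => // u t _; exists u; rewrite inE eqxx.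
pose sg u := side_form n f u (p (nx (nx u))).
have sgn u : u \in s -> 0 < sg u0 * sg u by move=> hu; exact: (side_sign_all sp n0 nb hu0 hu).
have oth u w : u \in s -> w \in s -> w != u -> w != nx u ->
    0 < sg u * side_form n f u (p w) by exact: (side_form_others sp n0 nb).
have [pos|neg] := ltP 0 (sg u0).
  exists n, b; split=> // u w hu hw wu wv.
  have := sgn u hu; have := oth u w hu hw wu wv; rewrite (pmulr_rgt0 _ pos) => h1 h2.
  by move: h1; rewrite pmulr_rgt0.
(* All turns are to the right here, so the opposite normal is taken. *)
exists (- n), (- b); split; first by rewrite oppr_eq0.
  by move=> v hv; rewrite -scaleN1r dotZl nb // mulN1r.
move=> u w hu hw wu wv; rewrite /side_form tripleNl -/(side_form n f u (p w)).
have su : sg u < 0.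
  by rewrite ltNge; apply/negP => h; have := sgn u hu; rewrite ltNge mulr_le0_ge0.
by rewrite oppr_gt0 -(nmulr_rgt0 _ su); exact: oth.
Qed.

End OneFace.
End Polygon.

(** * The disk bounded by a convex polygon *)

Section Region.
Variables (R : realType) (M : map_data) (p : vert M -> 'rV[R]_3) (r : R).
Local Notation E3 := 'rV[R]_3.
Hypothesis pI : injective p.
Hypothesis pr : forall v, dot (p v) (p v) = r.
Variable f : face M.
Local Notation s := (bdry f).
Local Notation nx := (next s).
Hypothesis us : uniq s.
Hypothesis ss : (3 <= size s)%N.
Variables (n : E3) (b : R).
Hypothesis cn : convex_normal p n b f.
Local Notation el := (side_form p n f).
Implicit Types (u v w : vert M) (x y : E3).

Let n0 : n != 0. Proof. by case: cn. Qed.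
Let nb v : v \in s -> dot n (p v) = b. Proof. by case: cn => _ + _; apply. Qed.
Let nxs u : u \in s -> nx u \in s. Proof. by rewrite mem_next. Qed.

Let d0 u : u \in s -> p (nx u) - p u != 0.
Proof.
move=> hu; rewrite subr_eq0; apply/eqP => /pI e.
by have [] := next_neq us ss hu; rewrite e eqxx.
Qed.

Definition side_normal u := cross n (p (nx u) - p u).

Lemma side_formE u x : el u x = dot (side_normal u) x - dot (side_normal u) (p u).
Proof. by rewrite /side_form triple_dot dotBr. Qed.

Lemma side_form0 u : el u (p u) = 0.
Proof. by rewrite side_formE subrr. Qed.

Lemma side_form_next u : el u (p (nx u)) = 0.
Proof. exact: triplevv. Qed.

Lemma side_form_vert u w : u \in s -> w \in s -> 0 <= el u (p w).
Proof.
move=> hu hw; have [->|wu] := eqVneq w u; first by rewrite side_form0.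
have [->|wv] := eqVneq w (nx u); first by rewrite side_form_next.
by case: cn => _ _ h; apply/ltW/h.
Qed.

Lemma side_form_hull u x : u \in s -> hull p (face_verts f) x -> 0 <= el u x.
Proof.
move=> hu [l wl ->]; rewrite side_formE subr_ge0.
apply: dot_bary_ge wl _ => w; rewrite inE => hw.
by rewrite -subr_ge0 -side_formE side_form_vert.
Qed.

Lemma side_form_supp u l : u \in s -> weights (face_verts f) l ->
  el u (bary p l) = 0 -> forall i, l i != 0 -> i \in [set u; nx u]%SET.
Proof.
move=> hu wl /eqP; rewrite side_formE subr_eq0 => /eqP e i li.
have iS : i \in s.
  by case: wl => _ lS _; apply: contraNT li => hi; rewrite lS // inE.
have h w : w \in face_verts f -> dot (side_normal u) (p u) <= dot (side_normal u) (p w).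
  by rewrite inE => hw; rewrite -subr_ge0 -side_formE side_form_vert.
have e2 := dot_bary_supp_ge wl h e li.
have : el u (p i) = 0 by rewrite side_formE e2 subrr.
rewrite !inE; apply: contra_eqT; rewrite negb_or => /andP[a1 a2].
by rewrite gt_eqF //; case: cn => _ _; apply.
Qed.

(** The side vectors of a closed polygon add up to zero, so the linear part of the sum vanishes. *)
Lemma sum_side_form x y : \sum_(u <- s) el u x = \sum_(u <- s) el u y.
Proof.
apply/eqP; rewrite -subr_eq0 -sumrB; apply/eqP.
transitivity (\sum_(u <- s) (dot (cross (x - y) n) (p (nx u)) - dot (cross (x - y) n) (p u))).
  apply: eq_bigr => u _; rewrite -dotBr /side_form -tripleBr opprB addrA subrK.
  by rewrite /triple !dotE !mxE /= ?mxE; ring.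
rewrite sumrB -(big_map nx predT (fun v => dot (cross (x - y) n) (p v))) /=.
by rewrite (perm_big _ (perm_map_next us)) subrr.
Qed.

(** The forms of the two sides at [nx u] are affine coordinates in the plane of the face, with
    origin at that vertex. *)
Lemma plane_coords x u : u \in s -> dot n x = b ->
  el (nx u) (p u) *: (x - p (nx u)) =
  el (nx u) x *: (p u - p (nx u)) + el u x *: (p (nx (nx u)) - p (nx u)).
Proof.
move=> hu xb; have hv := nxs hu; have hw := nxs hv.
set v := nx u; set w := nx v.
have nd y z : dot n y = b -> dot n z = b -> dot n (y - z) = 0.
  by move=> ey ez; rewrite dotBr ey ez subrr.
have := triple_cramer n0 (nd _ _ (nb hu) (nb hv)) (nd _ _ (nb hw) (nb hv))
  (nd _ _ xb (nb hv)).
have -> : triple n (p u - p v) (p w - p v) = - el v (p u).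
  by rewrite /side_form -/v -/w /triple !dotE !mxE /= ?mxE; ring.
have -> : triple n (x - p v) (p w - p v) = - el v x.
  by rewrite /side_form -/v -/w /triple !dotE !mxE /= ?mxE; ring.
have -> : triple n (p u - p v) (x - p v) = - el u x.
  by rewrite /side_form -/v -/w /triple !dotE !mxE /= ?mxE; ring.
by rewrite !scaleNr -opprD => /oppr_inj.
Qed.

Lemma side_pos u : u \in s -> 0 < el (nx u) (p u).
Proof.
move=> hu; have [a1 a2 a3] := next_neq us ss hu.
by case: cn => _ _; apply; rewrite ?nxs // eq_sym.
Qed.

(** On the line of the side, with parameter [t], the form of the preceding side gives [0 <= t] and
    that of the following side [t <= 1]. *)
Lemma polygon_side x u : u \in s -> dot n x = b ->
  (forall v, v \in s -> 0 <= el v x) -> el u x = 0 -> polygon p f x.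
Proof.
move=> hu xb pos e0; exists u => //; rewrite /edge_segment segment_hull.
have [t xt] := on_side_line pI us ss n0 nb hu xb e0.
apply/hull2P; exists t => //.
have aff v : el v x = (1 - t) * el v (p u) + t * el v (p (nx u)).
  by rewrite xt side_form_aff.
have [a1 a2 a3] := next_neq us ss hu.
apply/andP; split.
- have hu' : prev s u \in s by rewrite mem_prev.
  have e : nx (prev s u) = u by rewrite next_prev.
  have := pos _ hu'; rewrite aff -{2}e side_form_next mulr0 add0r.
  rewrite pmulr_lge0 //; case: cn => _ _; apply => //; rewrite ?nxs ?e //.
  by apply/eqP => h; move: a2; rewrite h e eqxx.
- have := pos _ (nxs hu); rewrite aff side_form0 mulr0 addr0.
  by rewrite pmulr_lge0 ?side_pos // subr_ge0.
Qed.

Lemma face_plane_dot x : face_plane p f x -> dot n x = b.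
Proof. by apply; exact: nb. Qed.

Lemma hull_face_plane x : hull p (face_verts f) x -> face_plane p f x.
Proof.
move=> [l wl ->] a c h; apply: dot_bary_eq wl _ => i; rewrite inE; exact: h.
Qed.

Lemma polygon_hull : polygon p f `<=` hull p (face_verts f).
Proof.
move=> x [u hu]; rewrite /edge_segment segment_hull; apply: hullS.
by apply/fintype.subsetP => v; rewrite !inE => /orP[]/eqP-> //; apply: nxs.
Qed.

Lemma open_side_forms (q : seq (vert M)) : open [set x | forall u, u \in q -> 0 < el u x].
Proof.
elim: q => [|u q IH].
  by rewrite (_ : [set x | _] = setT); [exact: openT|apply/seteqP; split].
rewrite (_ : [set x | _] =
  dot (side_normal u) @^-1` [set y | dot (side_normal u) (p u) < y] `&`
  [set x | forall u, u \in q -> 0 < el u x]).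
  apply: openI => //; apply: open_comp; last exact: open_gt.
  by move=> x _; exact: continuous_dot.
apply/seteqP; split=> x /= => [h|[h1 h2] v].
  split=> [|v vq]; last by apply: h; rewrite inE vq orbT.
  by rewrite -subr_gt0 -side_formE; apply: h; rewrite inE eqxx.
by move=> /predU1P[->|/h2 //]; rewrite side_formE subr_gt0.
Qed.

Lemma closed_side_forms (q : seq (vert M)) : closed [set x | forall u, u \in q -> 0 <= el u x].
Proof.
elim: q => [|u q IH].
  by rewrite (_ : [set x | _] = setT); [exact: closedT|apply/seteqP; split].
rewrite (_ : [set x | _] =
  dot (side_normal u) @^-1` [set y | dot (side_normal u) (p u) <= y] `&`
  [set x | forall u, u \in q -> 0 <= el u x]).
  apply: closedI => //; apply: closed_comp; last exact: closed_ge.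
  by move=> x _; exact: continuous_dot.
apply/seteqP; split=> x /= => [h|[h1 h2] v].
  split=> [|v vq]; last by apply: h; rewrite inE vq orbT.
  by rewrite -subr_ge0 -side_formE; apply: h; rewrite inE eqxx.
by move=> /predU1P[->|/h2 //]; rewrite side_formE subr_ge0.
Qed.

Let some_vertex : exists u, u \in s.
Proof. by case: (s) ss => // u t _; exists u; rewrite inE eqxx. Qed.

(** The forms have a constant sum [K], which may be evaluated at the origin even off the plane.
    Inside the polygon each form thus lies between 0 and [K], and two of them are affine
    coordinates. *)
Lemma inside_bounded :
  bounded_set [set x | dot n x = b /\ forall u, u \in s -> 0 <= el u x].
Proof.
have [u hu] := some_vertex; set v := nx u; set w := nx v.
pose K := \sum_(u <- s) el u 0.
exists (`|p v| + (`|el v (p u)|^-1 * (K * `|p u - p v| + K * `|p w - p v|))).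
split=> [|B KB x [xb pos] /=]; first exact: num_real.
apply: le_trans (ltW KB).
have elK z : z \in s -> 0 <= el z x <= K.
  move=> hz; rewrite pos //= /K (sum_side_form _ x) (perm_big _ (perm_to_rem hz)) big_cons /=.
  by rewrite lerDl big_seq; apply: sumr_ge0 => y /mem_rem; apply: pos.
rewrite -{1}[x](subrK (p v)) addrC (le_trans (ler_normD _ _)) // lerD2l.
have D := side_pos hu; rewrite -/v in D.
have -> : x - p v = (el v (p u))^-1 *: (el v x *: (p u - p v) + el u x *: (p w - p v)).
  by rewrite -plane_coords // scalerA mulVf ?scale1r // gt_eqF.
rewrite normrZ normfV ler_pM // ?invr_ge0 //.
have /andP[a0 aK] := elK _ (nxs hu); have /andP[b0 bK] := elK _ hu.
rewrite (le_trans (ler_normD _ _)) // !normrZ lerD // ler_wpM2r //.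
  by rewrite (ger0_norm a0).
by rewrite (ger0_norm b0).
Qed.

(** The component of an inner point cannot leave the polygon, because the first form to vanish on
    the way out would do so at a point of the boundary. *)
Lemma hull_sub_region : hull p (face_verts f) `<=` region p f.
Proof.
move=> z hz; have [|zP] := pselect (polygon p f z); first by left.
have zb := face_plane_dot (hull_face_plane hz).
right; split; first by split => //; exact: hull_face_plane.
set X := face_plane p f `\` polygon p f.
have Xz : X z by split => //; exact: hull_face_plane.
set C := connected_component X z.
have CX : C `<=` X by exact: connected_component_sub.
have pos x : X x -> (forall u, u \in s -> 0 <= el u x) ->
    forall u, u \in s -> 0 < el u x.
  move=> [xp xP] h u hu; rewrite lt_def h // andbT; apply/eqP => e.
  by apply: xP; apply: polygon_side hu _ h e; exact: face_plane_dot.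
have hz0 u : u \in s -> 0 <= el u z by move=> hu; exact: side_form_hull.
(* On [X] the conditions [0 < el u x] for all [u] and [0 <= el u x] for all [u] agree, so they cut
   out a subset of [C] that is both open and closed. *)
have e : C `&` [set x | forall u, u \in s -> 0 < el u x] = C.
  apply: (@component_connected _ X z).
  - by exists z; split; [exact: connected_component_refl|exact: pos].
  - by exists [set x | forall u, u \in s -> 0 < el u x] => //; exact: open_side_forms.
  - exists [set x | forall u, u \in s -> 0 <= el u x]; first exact: closed_side_forms.
    apply/seteqP; split=> x [Cx h]; split=> // u hu; first exact/ltW/h.
    by apply: pos hu => //; exact: CX.
have [K [Kr KB]] := inside_bounded; exists K; split=> // B hB x.
rewrite -/C -e => -[Cx hx]; apply: (KB B hB); split=> [|u /hx/ltW //].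
by have [/face_plane_dot] := CX _ Cx.
Qed.

(** The parallel through [x] to a side that has [x] on its outer side never meets the hull, so it
    lies in the component of [x]. *)
Lemma outside_unbounded x u : u \in s -> face_plane p f x -> el u x < 0 ->
  ~ bounded_set (connected_component (face_plane p f `\` polygon p f) x).
Proof.
move=> hu xp neg; set X := _ `\` _; set d := p (nx u) - p u.
have dne : d != 0 := d0 hu.
pose g (t : R) : E3 := x + t *: d.
have gX t : X (g t).
  split=> [a c h|/polygon_hull/(side_form_hull hu)].
    by rewrite dotDr dotZr dotBr !h ?nxs // subrr mulr0 addr0; exact: xp.
  rewrite leNgt => /negP; apply; rewrite /g side_formE dotDr dotZr -/d.
  suff -> : dot (side_normal u) d = 0 by rewrite mulr0 addr0 -side_formE.
  by rewrite -triple_dot triplevv.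
have gc : continuous g.
  move=> t; apply: cvgD; first exact: cvg_cst.
  by apply: cvgZr_tmp; exact: cvg_id.
have gC : range g `<=` connected_component X x.
  apply: connected_component_max.
  - by exists 0 => //; rewrite /g scale0r addr0.
  - by move=> _ [t _ <-].
  - apply: connected_continuous_connected; last exact: continuous_subspaceT.
    by apply/connected_intervalP => a c.
case=> K [_ KB].
have {KB} bd t : `|g t| <= `|K| + 1.
  apply: (KB (`|K| + 1)); last by apply: gC; exists t.
  by rewrite (le_lt_trans (ler_norm K)) // ltrDl.
(* Chosen so that [g t] has norm at least [|K| + 2], beyond the bound [|K| + 1]. *)
pose t := (`|x| + `|K| + 2) / `|d|.
have nd : 0 < `|d| by rewrite normr_gt0.
have : `|t *: d| <= `|g t| + `|x|.
  by rewrite (_ : t *: d = g t - x) ?ler_normB // /g addrAC subrr add0r.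
have := bd t; rewrite normrZ ger0_norm ?divr_ge0 // ?addr_ge0 //.
rewrite divfK ?gt_eqF // => h1 h2; lra.
Qed.

(** A point with bounded component has nonnegative side forms. In a triangle, the forms divided by
    their constant sum are the barycentric coordinates, each belonging to the vertex opposite to its
    side. *)
Lemma region_triangle : size s = 3%N -> region p f = hull p (face_verts f).
Proof.
move=> s3; apply/seteqP; split; last exact: hull_sub_region.
move=> x [/polygon_hull //|[[xp xP] xbd]].
have pos u : u \in s -> 0 <= el u x.
  by move=> hu; rewrite leNgt; apply/negP => neg; exact: (outside_unbounded hu xp neg xbd).
have [u hu] := some_vertex; have [v [w [t [e1 e2 ut st ct]]]] := next_unfold us ss hu.
have t0 : t = [::].
  have := perm_size (uniq_perm us ut st); rewrite s3.
  by case: (t).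
rewrite {}t0 in ut st ct.
have e3 : nx w = u by move: ct; rewrite /= => /and4P[_ _ /eqP].
have [hv hw] : v \in s /\ w \in s by rewrite !st !inE !eqxx !orbT.
have ps : perm_eq s [:: u; v; w] by apply: uniq_perm.
have sm y : el u y + el v y + el w y = el v (p u).
  have z : el w (p u) = 0 by rewrite -e3 side_form_next.
  rewrite -addrA; have := sum_side_form y (p u).
  by rewrite !(perm_big _ ps) !big_cons !big_nil /= side_form0 z add0r !addr0 => ->.
have D : 0 < el v (p u) by rewrite -e1; exact: side_pos.
have Dn : el v (p u) != 0 by rewrite gt_eqF.
have := plane_coords hu (face_plane_dot xp); rewrite e1 e2 => h.
have uvw : [/\ u != v, u != w & v != w].
  by move: ut; rewrite /= !inE negb_or => /and3P[/andP[-> ->] -> _].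
case: uvw => uv uw vw.
pose l i := (if i == u then el v x else if i == v then el w x
             else if i == w then el u x else 0) / el v (p u).
exists l.
  split=> [i|i|]; rewrite ?/l.
  - by apply: divr_ge0; [do 3?case: ifP => // _; exact: pos | exact: ltW].
  - by rewrite inE st !inE !negb_or => /and3P[/negPf-> /negPf-> /negPf->]; rewrite mul0r.
  rewrite -mulr_suml (bigD1 u) //= (bigD1 v) 1?eq_sym //= (bigD1 w) /=; last first.
    by rewrite eq_sym uw eq_sym vw.
  rewrite big1 => [|i /andP[/andP[/negPf-> /negPf->] /negPf->] //].
  rewrite eqxx (eq_sym v) (negPf uv) eqxx !(eq_sym w) (negPf uw) (negPf vw) eqxx addr0.
  have -> : el v x + (el w x + el u x) = el v (p u) by rewrite -(sm x); ring.
  by rewrite divff.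
have -> : bary p l = (el v (p u))^-1 *: (el v x *: p u + el w x *: p v + el u x *: p w).
  rewrite /bary (bigD1 u) //= (bigD1 v) 1?eq_sym //= (bigD1 w) /=; last first.
    by rewrite eq_sym uw eq_sym vw.
  rewrite big1 => [|i /andP[/andP[/negPf a1 /negPf a2] /negPf a3]]; last first.
    by rewrite /l a1 a2 a3 mul0r scale0r.
  rewrite /l eqxx (eq_sym v) (negPf uv) eqxx !(eq_sym w) (negPf uw) (negPf vw) eqxx addr0.
  by rewrite !scalerDr !scalerA !(mulrC (_^-1)) addrA.
apply: (@scalerI _ _ (el v (p u))) => //; rewrite scalerA divff // scale1r.
move/eqP: h; rewrite !scalerBr subr_eq => /eqP ->.
rewrite -(sm x); move: (el u x) (el v x) (el w x) => A B C.
by apply: vecP; rewrite !mxE; ring.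
Qed.
End Region.

(** * Faces of an inscribed polyhedron *)

Section Polyhedron.
Variables (R : realType) (M : map_data) (p : vert M -> 'rV[R]_3) (r : R).
Local Notation E3 := 'rV[R]_3.
Hypothesis hp : polyhedron p.
Hypothesis pr : forall v, dot (p v) (p v) = r.
Implicit Types (f g : face M) (u v w : vert M).

Lemma polyhedron_inj : injective p. Proof. by case: hp. Qed.
Lemma polyhedron_map : polyhedral_map M. Proof. by case: hp. Qed.
Lemma face_uniq f : uniq (bdry f).
Proof. by case: polyhedron_map => /(_ f)[]. Qed.
Lemma face_size f : (3 <= size (bdry f))%N.
Proof. by case: polyhedron_map => /(_ f)[]. Qed.

Lemma face_convex_normal f : exists n b, convex_normal p n b f.
Proof.
have [_ pI /(_ f)[pl sp] _] := hp.
exact: (exists_convex_normal pI pr (face_uniq f) (face_size f) sp pl).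
Qed.

Lemma hull_face_region f : hull p (face_verts f) `<=` region p f.
Proof.
have [n [b cn]] := face_convex_normal f.
exact: (hull_sub_region polyhedron_inj (face_uniq f) (face_size f) cn).
Qed.

Lemma face_edgeP f (e : {set vert M}) :
  e \in face_edges f -> exists2 u, u \in bdry f & e = [set u; next (bdry f) u]%SET.
Proof. by case/imsetP => u; exists u. Qed.

Lemma face_edge_sub f e : e \in face_edges f -> e \subset face_verts f.
Proof.
case/face_edgeP => u hu ->; apply/fintype.subsetP => v; rewrite !inE.
by case/orP => /eqP->//; rewrite mem_next.
Qed.

(** The form of the side vanishes at the point and is positive at all vertices off the edge, so
    these have weight 0. *)
Lemma edge_supp f (e : {set vert M}) l l' : e \in face_edges f ->
  weights (face_verts f) l -> weights e l' -> bary p l = bary p l' ->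
  forall i, l i != 0 -> i \in e.
Proof.
case/face_edgeP => u hu -> wl wl' el i; have [n [b cn]] := face_convex_normal f.
apply: (side_form_supp cn hu wl).
rewrite el side_formE (dot_bary_eq wl' (b := dot (side_normal p f n u) (p u))) ?subrr //.
move=> j; rewrite !inE => /orP[]/eqP-> //.
apply/eqP; rewrite -subr_eq0 -side_formE; apply/eqP; exact: side_form_next.
Qed.

(* Points of a sphere are extreme, so a common point of two faces that lies in
   the hulls of disjoint sets of vertices is neither a common vertex nor on a
   common edge. *)
Lemma disjoint_hulls f g (A B : {set vert M}) l l' : f != g ->
  A \subset face_verts f -> B \subset face_verts g ->
  weights A l -> weights B l' -> bary p l = bary p l' ->
  (forall i, i \in A -> i \in B -> False) -> False.
Proof.
move=> fg Af Bg wl wl' e nAB.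
have zf : region p f (bary p l).
  by apply: hull_face_region; exists l => //; apply: weightsS wl.
have zg : region p g (bary p l).
  by apply: hull_face_region; exists l' => //; apply: weightsS wl'.
have pI := polyhedron_inj.
have ext S m v : weights S m -> bary p m = p v -> v \in S.
  by move=> wm em; apply: (sphere_hull_mem pr pI); exists m.
have [_ _ _ /(_ f g fg)[e0|[v [_ _ e0]]|[u [v [cuv e0]]]]] := hp.
- by have : (region p f `&` region p g) (bary p l) by []; rewrite e0.
- have : (region p f `&` region p g) (bary p l) by [].
  rewrite e0 => ev; apply: (nAB v); apply: ext; [exact: wl|exact: ev|exact: wl'|].
  by rewrite -e.
have : (region p f `&` region p g) (bary p l) by [].
rewrite e0 segment_hull => -[m wm em].
move: cuv; rewrite /common_edge finset.in_setI => /andP[ef eg].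
have sf := edge_supp ef (weightsS Af wl) wm em.
have sg := edge_supp eg (weightsS Bg wl') wm (etrans (esym e) em).
have [i iA li] := weights_neq0 wl; have [j jB lj] := weights_neq0 wl'.
have iuv := sf i li; have juv := sg j lj.
have ij : i != j by apply/eqP => h; apply: (nAB i iA); rewrite h.
(* Both supports lie in the edge, which has two ends, and they are disjoint: the first is [i] alone.
   Then the point is [p i], an extreme point, so [i] lies in [B] too. *)
have only k : l k != 0 -> k = i.
  move=> lk; have := sf k lk; move: iuv juv (elimN eqP ij); rewrite !inE.
  have kA : k \in A by case: wl => _ lS _; apply: contraNT lk => /lS->.
  have kj : k <> j by move=> h; apply: (nAB k kA); rewrite h.
  by move=> /orP[]/eqP hi /orP[]/eqP hj hij /orP[]/eqP hk; congruence.
have wi : weights [set i]%SET l.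
  case: wl => l0 lS l1; split=> // k; rewrite inE => ki.
  by apply/eqP; apply: contraNT ki => /only->.
have : hull p [set i]%SET (bary p l) by exists l.
rewrite hull1 => ei; have := ext _ _ i wl' (etrans (esym e) ei).
exact: nAB.
Qed.

(** Here [f] and [g] may be equal. Two diagonals of one face may cross, but nothing in the face
    crosses an edge: this is how edges and diagonals are told apart. *)
Lemma edge_disjoint_hull f g (A B : {set vert M}) l l' :
  A \in face_edges f -> B \subset face_verts g ->
  weights A l -> weights B l' -> bary p l = bary p l' ->
  (forall i, i \in A -> i \in B -> False) -> False.
Proof.
move=> ef Bg wl wl' e dAB.
have [fg|] := eqVneq f g; last first.
  move=> fg; exact: (disjoint_hulls fg (face_edge_sub ef) Bg wl wl' e dAB).
rewrite -fg in Bg.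
have [j jB lj] := weights_neq0 wl'.
have := edge_supp ef (weightsS Bg wl') wl (esym e) lj.
by move=> jA; exact: dAB jA jB.
Qed.

(** Distinct faces share at most the two ends of an edge, while a face has three vertices or
    more. *)
Lemma face_verts_inj : injective (@face_verts M).
Proof.
move=> f g e; apply/eqP; apply/negP => /negP fg.
have [_ _ _ _ /(_ f g fg)] := polyhedron_map.
rewrite /= -e finset.setIid.
have cf : (3 <= #|face_verts f|)%N.
  by rewrite cardsE (card_uniqP (face_uniq f)) face_size.
case=> [h|]; first by move: (leq_trans cf h).
rewrite finset.in_setI => /andP[/face_edgeP[u _ h] _].
by move: cf; rewrite h cards2; case: eqP.
Qed.

Lemma card_face_edges f : #|face_edges f| = size (bdry f).
Proof.
rewrite card_in_imset; first exact/card_uniqP/face_uniq.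
move=> u v hu hv e; have us := face_uniq f; have ss := face_size f.
have : u \in [set v; next (bdry f) v]%SET by rewrite -e !inE eqxx.
rewrite !inE => /orP[/eqP //|/eqP uv].
have : v \in [set u; next (bdry f) u]%SET by rewrite e !inE eqxx.
rewrite !inE => /orP[/eqP //|/eqP vu].
by have [_] := next_neq us ss hu; rewrite -vu -uv eqxx.
Qed.

Lemma double_count : (\sum_(f : face M) size (bdry f) = #|edges M| * 2)%N.
Proof.
have [_ [_ two _] _ _ _] := polyhedron_map.
rewrite (eq_bigr (fun f => \sum_(e in edges M | e \in face_edges f) 1)%N) => [|f _]; last first.
  rewrite -card_face_edges -sum1_card; apply: eq_bigl => e.
  by rewrite andb_idl // => ef; apply/bigcupP; exists f.
rewrite (exchange_big_dep (mem (edges M))) //=; last by move=> f e _ /andP[].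
rewrite -sum_nat_const; apply: eq_bigr => e eE.
rewrite sum1dep_card -(two e eE); apply: eq_card => f.
by rewrite !inE eE.
Qed.

End Polyhedron.

(** * Tetrahedral rotations in an adapted frame *)

(* A signed permutation of the three coordinates sends [i] to a sign ([true]
   for minus) and an index.  The rotation of index [4 * q + j] shifts the
   coordinates cyclically by [q] and then changes the two signs of index other
   than [j - 1] (none if [j = 0]). *)
Definition signed := nat -> bool * nat.

Definition rotation (k : nat) : signed := fun i =>
  let j := (k %% 4)%N in ((0 < j)%N && (i.+1 != j), ((i + k %/ 4) %% 3)%N).

Definition compose (m m' : signed) : signed := fun i =>
  ((m i).1 (+) (m' (m i).2).1, (m' (m i).2).2).

Definition same3 (m m' : signed) : bool :=
  [&& m 0 == m' 0, m 1 == m' 1 & m 2 == m' 2]%N.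

Definition swap01 : signed := fun i => (false, nth 0 [:: 1; 0; 2] i)%N.
Definition swap12 : signed := fun i => (false, nth 0 [:: 0; 2; 1] i)%N.
Definition flip_sign (j : nat) : signed := fun i => (i == j, i).

(** The group law, tabulated for fast computation: row [g], column [j] is the index of [rotation g]
    after [rotation j]. Rotation [g] thus carries the vertex labelled [j] to the one labelled
    [mul12 g j]. *)
Definition mul12_table : seq (seq nat) :=
  [:: [:: 0; 1; 2; 3; 4; 5; 6; 7; 8; 9; 10; 11];
      [:: 1; 0; 3; 2; 5; 4; 7; 6; 9; 8; 11; 10];
      [:: 2; 3; 0; 1; 6; 7; 4; 5; 10; 11; 8; 9];
      [:: 3; 2; 1; 0; 7; 6; 5; 4; 11; 10; 9; 8];
      [:: 4; 7; 5; 6; 8; 11; 9; 10; 0; 3; 1; 2];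
      [:: 5; 6; 4; 7; 9; 10; 8; 11; 1; 2; 0; 3];
      [:: 6; 5; 7; 4; 10; 9; 11; 8; 2; 1; 3; 0];
      [:: 7; 4; 6; 5; 11; 8; 10; 9; 3; 0; 2; 1];
      [:: 8; 10; 11; 9; 0; 2; 3; 1; 4; 6; 7; 5];
      [:: 9; 11; 10; 8; 1; 3; 2; 0; 5; 7; 6; 4];
      [:: 10; 8; 9; 11; 2; 0; 1; 3; 6; 4; 5; 7];
      [:: 11; 9; 8; 10; 3; 1; 0; 2; 7; 5; 4; 6]]%N.

Definition mul12 (g j : nat) : nat := nth 0%N (nth [::] mul12_table g) j.

Lemma all_iotaP (n : nat) (P : pred nat) :
  reflect (forall k, (k < n)%N -> P k) (all P (iota 0 n)).
Proof.
apply: (iffP allP) => h k; first by move=> kn; apply: h; rewrite mem_iota.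
by rewrite mem_iota add0n; exact: h.
Qed.

Lemma mul12_table_check :
  all (fun g => all (fun j => (mul12 g j < 12)%N &&
    same3 (rotation (mul12 g j)) (compose (rotation g) (rotation j))) (iota 0 12)) (iota 0 12).
Proof. by vm_compute. Qed.

Lemma mul12_lt g j : (g < 12)%N -> (j < 12)%N -> (mul12 g j < 12)%N.
Proof.
by move=> hg hj; move/all_iotaP/(_ g hg)/all_iotaP/(_ j hj)/andP: mul12_table_check => -[].
Qed.

Lemma rotation_mul g j : (g < 12)%N -> (j < 12)%N ->
  same3 (rotation (mul12 g j)) (compose (rotation g) (rotation j)).
Proof.
by move=> hg hj; move/all_iotaP/(_ g hg)/all_iotaP/(_ j hj)/andP: mul12_table_check => -[].
Qed.

Section SignedAction.
Variable V : zmodType.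
Implicit Types (x : nat -> V) (m : signed).

Definition sgn (b : bool) (v : V) : V := if b then - v else v.

Definition mv m x : nat -> V := fun i => sgn (m i).1 (x (m i).2).

Lemma sgn_sgn b b' v : sgn b (sgn b' v) = sgn (b (+) b') v.
Proof. by case: b b' => [] [] //=; rewrite opprK. Qed.

Lemma mv_compose m m' x i : mv m (mv m' x) i = mv (compose m m') x i.
Proof. by rewrite /mv sgn_sgn. Qed.

End SignedAction.

Section Frames.
Variable R : realType.
Local Notation E3 := 'rV[R]_3.
Implicit Types (e : nat -> E3) (q : nat -> R) (A : 'M[R]_3) (m : signed).

Definition lin e q : E3 := q 0%N *: e 0%N + q 1%N *: e 1%N + q 2%N *: e 2%N.

Definition ip q q' : R := q 0%N * q' 0%N + q 1%N * q' 1%N + q 2%N * q' 2%N.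

(** Allowing any squared length [c] avoids square roots: sums of two vertices of the tetrahedron
    serve as axes without normalization. *)
Definition frame e (c : R) : Prop :=
  0 < c /\ forall i j, (i < 3)%N -> (j < 3)%N -> dot (e i) (e j) = if i == j then c else 0.

Definition acts e A k : Prop := forall q, lin e q *m A = lin e (mv (rotation k) q).

Definition unitq (i : nat) : nat -> R := fun j => (j == i)%:R.

Lemma lin_ext e q q' : q 0%N = q' 0%N -> q 1%N = q' 1%N -> q 2%N = q' 2%N -> lin e q = lin e q'.
Proof. by rewrite /lin => -> -> ->. Qed.

Lemma lin_same3 e q m m' : same3 m m' -> lin e (mv m q) = lin e (mv m' q).
Proof. by case/and3P => /eqP a /eqP b /eqP c; apply: lin_ext; rewrite /mv ?a ?b ?c. Qed.

Lemma lin_unit e i : (i < 3)%N -> lin e (unitq i) = e i.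
Proof.
by case: i => [|[|[|//]]] _;
  rewrite /lin /unitq /= ?scale1r ?scale0r ?addr0 ?add0r.
Qed.

Lemma lin_mulmx e q A : lin e q *m A = lin (fun i => e i *m A) q.
Proof. by rewrite /lin !mulmxDl -!scalemxAl. Qed.

Lemma ip_rotation k q q' : ip (mv (rotation k) q) (mv (rotation k) q') = ip q q'.
Proof.
have s b (u v : R) : sgn b u * sgn b v = u * v by case: b => /=; rewrite ?mulrNN.
have r2 i : (rotation k i).2 = ((i + (k %/ 4) %% 3) %% 3)%N by rewrite /= modnDmr.
rewrite /ip /mv !s !r2.
have : ((k %/ 4) %% 3 < 3)%N by rewrite ltn_pmod.
by case: ((k %/ 4) %% 3)%N => [|[|[|//]]] _; rewrite /modn /=; ring.
Qed.

Section OneFrame.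
Variables (e : nat -> E3) (c : R).
Hypothesis fr : frame e c.

Lemma dot_lin q q' : dot (lin e q) (lin e q') = c * ip q q'.
Proof.
have [_ d] := fr; rewrite /lin !(dotDl, dotDr, dotZl, dotZr) !d // /ip /=; ring.
Qed.

(** The square of the triple product is the Gram determinant of the axes, here [c ^+ 3]. *)
Lemma triple_frame : triple (e 0%N) (e 1%N) (e 2%N) != 0.
Proof.
have [c0 d] := fr; set a := e 0%N; set b := e 1%N; set f := e 2%N.
have h : triple a b f ^+ 2 = dot a a * (dot b b * dot f f - dot b f ^+ 2)
   - dot a b * (dot a b * dot f f - dot b f * dot a f)
   + dot a f * (dot a b * dot b f - dot b b * dot a f).
  by rewrite /triple !dotE !mxE /=; ring.
rewrite -sqrf_eq0 h /a /b /f !d //= gt_eqF // !(mulr0, mul0r, expr0n, subr0, addr0) /=.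
by rewrite !mulr_gt0.
Qed.

Lemma frame_basis v : v = lin e (fun i => dot v (e i) / c).
Proof.
have [c0 d] := fr; have cn : c != 0 by rewrite gt_eqF.
apply/eqP; rewrite -subr_eq0; apply/eqP; set w := _ - _.
have w0 i : (i < 3)%N -> dot w (e i) = 0.
  rewrite -{2}[i]/i => hi; rewrite /w dotBl.
  by case: i hi => [|[|[|//]]] hi; rewrite /lin !(dotDl, dotZl) !d //= !mulr0 ?addr0 ?add0r divfK // subrr.
have h : triple (e 0%N) (e 1%N) (e 2%N) *: w =
    dot w (e 0%N) *: cross (e 1%N) (e 2%N) + dot w (e 1%N) *: cross (e 2%N) (e 0%N)
    + dot w (e 2%N) *: cross (e 0%N) (e 1%N).
  by rewrite /triple; apply: vecP; rewrite !dotE !mxE /= ?mxE; ring.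
move: h; rewrite !w0 // !scale0r !addr0 => /eqP.
by rewrite scaler_eq0 (negPf triple_frame) => /eqP.
Qed.

Lemma lin_inj q q' : lin e q = lin e q' -> forall i, (i < 3)%N -> q i = q' i.
Proof.
move=> h i hi; have [c0 _] := fr; have cn : c != 0 by rewrite gt_eqF.
have := congr1 (fun v => dot v (lin e (unitq i))) h.
rewrite !dot_lin => /(mulfI cn).
by case: i hi => [|[|[|//]]] _; rewrite /ip /unitq /= !mulr0 !mulr1 ?addr0 ?add0r.
Qed.

Lemma acts_isometry A k : acts e A k -> linear_isometry A.
Proof.
by move=> h x y; rewrite (frame_basis x) (frame_basis y) !h !dot_lin ip_rotation.
Qed.

(** A sum of rank-one matrices: the term of index [i] sends [e i] to its image and the other two
    axes to zero. *)
Definition rotation_mx k : 'M[R]_3 :=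
  \sum_(i < 3) c^-1 *: ((e i)^T *m lin e (mv (rotation k) (unitq i))).

Lemma rotation_mxP k : acts e (rotation_mx k) k.
Proof.
move=> q; have [c0 d] := fr; have cn : c != 0 by rewrite gt_eqF.
have h i (w : E3) : (i < 3)%N -> lin e q *m (c^-1 *: ((e i)^T *m w)) = q i *: w.
  move=> hi; rewrite -scalemxAr mulmxA (mx11_scalar (_ *m (e i)^T)) mul_scalar_mx.
  rewrite scalerA -/(dot _ _) -(lin_unit e hi) dot_lin mulKf //; congr (_ *: _).
  by case: i hi => [|[|[|//]]] _; rewrite /ip /unitq /=; ring.
rewrite mulmx_sumr big_ord3 !h // /lin.
have f b (j : nat) : (j < 3)%N ->
    q 0%N * sgn b (unitq 0 j) + q 1%N * sgn b (unitq 1 j) + q 2%N * sgn b (unitq 2 j) = sgn b (q j).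
  by case: j => [|[|[|//]]] _; case: b; rewrite /unitq /=; ring.
have r3 i : ((rotation k i).2 < 3)%N by rewrite /= ltn_pmod.
have {}f i : q 0%N * mv (rotation k) (unitq 0) i + q 1%N * mv (rotation k) (unitq 1) i +
    q 2%N * mv (rotation k) (unitq 2) i = mv (rotation k) q i by exact: f.
rewrite -!f; move: (mv _ (unitq 0)) (mv _ (unitq 1)) (mv _ (unitq 2)) => x y z.
by apply: vecP; rewrite !mxE; ring.
Qed.

End OneFrame.

Lemma det3E A : \det A = triple (row i0 A) (row i1 A) (row i2 A).
Proof.
rewrite (expand_det_row _ i0) big_ord3 /cofactor.
have d2 (B : 'M[R]_2) : \det B = B 0 0 * B 1 1 - B 0 1 * B 1 0.
  rewrite (expand_det_row _ 0) !big_ord_recl big_ord0 /cofactor !det_mx11 !mxE /=.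
  rewrite (_ : lift 0 0 = 1); last exact/val_inj.
  rewrite (_ : lift 1 0 = 0); last exact/val_inj.
  by rewrite /= expr0 expr1; ring.
rewrite !d2 !mxE /triple dotE !mxE /=.
have l00 : lift i0 0 = i1 by apply/val_inj.
have l01 : lift i0 1 = i2 by apply/val_inj.
have l10 : lift i1 0 = i0 by apply/val_inj.
have l11 : lift i1 1 = i2 by apply/val_inj.
have l20 : lift i2 0 = i0 by apply/val_inj.
have l21 : lift i2 1 = i1 by apply/val_inj.
by rewrite !(l00, l01, l10, l11, l20, l21) /= expr0 expr1 sqrrN expr1n; ring.
Qed.

Lemma row_mulE (v : E3) A : v *m A = v 0 i0 *: row i0 A + v 0 i1 *: row i1 A + v 0 i2 *: row i2 A.
Proof. by rewrite mulmx_sum_row big_ord3. Qed.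

Lemma triple_mulmx (x y z : E3) A :
  triple (x *m A) (y *m A) (z *m A) = triple x y z * \det A.
Proof.
rewrite det3E !row_mulE; move: (row i0 A) (row i1 A) (row i2 A) => a b c.
by rewrite /triple !dotE !mxE /=; ring.
Qed.

Lemma triple_lin e q q' q'' : triple (lin e q) (lin e q') (lin e q'') =
  (q 0%N * (q' 1%N * q'' 2%N - q' 2%N * q'' 1%N) + q 1%N * (q' 2%N * q'' 0%N - q' 0%N * q'' 2%N)
   + q 2%N * (q' 0%N * q'' 1%N - q' 1%N * q'' 0%N)) * triple (e 0%N) (e 1%N) (e 2%N).
Proof. by rewrite /lin /triple !dotE !mxE /=; ring. Qed.

Lemma triple_rotation e k : (k < 12)%N ->
  triple (lin e (mv (rotation k) (unitq 0))) (lin e (mv (rotation k) (unitq 1)))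
    (lin e (mv (rotation k) (unitq 2))) = triple (e 0%N) (e 1%N) (e 2%N).
Proof.
move=> hk; rewrite triple_lin -[RHS]mul1r; congr (_ * _).
do 12![case: k hk => [_|k hk]; first by rewrite /mv /rotation /unitq /=; ring].
by [].
Qed.

Lemma acts_det e c A k : frame e c -> (k < 12)%N -> acts e A k -> \det A = 1.
Proof.
move=> fr hk h; apply: (mulfI (triple_frame fr)); rewrite -triple_mulmx mulr1.
by rewrite -!(lin_unit e (_ : _ < 3)%N) // !h triple_rotation // !lin_unit.
Qed.

(** Moving the axes by [m] moves coordinates by the inverse of [m]; the second hypothesis says that
    [rotation k] is this inverse. *)
Lemma lin_signed_inverse e m k : (forall i, (i < 3)%N -> ((m i).2 < 3)%N) ->
  (forall i, (i < 3)%N -> rotation k (m i).2 = ((m i).1, i)) ->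
  forall q, lin (mv m e) q = lin e (mv (rotation k) q).
Proof.
move: (rotation k) => rot m3 h q; have := h 0%N isT; have := h 1%N isT; have := h 2%N isT.
have := m3 0%N isT; have := m3 1%N isT; have := m3 2%N isT.
have sc b (x : R) (v : E3) : x *: sgn b v = sgn b x *: v.
  by case: b; rewrite //= scalerN scaleNr.
rewrite /lin /mv !sc.
case: (m 0%N) => b0 m0; case: (m 1%N) => b1 m1; case: (m 2%N) => b2 m2 /=.
case: m0 => [|[|[|//]]]; case: m1 => [|[|[|//]]]; case: m2 => [|[|[|//]]] _ _ _ h2 h1 h0;
  try (by congruence); rewrite h0 h1 h2 /=;
  by apply: vecP; rewrite !mxE; ring.
Qed.

End Frames.

Section HullMaps.
Variable R : realType.
Local Notation E3 := 'rV[R]_3.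

Lemma hull_convexly_closed (I : finType) (p : I -> E3) S : convexly_closed (hull p S).
Proof. by move=> x y t; exact: hull_convex. Qed.

Lemma hull_imset (I J : finType) (p : J -> E3) (phi : I -> J) (S : {set I}) :
  hull p (phi @: S) = hull (p \o phi) S.
Proof.
apply/seteqP; split; apply: hull_sub_convex; try exact: hull_convexly_closed.
  by move=> _ /imsetP[i iS ->]; exact: (hull_pt (p \o phi)).
by move=> i iS; apply: hull_pt; exact: imset_f.
Qed.

Lemma act_hull (I : finType) (p : I -> E3) A S :
  act A (hull p S) = hull (fun i => p i *m A) S.
Proof.
have e l : bary p l *m A = bary (fun i => p i *m A) l.
  by rewrite /bary mulmx_suml; apply: eq_bigr => i _; rewrite scalemxAl.
apply/seteqP; split=> [_ [_ [l wl ->] <-]|_ [l wl ->]]; first by exists l.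
by exists (bary p l) => //; exists l.
Qed.

Lemma convex_hull_range (I : finType) (p : I -> E3) :
  convex_hull (range p) = hull p [set: I]%SET.
Proof.
apply: convex_hull_eq => [i _|_ [i _ <-]]; first by exists i.
exact: hull_pt.
Qed.

End HullMaps.

(** The sum of the vertices [a] and [b] as a signed axis. The four vertices add up to zero, so an
    edge without vertex 0 gives minus the axis of the opposite edge, which joins 0 to [6 - (a + b)]
    and has index one less. *)
Definition tetra_edge (a b : nat) : bool * nat :=
  if a == 0%N then (false, b.-1) else if b == 0%N then (false, a.-1) else (true, (5 - (a + b))%N).

(* Every permutation of the vertices of the tetrahedron, or else its composite
   with the reflection exchanging the first two coordinates, is a rotation. *)
Lemma tetra_perm_rotation :
  all (fun a => all (fun b => all (fun c => all (fun d =>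
    uniq [:: a; b; c; d] ==>
    let nu i := tetra_edge a (nth 0 [:: b; c; d] i)%N in
    let nu' i := nu (swap01 i).2 in
    has (fun k => all (fun i => rotation k (nu i).2 == ((nu i).1, i)) (iota 0 3)
               || all (fun i => rotation k (nu' i).2 == ((nu' i).1, i)) (iota 0 3)) (iota 0 12))
  (iota 0 4)) (iota 0 4)) (iota 0 4)) (iota 0 4).
Proof. by vm_compute. Qed.

Lemma rotation_tetra_vertex :
  all (fun k => all (fun j => has (fun i => (mul12 k i %% 4 == j)%N) (iota 0 4)) (iota 0 4))
    (iota 0 12).
Proof. by vm_compute. Qed.

Section Tetrahedron.
Variable R : realType.
Local Notation E3 := 'rV[R]_3.
Variable t : 'I_4 -> E3.
Hypothesis reg : regular_tetrahedron t.
Hypothesis cen : centered t.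

Local Notation tt k := (t (inord k)).

Definition tetra_axis (i : nat) : E3 := tt 0%N + tt i.+1.

Lemma ord4P (P : 'I_4 -> Prop) : P (inord 0) -> P (inord 1) -> P (inord 2) -> P (inord 3) ->
  forall i, P i.
Proof.
move=> h0 h1 h2 h3 i; rewrite -(inord_val i).
by case: i => [[|[|[|[|//]]]] hi].
Qed.

Lemma tetra_sum : tt 0%N + tt 1%N + tt 2%N + tt 3%N = 0.
Proof.
rewrite -cen !big_ord_recl big_ord0 addr0 !addrA.
by congr (t _ + t _ + t _ + t _); apply/val_inj; rewrite /= inordK.
Qed.

(** Six squared distances and four products with the zero sum of the vertices form a linear system
    for the ten inner products. If [d] is the squared edge length, they are [3 * d / 8] and
    [- d / 8]. *)
Lemma tetra_dots : exists2 d : R, 0 < d & forall i j : nat, (i < 4)%N -> (j < 4)%N ->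
  dot (tt i) (tt j) = if i == j then 3 * d else - d.
Proof.
have [d d0 h] := reg; exists (d / 8); first by rewrite divr_gt0.
have ne (i j : nat) : (i < j < 4)%N ->
    dot (tt i) (tt i) + dot (tt j) (tt j) - 2 * dot (tt i) (tt j) = d.
  case/andP=> ij j4; rewrite -(h (inord i) (inord j)).
    rewrite !(dotBl, dotBr) (dotC (tt j) (tt i)); ring.
  apply/eqP => /(congr1 val); rewrite /= !inordK // ?(ltn_trans ij) // => e.
  by rewrite e ltnn in ij.
have s i : dot (tt i) (tt 0%N) + dot (tt i) (tt 1%N) + dot (tt i) (tt 2%N) + dot (tt i) (tt 3%N) = 0.
  by rewrite -!dotDr tetra_sum dot0r.
have := s 0%N; have := s 1%N; have := s 2%N; have := s 3%N.
have := ne 0 1 isT; have := ne 0 2 isT; have := ne 0 3 isT.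
have := ne 1 2 isT; have := ne 1 3 isT; have := ne 2 3 isT.
rewrite (dotC (tt 1%N) (tt 0%N)) (dotC (tt 2%N) (tt 0%N)) (dotC (tt 3%N) (tt 0%N)).
rewrite (dotC (tt 2%N) (tt 1%N)) (dotC (tt 3%N) (tt 1%N)) (dotC (tt 3%N) (tt 2%N)).
do 10!move=> ?; by case=> [|[|[|[|//]]]] [|[|[|[|//]]]] _ _ /=; first [lra | rewrite dotC; lra].
Qed.

Lemma tetra_frame : exists c, frame tetra_axis c.
Proof.
have [d d0 h] := tetra_dots; exists (4 * d); split=> [|i j]; first by rewrite mulr_gt0.
rewrite /tetra_axis; case: i j => [|[|[|//]]] [|[|[|//]]] _ _ /=;
  rewrite !(dotDl, dotDr) !h //=; ring.
Qed.

Definition halfq : nat -> R := fun=> 2^-1.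

Lemma tetra_lin (j : nat) : (j < 4)%N -> tt j = lin tetra_axis (mv (rotation j) halfq).
Proof.
have e := tetra_sum; have two : (2 : R) != 0 by rewrite pnatr_eq0.
move=> hj; apply: (scalerI two); rewrite /lin.
have -> : 2 *: (mv (rotation j) halfq 0%N *: tetra_axis 0%N + mv (rotation j) halfq 1%N *: tetra_axis 1%N +
     mv (rotation j) halfq 2%N *: tetra_axis 2%N) =
  sgn (rotation j 0%N).1 (tetra_axis 0%N) + sgn (rotation j 1%N).1 (tetra_axis 1%N) + sgn (rotation j 2%N).1 (tetra_axis 2%N).
  have f b i v : 2 *: (sgn b (halfq i) *: v) = sgn b v :> E3.
    by rewrite /halfq scalerA; case: b; rewrite /= ?mulrN divff // ?scale1r ?scaleN1r.
  by rewrite 2!scalerDr /mv !f.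
case: j hj => [|[|[|[|//]]]] _; rewrite /rotation /=; move: e; rewrite /tetra_axis;
  move: (tt 0) (tt 1) (tt 2) (tt 3) => a b f g /eqP; rewrite addrC addr_eq0 => /eqP ->;
  by apply: vecP; rewrite !mxE; ring.
Qed.

(** Cyclic shifts fix the diagonal vector [halfq], so a vertex of the tetrahedron depends only on
    the signs, that is, on the label modulo 4. *)
Lemma halfq_mod m i : mv (rotation (m %% 4)) halfq i = mv (rotation m) halfq i.
Proof. by rewrite /mv /rotation /= modn_mod. Qed.

Lemma acts_tetra A k j : (k < 12)%N -> (j < 4)%N -> acts tetra_axis A k ->
  tt j *m A = tt (mul12 k j %% 4)%N.
Proof.
move=> hk hj h; have j12 : (j < 12)%N by apply: ltn_trans hj _.
rewrite tetra_lin // h [RHS]tetra_lin ?ltn_pmod //.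
rewrite -[RHS](@lin_ext _ _ (mv (rotation (mul12 k j)) halfq)) ?halfq_mod //.
rewrite (lin_same3 _ _ (rotation_mul hk j12)).
by apply: lin_ext; rewrite mv_compose.
Qed.

Lemma acts_tetrahedral_rotation A k : (k < 12)%N -> acts tetra_axis A k ->
  tetrahedral_rotation t A.
Proof.
move=> hk h; have [c fr] := tetra_frame; split.
- exact: acts_isometry fr _ _ h.
- exact: acts_det fr hk h.
rewrite convex_hull_range act_hull.
apply/seteqP; split; apply: hull_sub_convex; try exact: hull_convexly_closed.
  move=> i _; rewrite -(inord_val i) (acts_tetra hk _ h) //.
  exact: hull_pt.
move=> j _; have := rotation_tetra_vertex => /all_iotaP/(_ k hk)/all_iotaP/(_ j (ltn_ord j)).
case/hasP => i; rewrite mem_iota /= add0n => hi /eqP e.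
rewrite -(inord_val j) -e -(acts_tetra hk hi h).
exact: (hull_pt (fun i => t i *m A)).
Qed.

Lemma tetra_edge_sum (a b : nat) : (a < 4)%N -> (b < 4)%N -> a != b ->
  ((tetra_edge a b).2 < 3)%N /\
  tt a + tt b = sgn (tetra_edge a b).1 (tetra_axis (tetra_edge a b).2).
Proof.
have := tetra_sum; rewrite /tetra_axis /tetra_edge => e.
case: a => [|[|[|[|//]]]]; case: b => [|[|[|[|//]]]] // _ _ _; split=> //=; try by rewrite addrC.
all: rewrite -[LHS]addr0 -[X in _ + X]oppr0 -e; apply: vecP; rewrite !mxE; ring.
Qed.

(** An isometry preserving the solid tetrahedron sends each vertex to a point of maximal norm of the
    hull, hence to a vertex. So it permutes the vertices, and the axes up to sign. *)
Lemma tetrahedral_rotation_acts A : tetrahedral_rotation t A ->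
  exists2 k, (k < 12)%N & acts tetra_axis A k.
Proof.
case=> iso detA hA; have [c fr] := tetra_frame; have [d d0 dots] := tetra_dots.
have sphere i : dot (t i) (t i) = 3 * d.
  by rewrite -(inord_val i) dots // eqxx.
have img (j : nat) : exists2 a : nat, (a < 4)%N & tt j *m A = tt a.
  have : convex_hull (range t) (tt j *m A).
    by rewrite -hA; exists (tt j) => //; rewrite convex_hull_range; apply: hull_pt.
  rewrite convex_hull_range => -[l wl e]; have [i _ li] := weights_neq0 wl.
  exists i => //; rewrite inord_val e (sphere_extreme sphere wl _ li) //.
  by rewrite -e iso sphere.
have inj (i j a b : nat) : (i < 4)%N -> (j < 4)%N -> i != j ->
    tt i *m A = tt a -> tt j *m A = tt b -> a != b.
  move=> hi hj ij ei ej; apply/eqP => ab; rewrite -ab in ej.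
  have h1 := iso (tt i) (tt j); have h2 := iso (tt i) (tt i).
  rewrite ei ej in h1; rewrite ei in h2.
  by rewrite h2 !dots // eqxx (negPf ij) in h1; lra.
have [a ha ea] := img 0%N; have [b hb eb] := img 1%N.
have [f hf ef] := img 2%N; have [g hg eg] := img 3%N.
have ab := inj 0%N 1%N _ _ isT isT isT ea eb; have af := inj 0%N 2%N _ _ isT isT isT ea ef.
have ag := inj 0%N 3%N _ _ isT isT isT ea eg; have bf := inj 1%N 2%N _ _ isT isT isT eb ef.
have bg := inj 1%N 3%N _ _ isT isT isT eb eg; have fg := inj 2%N 3%N _ _ isT isT isT ef eg.
have un : uniq [:: a; b; f; g] by rewrite /= !inE !negb_or ab af ag bf bg fg.
pose nu (i : nat) := tetra_edge a (nth 0%N [:: b; f; g] i).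
have nuB i : (i < 3)%N -> ((nu i).2 < 3)%N /\ tetra_axis i *m A = mv nu tetra_axis i.
  move=> hi; rewrite mulmxDl ea /mv /nu.
  by case: i hi => [|[|[|//]]] _; rewrite ?eb ?ef ?eg; apply: tetra_edge_sum.
have n3 i (hi : (i < 3)%N) := proj1 (nuB i hi).
have nuE i (hi : (i < 3)%N) := proj2 (nuB i hi).
have := tetra_perm_rotation.
move=> /all_iotaP/(_ a ha)/all_iotaP/(_ b hb)/all_iotaP/(_ f hf)/all_iotaP/(_ g hg).
rewrite un => /hasP[k]; rewrite mem_iota => /= hk; case/orP => hnu.
  have {}hnu i : (i < 3)%N -> rotation k (nu i).2 = ((nu i).1, i).
    by case: i => [|[|[|//]]] _; apply/eqP; case/and4P: hnu.
  exists k => // q; rewrite lin_mulmx -(lin_signed_inverse _ n3 hnu).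
  by rewrite /lin !nuE.
(* The odd permutations: determinant 1 would make the triple product of the axes equal to its own
   opposite. *)
have hnu' i : (i < 3)%N -> rotation k (nu (swap01 i).2).2 = ((nu (swap01 i).2).1, i).
  by case: i => [|[|[|//]]] _; apply/eqP; case/and4P: hnu.
pose nu' i := nu (swap01 i).2.
have nu3 i : (i < 3)%N -> ((nu' i).2 < 3)%N.
  by case: i => [|[|[|//]]] _; rewrite /nu' /=; apply: n3.
have r := lin_signed_inverse tetra_axis nu3 hnu'.
have := triple_rotation tetra_axis hk; rewrite -!r !lin_unit // /mv /nu' /=.
have := triple_mulmx (tetra_axis 0%N) (tetra_axis 1%N) (tetra_axis 2%N) A.
rewrite detA mulr1 !nuE // /mv => e1 e2.
have sw (x y z : E3) : triple x y z = - triple y x z.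
  by rewrite /triple !dotE !mxE /=; ring.
rewrite sw e1 in e2.
have T0 : triple (tetra_axis 0%N) (tetra_axis 1%N) (tetra_axis 2%N) = 0 by lra.
by have := triple_frame fr; rewrite T0 eqxx.
Qed.

End Tetrahedron.

(** * Sign certificates for circuits *)

(* Polynomials in [c], [v], [u] as lists of (exponents, coefficient); the
   coordinates [a >= b >= c >= 0] are written [a = c + v + u] and [b = c + v],
   so that nonnegative coefficients certify a sign. *)
Definition monomial : Type := nat * nat * nat.
Definition poly3 : Type := seq (monomial * int).

Fixpoint add_term (m : monomial) (x : int) (p : poly3) : poly3 :=
  if p is (m', y) :: p' then
    if m == m' then (m, x + y) :: p' else (m', y) :: add_term m x p'
  else [:: (m, x)].

Definition padd (p p' : poly3) : poly3 := foldr (fun t => add_term t.1 t.2) p' p.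
Definition pscale (m : monomial) (x : int) (p : poly3) : poly3 :=
  [seq ((m.1.1 + t.1.1.1, m.1.2 + t.1.1.2, m.2 + t.1.2)%N, x * t.2) | t <- p].
Definition popp (p : poly3) : poly3 := pscale (0, 0, 0)%N (-1) p.
Definition psub (p p' : poly3) : poly3 := padd p (popp p').
Definition pmul (p p' : poly3) : poly3 := foldr (fun t => padd (pscale t.1 t.2 p')) [::] p.

Section Det.
Variables (T : Type) (ad sb ml : T -> T -> T).

(** The determinant of [y - x], [z - x], [w - x]. The operations are parameters, so that one
    definition is computed on polynomials, on integers and on reals. *)
Definition det_points (x y z w : nat -> T) : T :=
  let d (p : nat -> T) i := sb (p i) (x i) in
  let m i j := sb (ml (d z i) (d w j)) (ml (d z j) (d w i)) in
  ad (ml (d y 0%N) (m 1%N 2%N)) (ad (ml (d y 1%N) (m 2%N 0%N)) (ml (d y 2%N) (m 0%N 1%N))).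

(** By Cramer's rule, the alternating determinants of four out of five points are the coefficients
    of an affine dependence of the five; [four_dets_sum] is this statement. *)
Definition four_dets (P : nat -> nat -> T) (neg : T -> T) (k0 k1 k2 k3 k4 : nat) : seq T :=
  [:: det_points (P k1) (P k2) (P k3) (P k4); neg (det_points (P k0) (P k2) (P k3) (P k4));
      det_points (P k0) (P k1) (P k3) (P k4); neg (det_points (P k0) (P k1) (P k2) (P k4));
      det_points (P k0) (P k1) (P k2) (P k3)].

End Det.

Definition rdet (R : pzRingType) := @det_points R +%R (fun x y => x - y) *%R.
Definition pdet := det_points padd psub pmul.

Definition coord_poly (i : nat) : poly3 :=
  let X := ((1, 0, 0)%N, 1) in let Y := ((0, 1, 0)%N, 1) in let Z := ((0, 0, 1)%N, 1) in
  nth [::] [:: [:: X; Y; Z]; [:: X; Y]; [:: X]] i.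

Definition point_poly (k i : nat) : poly3 :=
  let: (b, j) := rotation k i in if b then popp (coord_poly j) else coord_poly j.

(* [pos] tells which of [c], [v], [u] are known to be positive, [zero] which
   are known to vanish. *)
Record domain := Domain { pos : bool * bool * bool; zero : bool * bool * bool }.

Definition vanishes (d : domain) (m : monomial) : bool :=
  [|| (zero d).1.1 && (0 < m.1.1)%N, (zero d).1.2 && (0 < m.1.2)%N | (zero d).2 && (0 < m.2)%N].

Definition positive_monomial (d : domain) (m : monomial) : bool :=
  [&& (pos d).1.1 || (m.1.1 == 0%N), (pos d).1.2 || (m.1.2 == 0%N) & (pos d).2 || (m.2 == 0%N)].

Definition coef_ge0 (d : domain) (p : poly3) : bool :=
  all (fun t => vanishes d t.1 || (0 <= t.2)) p.

Definition coef_gt0 (d : domain) (p : poly3) : bool :=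
  coef_ge0 d p && has (fun t => (0 < t.2) && positive_monomial d t.1) p.

(** A certificate subtracts at most one of the polynomials [hs], which are assumed nonnegative, and
    then inspects coefficients; monomials known to vanish may have any coefficient. *)
Definition poly_ge0 d (hs : seq poly3) p := has (fun h => coef_ge0 d (psub p h)) ([::] :: hs).
Definition poly_gt0 d (hs : seq poly3) p := has (fun h => coef_gt0 d (psub p h)) ([::] :: hs).

(** Up to a common sign, the dependence is nonnegative on [A], nonpositive on [B] and not zero.
    Normalized, it is a common point of the segment on [A] and the triangle on [B]. Weak signs
    suffice, as a weight may be zero. *)
Definition circuit_check d hs (A B : seq nat) : bool :=
  if (A, B) is ([:: k0; k1], [:: k2; k3; k4]) then
    let D := four_dets padd psub pmul point_poly popp k0 k1 k2 k3 k4 in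
    let chk (s : poly3 -> poly3) :=
      let D' := [seq s x | x <- take 2 D] ++ [seq s (popp x) | x <- drop 2 D] in
      all (poly_ge0 d hs) D' && has (poly_gt0 d hs) D' in
    uniq (A ++ B) && all (fun k => k < 12)%N (A ++ B) && (chk id || chk popp)
  else false.

Section Eval.
Variable R : realType.
Variables c v u : R.

Definition mono_eval (m : monomial) : R := c ^+ m.1.1 * v ^+ m.1.2 * u ^+ m.2.
Definition peval (p : poly3) : R := \sum_(t <- p) t.2%:~R * mono_eval t.1.

Lemma peval_nil : peval [::] = 0. Proof. exact: big_nil. Qed.
Lemma peval_cons t p : peval (t :: p) = t.2%:~R * mono_eval t.1 + peval p.
Proof. exact: big_cons. Qed.

Lemma peval_add_term m x p : peval (add_term m x p) = x%:~R * mono_eval m + peval p.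
Proof.
elim: p => [|[m' y] p IH] /=; first by rewrite peval_cons.
case: eqP => [<-|_]; rewrite !peval_cons /= ?IH.
  by rewrite intrD mulrDl addrA.
by rewrite addrCA.
Qed.

Lemma pevalD p p' : peval (padd p p') = peval p + peval p'.
Proof.
elim: p => [|t p IH] /=; first by rewrite peval_nil add0r.
by rewrite peval_add_term IH peval_cons addrA.
Qed.

Lemma peval_scale m x p : peval (pscale m x p) = x%:~R * mono_eval m * peval p.
Proof.
elim: p => [|t p IH] /=; first by rewrite peval_nil mulr0.
rewrite !peval_cons IH /= intrM /mono_eval /= !exprD; ring.
Qed.

Lemma pevalN p : peval (popp p) = - peval p.
Proof. by rewrite peval_scale /mono_eval /= !expr0 !mulr1 mulN1r. Qed.

Lemma pevalB p p' : peval (psub p p') = peval p - peval p'.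
Proof. by rewrite pevalD pevalN. Qed.

Lemma pevalM p p' : peval (pmul p p') = peval p * peval p'.
Proof.
elim: p => [|t p IH] /=; first by rewrite peval_nil mul0r.
by rewrite pevalD IH peval_scale peval_cons mulrDl.
Qed.

Lemma peval_det (x y z w : nat -> poly3) :
  peval (pdet x y z w) =
  rdet (peval \o x) (peval \o y) (peval \o z) (peval \o w).
Proof. by rewrite /pdet /rdet /det_points !(pevalD, pevalM, pevalB). Qed.

Definition coords (i : nat) : R := nth 0 [:: c + v + u; c + v; c] i.

Lemma peval_coord i : peval (coord_poly i) = coords i.
Proof.
case: i => [|[|[|i]]]; rewrite /coord_poly /coords /= ?nth_nil;
  rewrite ?peval_cons ?peval_nil /mono_eval //= ?expr0 ?expr1; ring.
Qed.

Lemma peval_point k i : peval (point_poly k i) = mv (rotation k) coords i.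
Proof.
rewrite /point_poly /mv; case: (rotation k i) => b j.
by case: b; rewrite ?pevalN peval_coord.
Qed.

Definition in_domain (d : domain) : Prop :=
  [/\ [/\ 0 <= c, 0 <= v & 0 <= u],
      [/\ ((pos d).1.1 -> 0 < c), ((pos d).1.2 -> 0 < v) & ((pos d).2 -> 0 < u)] &
      [/\ ((zero d).1.1 -> c = 0), ((zero d).1.2 -> v = 0) & ((zero d).2 -> u = 0)]].

Section Domain.
Variable d : domain.
Hypothesis dom : in_domain d.

Lemma mono_ge0 m : 0 <= mono_eval m.
Proof. by case: dom => -[c0 v0 u0] _ _; rewrite !mulr_ge0 // exprn_ge0. Qed.

Lemma mono_gt0 m : positive_monomial d m -> 0 < mono_eval m.
Proof.
case: dom => _ [cp vp up] _ /and3P[hc hv hu]; rewrite !mulr_gt0 //.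
- by case/orP: hc => [/cp/exprn_gt0 //|/eqP->]; rewrite expr0.
- by case/orP: hv => [/vp/exprn_gt0 //|/eqP->]; rewrite expr0.
- by case/orP: hu => [/up/exprn_gt0 //|/eqP->]; rewrite expr0.
Qed.

Lemma mono_vanishes m : vanishes d m -> mono_eval m = 0.
Proof.
case: dom => _ _ [cz vz uz]; rewrite /mono_eval.
by case/or3P => /andP[h /prednK <-]; rewrite exprS ?(cz h) ?(vz h) ?(uz h);
  rewrite !(mul0r, mulr0).
Qed.

Lemma coef_ge0P p : coef_ge0 d p -> 0 <= peval p.
Proof.
elim: p => [|t p IH]; first by rewrite peval_nil.
rewrite peval_cons /= => /andP[/orP[/mono_vanishes->|ht] /IH hp].
  by rewrite mulr0 add0r.
by rewrite addr_ge0 // mulr_ge0 ?mono_ge0 // ler0z.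
Qed.

Lemma coef_gt0P p : coef_gt0 d p -> 0 < peval p.
Proof.
case/andP; elim: p => // t p IH; rewrite peval_cons /= => /andP[ht hp].
case/orP => [/andP[t0 /mono_gt0 tm]|hs].
  by rewrite ltr_pwDl ?coef_ge0P // mulr_gt0 // ltr0z.
rewrite ltr_wpDl ?IH //; case/orP: ht => [/mono_vanishes->|t0]; first by rewrite mulr0.
by rewrite mulr_ge0 ?mono_ge0 // ler0z.
Qed.

Variable hs : seq poly3.
Hypothesis hsP : forall h, h \in hs -> 0 <= peval h.

Lemma poly_ge0P p : poly_ge0 d hs p -> 0 <= peval p.
Proof.
case/hasP => h /[!inE] hh /coef_ge0P; rewrite pevalB subr_ge0; apply: le_trans.
by case/orP: hh => [/eqP->|/hsP //]; rewrite peval_nil.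
Qed.

Lemma poly_gt0P p : poly_gt0 d hs p -> 0 < peval p.
Proof.
case/hasP => h /[!inE] hh /coef_gt0P; rewrite pevalB subr_gt0; apply: le_lt_trans.
by case/orP: hh => [/eqP->|/hsP //]; rewrite peval_nil.
Qed.

End Domain.
End Eval.

Section CircuitSigns.
Variables (R : realType) (c v u : R) (d : domain) (hs : seq poly3).
Hypothesis dom : in_domain c v u d.
Hypothesis hsP : forall h, h \in hs -> 0 <= peval c v u h.

Let P k := mv (rotation k) (coords c v u).
Let D := four_dets +%R (fun x y : R => x - y) *%R P -%R.

Lemma peval_four_dets k0 k1 k2 k3 k4 :
  map (peval c v u) (four_dets padd psub pmul point_poly popp k0 k1 k2 k3 k4) = D k0 k1 k2 k3 k4.
Proof.
have e k0' k1' k2' k3' : peval c v u (pdet (point_poly k0') (point_poly k1') (point_poly k2') (point_poly k3'))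
    = rdet (P k0') (P k1') (P k2') (P k3').
  by rewrite peval_det; congr rdet; apply/funext => i /=; rewrite peval_point.
by rewrite /= !pevalN -!/(pdet _ _ _ _) !e.
Qed.

Lemma circuit_checkP A B : circuit_check d hs A B ->
  exists k0 k1 k2 k3 k4 (s : R), [/\ A = [:: k0; k1], B = [:: k2; k3; k4],
    uniq (A ++ B) && all (fun k => k < 12)%N (A ++ B) &
    exists D0 D1 D2 D3 D4 : R, [/\ D k0 k1 k2 k3 k4 = [:: D0; D1; D2; D3; D4],
      [/\ 0 <= s * D0, 0 <= s * D1, s * D2 <= 0, s * D3 <= 0 & s * D4 <= 0] &
      [\/ 0 < s * D0, 0 < s * D1, s * D2 < 0 | s * D3 < 0 \/ s * D4 < 0]]].
Proof.
case: A => [|k0 [|k1 [|? ?]]] //; case: B => [|k2 [|k3 [|k4 [|? ?]]]] //.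
rewrite /circuit_check => /andP[un].
have := peval_four_dets k0 k1 k2 k3 k4; set E := four_dets _ _ _ _ _ _ _ _ _ _ => eE.
have sgn_case (s : R) (f : poly3 -> poly3) : (forall p, peval c v u (f p) = s * peval c v u p) ->
  (let D' := [seq f x | x <- take 2 E] ++ [seq f (popp x) | x <- drop 2 E] in
      all (poly_ge0 d hs) D' && has (poly_gt0 d hs) D') ->
  exists D0 D1 D2 D3 D4 : R, [/\ D k0 k1 k2 k3 k4 = [:: D0; D1; D2; D3; D4],
      [/\ 0 <= s * D0, 0 <= s * D1, s * D2 <= 0, s * D3 <= 0 & s * D4 <= 0] &
      [\/ 0 < s * D0, 0 < s * D1, s * D2 < 0 | s * D3 < 0 \/ s * D4 < 0]].
  move=> fs; rewrite -eE /E /four_dets; move: (det_points _ _ _ _ _ _ _) => E0.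
  move: (popp (det_points _ _ _ _ _ _ _)) => E1; move: (det_points _ _ _ (point_poly k0) (point_poly k1) (point_poly k3) _) => E2.
  move: (popp (det_points _ _ _ _ _ _ _)) => E3; move: (det_points _ _ _ _ _ _ _) => E4.
  rewrite /= !andbT orbF => /andP[/and5P[h0 h1 h2 h3 h4] hh].
  exists (peval c v u E0), (peval c v u E1), (peval c v u E2), (peval c v u E3), (peval c v u E4).
  have ge := poly_ge0P dom hsP; have gt := poly_gt0P dom hsP.
  have N p : 0 <= peval c v u (f (popp p)) -> s * peval c v u p <= 0.
    by rewrite fs pevalN mulrN oppr_ge0.
  have N' p : 0 < peval c v u (f (popp p)) -> s * peval c v u p < 0.
    by rewrite fs pevalN mulrN oppr_gt0.
  split=> //.
    by split; [rewrite -fs; exact: ge|rewrite -fs; exact: ge|exact/N/ge|exact/N/ge|exact/N/ge].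
  case/or4P: hh => [/gt|/gt|/gt/N'|/orP[/gt/N'|/gt/N']]; rewrite ?fs => hh.
  - by constructor 1. - by constructor 2. - by constructor 3.
  - by constructor 4; left. - by constructor 4; right.
move=> /orP[h|h]; [exists k0, k1, k2, k3, k4, 1|exists k0, k1, k2, k3, k4, (-1)]; split=> //.
  by apply: (sgn_case _ _ _ h) => p; rewrite mul1r.
by apply: (sgn_case _ _ _ h) => p; rewrite pevalN mulN1r.
Qed.

End CircuitSigns.

(** * The labelling of an orbit of vertices *)

Section SortFrame.
Variable R : realType.
Local Notation E3 := 'rV[R]_3.
Variable G : 'M[R]_3 -> Prop.
Implicit Types (e : nat -> E3) (q : nat -> R) (m : signed).

Definition sym_frame e : Prop :=
  exists2 c, frame e c & forall A, G A <-> exists2 k, (k < 12)%N & acts e A k.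

Definition basic_move (j : nat) : signed :=
  match j with 0 => swap01 | 1 => swap12 | j'.+2 => flip_sign j' end%N.

(** The moves are reflections generating the full octahedral group. As they normalize the group of
    the twelve rotations, the moved frame is adapted to the same symmetry group. *)
Lemma basic_move_conj :
  all (fun j => let m := basic_move j in
    all (fun k => has (fun k' => same3 (compose m (compose (rotation k) m)) (rotation k'))
      (iota 0 12)) (iota 0 12)) (iota 0 5).
Proof. by vm_compute. Qed.

Lemma basic_move_lin j e q : (j < 5)%N -> lin (mv (basic_move j) e) (mv (basic_move j) q) = lin e q.
Proof.
by case: j => [|[|[|[|[|//]]]]] _; rewrite /lin /mv /=; apply: vecP; rewrite !mxE; ring.
Qed.

Lemma basic_move_invol (V : zmodType) j (x : nat -> V) i : (j < 5)%N -> (i < 3)%N ->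
  mv (basic_move j) (mv (basic_move j) x) i = x i.
Proof.
by case: j => [|[|[|[|[|//]]]]] _; case: i => [|[|[|//]]] _; rewrite /mv /= ?opprK.
Qed.

Lemma lin_ext_frame e e' q : (forall i, (i < 3)%N -> e i = e' i) -> lin e q = lin e' q.
Proof. by move=> h; rewrite /lin !h. Qed.

Lemma acts_move e A j k : (j < 5)%N -> (k < 12)%N -> acts e A k ->
  exists2 k', (k' < 12)%N & acts (mv (basic_move j) e) A k'.
Proof.
move=> hj hk h; have := basic_move_conj => /all_iotaP/(_ j hj)/all_iotaP/(_ k hk)/hasP[k'].
rewrite mem_iota /= => hk' s; exists k' => // q; set m := basic_move j in s *.
have e1 : lin (mv m e) q = lin e (mv m q).
  rewrite -(basic_move_lin e (mv m q) hj); apply: lin_ext; by rewrite basic_move_invol.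
rewrite e1 h -(basic_move_lin e _ hj) -/m -(lin_same3 _ _ s).
by apply: lin_ext; rewrite -mv_compose; exact: (congr1 (sgn _) (mv_compose _ _ _ _)).
Qed.

Lemma sym_frame_move e j : (j < 5)%N -> sym_frame e -> sym_frame (mv (basic_move j) e).
Proof.
move=> hj [c [c0 d] hG]; exists c.
  split=> // i i'.
  case: j hj => [|[|[|[|[|//]]]]] _; case: i => [|[|[|//]]]; case: i' => [|[|[|//]]] _ _;
    rewrite /mv /= ?dotNl ?(dotC _ (- _)) ?dotNl ?(dotC _ (- _)) ?dotNl !d ?opprK ?oppr0 //=.
move=> A; split=> [/hG[k hk h]|[k hk h]]; first exact: acts_move h.
have [k' hk' h'] := acts_move hj hk h; apply/hG; exists k' => // q.
rewrite (@lin_ext_frame e (mv (basic_move j) (mv (basic_move j) e))) ?h' //.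
  by apply: lin_ext_frame => i hi; rewrite basic_move_invol.
by move=> i hi; rewrite basic_move_invol.
Qed.

(** Sign changes make the coordinates nonnegative; comparing positions 01, 12, 01 in turn then sorts
    them. *)
Lemma sort_frame e q : sym_frame e -> exists e' q',
  [/\ sym_frame e', lin e' q' = lin e q & [/\ 0 <= q' 2%N, q' 2%N <= q' 1%N & q' 1%N <= q' 0%N]].
Proof.
move=> he.
pose good e' q' := sym_frame e' /\ lin e' q' = lin e q.
have mvg j e' q' : (j < 5)%N -> good e' q' -> good (mv (basic_move j) e') (mv (basic_move j) q').
  by move=> hj [a b]; split; [exact: sym_frame_move|rewrite basic_move_lin].
have flip i e' q' : (i < 3)%N -> good e' q' -> exists e2 q2, [/\ good e2 q2, 0 <= q2 i &
    forall i', i' != i -> q2 i' = q' i'].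
  move=> hi g; have [h|h] := leP 0 (q' i); first by exists e', q'.
  exists (mv (basic_move i.+2) e'), (mv (basic_move i.+2) q'); split; first exact: mvg.
    by rewrite /mv /= eqxx /= oppr_ge0 ltW.
  by move=> i' /negPf ii; rewrite /mv /= ii.
have [e0 [q0 [g0 a0 _]]] := flip 0%N e q isT (conj he erefl).
have [e1 [q1 [g1 b1 h1]]] := flip 1%N e0 q0 isT g0.
have [e2 [q2 [g2 c2 h2]]] := flip 2%N e1 q1 isT g1.
have a2 : 0 <= q2 0%N by rewrite h2 // h1.
have b2 : 0 <= q2 1%N by rewrite h2.
have [e3 [q3 [g3 [a3 b3 c3 l3]]]] : exists e3 q3, good e3 q3 /\
    [/\ 0 <= q3 0%N, 0 <= q3 1%N, 0 <= q3 2%N & q3 1%N <= q3 0%N].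
  have [h|h] := leP (q2 1%N) (q2 0%N); first by exists e2, q2.
  exists (mv (basic_move 0) e2), (mv (basic_move 0) q2); split; first exact: mvg.
  by split=> //; rewrite /mv /= ltW.
have [e4 [q4 [g4 [a4 b4 c4 l4 l4']]]] : exists e4 q4, good e4 q4 /\
    [/\ 0 <= q4 0%N, 0 <= q4 1%N, 0 <= q4 2%N, q4 2%N <= q4 1%N & q4 2%N <= q4 0%N].
  have [h|h] := leP (q3 2%N) (q3 1%N).
    by exists e3, q3; split=> //; split=> //; apply: le_trans h l3.
  exists (mv (basic_move 1) e3), (mv (basic_move 1) q3); split; first exact: mvg.
  by split=> //; rewrite /mv /= ltW.
have [h|h] := leP (q4 1%N) (q4 0%N).
  by exists e4, q4; case: g4.
exists (mv (basic_move 0) e4), (mv (basic_move 0) q4).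
by have [a b] := mvg 0%N _ _ isT g4; split=> //; split=> //; rewrite /mv /= ltW.
Qed.

End SortFrame.

Section Labelling.
Variables (R : realType) (M : map_data) (p : vert M -> 'rV[R]_3).
Local Notation E3 := 'rV[R]_3.

(** Only labels below 12 matter. [lab] may identify labels, as it does when the vertices have
    nontrivial stabilizers. The base point has coordinates [c + v + u], [c + v], [c]. *)
Record labelling (e : nat -> E3) (d c v u : R) (lab : nat -> vert M) : Prop := Labelling {
  lab_frame : frame e d;
  lab_pos : [/\ 0 <= c, 0 <= v & 0 <= u];
  lab_point : forall k, (k < 12)%N -> p (lab k) = lin e (mv (rotation k) (coords c v u));
  lab_surj : forall w, exists2 k, (k < 12)%N & w = lab k;
  lab_sym : forall g, (g < 12)%N -> exists phi psi,
    is_map_iso phi psi /\ forall k, (k < 12)%N -> phi (lab k) = lab (mul12 g k) }.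

Lemma labelling_exists : injective p -> (0 < #|vert M|)%N ->
  vertex_transitive_tetrahedral p -> exists e d c v u lab, labelling e d c v u lab.
Proof.
move=> pI /card_gt0P[v0 _] [[t [reg cen hG]] trans].
have sf0 : sym_frame (symmetry p) (tetra_axis t).
  have [c fr] := tetra_frame reg cen; exists c => // A; rewrite hG; split.
    exact: tetrahedral_rotation_acts.
  by case=> k hk h; exact: acts_tetrahedral_rotation hk h.
have [d0 fr0 _] := sf0.
have [e [q [[d fr hA] hq [q2 q21 q10]]]] := sort_frame (fun i => dot (p v0) (tetra_axis t i) / d0) sf0.
rewrite -(frame_basis fr0) in hq.
pose c := q 2%N; pose v := q 1%N - q 2%N; pose u := q 0%N - q 1%N.
have hq' : p v0 = lin e (coords c v u).
  by rewrite -hq; apply: lin_ext; rewrite /coords /c /v /u /=; ring.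
have pos : [/\ 0 <= c, 0 <= v & 0 <= u] by split; rewrite /c /v /u ?subr_ge0.
have ex (k : 'I_12) : exists w, p w = lin e (mv (rotation k) (coords c v u)).
  have /hA : exists2 k', (k' < 12)%N & acts e (rotation_mx e d k) k'.
    by exists k => //; exact: rotation_mxP.
  case=> _ _ [phi [psi [_ h _]]]; exists (phi v0).
  by rewrite h hq' (rotation_mxP fr).
have [f hf] := choice ex; pose lab k := f (inord k).
have labP k : (k < 12)%N -> p (lab k) = lin e (mv (rotation k) (coords c v u)).
  by move=> hk; rewrite /lab hf inordK.
exists e, d, c, v, u, lab; split=> //.
  move=> w; have [A /hA[k hk h] e1] := trans v0 w; exists k => //.
  by apply: pI; rewrite labP // -e1 hq' h.
move=> g hg; have /hA : exists2 k', (k' < 12)%N & acts e (rotation_mx e d g) k'.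
  by exists g => //; exact: rotation_mxP.
case=> _ _ [phi [psi [iso h _]]]; exists phi, psi; split=> // k hk.
apply: pI; rewrite h !labP ?mul12_lt // (rotation_mxP fr) (lin_same3 _ _ (rotation_mul hg hk)).
by apply: lin_ext; rewrite mv_compose.
Qed.

End Labelling.

Section Dependency.
Variables (R : realType) (M : map_data) (p : vert M -> 'rV[R]_3) (r : R).
Local Notation E3 := 'rV[R]_3.
Hypothesis hp : polyhedron p.
Hypothesis pr : forall v, dot (p v) (p v) = r.

Definition list_weight (la : seq (vert M * R)) (S : R) : vert M -> R :=
  fun w => \sum_(x <- la | x.1 == w) x.2 / S.

Lemma bary_list la S : bary p (list_weight la S) = S^-1 *: \sum_(x <- la) x.2 *: p x.1.
Proof.
rewrite /bary /list_weight scaler_sumr.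
under eq_bigr => i _ do rewrite scaler_suml.
rewrite (exchange_big_dep predT) //=; apply: eq_bigr => x _.
by rewrite (big_pred1 x.1) ?scalerA 1?mulrC // => i; rewrite eq_sym.
Qed.

Lemma weights_list la S (A : {set vert M}) : 0 < S -> \sum_(x <- la) x.2 = S ->
  (forall x, x \in la -> 0 <= x.2 /\ x.1 \in A) -> weights A (list_weight la S).
Proof.
move=> S0 sS h; split=> [w|w wA|].
- rewrite /list_weight big_seq_cond; apply: sumr_ge0 => x /andP[/h[x0 _] _].
  by rewrite divr_ge0 // ltW.
- rewrite /list_weight big_seq_cond big1 // => x /andP[/h[_ xA] /eqP e].
  by rewrite -e xA in wA.
rewrite /list_weight (exchange_big_dep predT) //=.
under eq_bigr => x _ do rewrite (big_pred1 x.1 (fun i => eq_sym _ _)) //.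
by rewrite -mulr_suml sS divff // gt_eqF.
Qed.

Lemma dependent_faces f g (la lb : seq (vert M * R)) :
  f != g -> (forall x, x \in la -> 0 <= x.2 /\ x.1 \in face_verts f) ->
  (forall x, x \in lb -> 0 <= x.2 /\ x.1 \in face_verts g) ->
  0 < \sum_(x <- la) x.2 -> \sum_(x <- la) x.2 = \sum_(x <- lb) x.2 ->
  \sum_(x <- la) x.2 *: p x.1 = \sum_(x <- lb) x.2 *: p x.1 ->
  (forall x y, x \in la -> y \in lb -> x.1 != y.1) -> False.
Proof.
move=> fg ha hb S0 sS sp dis.
set A := [set w in map fst la]%SET; set B := [set w in map fst lb]%SET.
apply: (disjoint_hulls hp pr fg (A := A) (B := B)
  (l := list_weight la (\sum_(x <- la) x.2)) (l' := list_weight lb (\sum_(x <- la) x.2))).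
- by apply/fintype.subsetP => w; rewrite inE => /mapP[x /ha[_ h] ->].
- by apply/fintype.subsetP => w; rewrite inE => /mapP[x /hb[_ h] ->].
- by apply: weights_list => // x xa; have [x0 _] := ha x xa; split=> //; rewrite inE map_f.
- by apply: weights_list => // x xb; have [x0 _] := hb x xb; split=> //; rewrite inE map_f.
- by rewrite !bary_list sp.
move=> w; rewrite !inE => /mapP[x xa ->] /mapP[y yb e].
by have := dis x y xa yb; rewrite e eqxx.
Qed.

Lemma dependent_edge f g (la lb : seq (vert M * R)) (e : {set vert M}) : e \in face_edges f ->
  (forall x, x \in la -> 0 <= x.2 /\ x.1 \in e) ->
  (forall x, x \in lb -> 0 <= x.2 /\ x.1 \in face_verts g) ->
  0 < \sum_(x <- la) x.2 -> \sum_(x <- la) x.2 = \sum_(x <- lb) x.2 ->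
  \sum_(x <- la) x.2 *: p x.1 = \sum_(x <- lb) x.2 *: p x.1 ->
  (forall x y, x \in e -> y \in lb -> x != y.1) -> False.
Proof.
move=> ef ha hb S0 sS sp dis.
set B := [set w in map fst lb]%SET.
apply: (edge_disjoint_hull hp pr ef (B := B) (g := g)
  (l := list_weight la (\sum_(x <- la) x.2)) (l' := list_weight lb (\sum_(x <- la) x.2))).
- by apply/fintype.subsetP => w; rewrite inE => /mapP[x /hb[_ h] ->].
- by apply: weights_list.
- by apply: weights_list => // x xb; have [x0 _] := hb x xb; split=> //; rewrite inE map_f.
- by rewrite !bary_list sp.
move=> w wA; rewrite !inE => /mapP[y yb e'].
by have := dis w y wA yb; rewrite e' eqxx.
Qed.

End Dependency.

Lemma four_dets_sum (R : comNzRingType) (P : nat -> nat -> R) k0 k1 k2 k3 k4 D0 D1 D2 D3 D4 :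
  four_dets +%R (fun x y => x - y) *%R P -%R k0 k1 k2 k3 k4 = [:: D0; D1; D2; D3; D4] ->
  D0 + D1 + D2 + D3 + D4 = 0 /\
  forall j, (j < 3)%N -> D0 * P k0 j + D1 * P k1 j + D2 * P k2 j + D3 * P k3 j + D4 * P k4 j = 0.
Proof.
case=> <- <- <- <- <-; rewrite /det_points; split; first by ring.
by case=> [|[|[|//]]] _; ring.
Qed.

Lemma triple_perp (R : realType) (n a b c : 'rV[R]_3) : n != 0 ->
  dot n a = 0 -> dot n b = 0 -> dot n c = 0 -> triple a b c = 0.
Proof.
move=> n0 na nb nc.
have : triple a b c *: n = dot n a *: cross b c + dot n b *: cross c a + dot n c *: cross a b.
  by rewrite /triple; apply: vecP; rewrite !dotE !mxE /= ?mxE; ring.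
by rewrite na nb nc !scale0r !addr0 => /eqP; rewrite scaler_eq0 (negPf n0) orbF => /eqP.
Qed.

Section LabelledFaces.
Variables (R : realType) (M : map_data) (p : vert M -> 'rV[R]_3).
Local Notation E3 := 'rV[R]_3.
Hypothesis hp : polyhedron p.
Variables (e : nat -> E3) (d c v u : R) (lab : nat -> vert M).
Hypothesis hl : labelling p e d c v u lab.
Implicit Types (f : face M) (s A B : seq nat).

Local Notation x := (coords c v u).
Local Notation P k := (mv (rotation k) x).

Lemma labelled_sphere w : dot (p w) (p w) = d * ip x x.
Proof.
have [fr _ hpt hs _] := hl; have [k hk ->] := hs w.
by rewrite hpt // (dot_lin fr) ip_rotation.
Qed.

Definition vset s : {set vert M} := [set w in map lab s]%SET.
Definition is_face s : bool := [exists f : face M, face_verts f == vset s].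
Definition in_face s : Prop := exists f, vset s \subset face_verts f.
Definition labels s : bool := all (fun k => k < 12)%N s.

Lemma vset_sub s (S : {set vert M}) : (vset s \subset S) = all (fun k => lab k \in S) s.
Proof.
apply/fintype.subsetP/allP => [h k ks|h w]; first by apply: h; rewrite inE map_f.
by rewrite inE => /mapP[k ks ->]; apply: h.
Qed.

Lemma face_verts_cover f w : (w \in face_verts f) = [exists e in face_edges f, w \in (e : {set vert M})].
Proof.
apply/idP/existsP => [|[E /andP[/(face_edge_sub) /fintype.subsetP h /h //]]].
rewrite inE => hw; exists [set w; next (bdry f) w]%SET.
by apply/andP; split; [exact: imset_f|rewrite !inE eqxx].
Qed.

Lemma iso_face_verts (phi : vert M -> vert M) (psi : face M -> face M) :
  is_map_iso phi psi -> forall f, face_verts (psi f) = [set phi w | w in face_verts f]%SET.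
Proof.
case=> bphi _ h f; apply/setP => w; rewrite face_verts_cover h.
apply/existsP/imsetP => [[E /andP[/imsetP[E' hE' ->] /imsetP[w' hw' ->]]]|[w' hw' ->]].
  exists w' => //; rewrite face_verts_cover; apply/existsP; exists E'; exact/andP.
move: hw'; rewrite face_verts_cover => /existsP[E' /andP[h1 h2]].
by exists [set phi w | w in E']%SET; apply/andP; split; exact: imset_f.
Qed.

Lemma vset_map g s (phi : vert M -> vert M) : labels s ->
  (forall k, (k < 12)%N -> phi (lab k) = lab (mul12 g k)) ->
  [set phi w | w in vset s]%SET = vset (map (mul12 g) s).
Proof.
move=> /allP ls h; apply/setP => w; rewrite inE; apply/imsetP/mapP => [[w']|[k]].
  rewrite inE => /mapP[k ks ->] ->; exists (mul12 g k); first exact: map_f.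
  exact/h/ls.
by case/mapP=> j js -> ->; exists (lab j); rewrite ?inE ?map_f // h // ls.
Qed.

Lemma is_face_mul g s : (g < 12)%N -> labels s -> is_face s -> is_face (map (mul12 g) s).
Proof.
move=> hg ls /existsP[f /eqP hf]; have [phi [psi [iso h]]] := lab_sym hl hg.
apply/existsP; exists (psi f); rewrite (iso_face_verts iso) hf.
by apply/eqP; apply: vset_map.
Qed.

Lemma in_face_mul g s : (g < 12)%N -> labels s -> in_face s -> in_face (map (mul12 g) s).
Proof.
move=> hg ls [f hf]; have [phi [psi [iso h]]] := lab_sym hl hg.
by exists (psi f); rewrite (iso_face_verts iso) -(vset_map ls h) imsetS.
Qed.

Lemma in_faceS s s' : {subset s' <= s} -> in_face s -> in_face s'.
Proof.
move=> ss [f]; rewrite vset_sub => /allP h; exists f; rewrite vset_sub.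
by apply/allP => k /ss/h.
Qed.

Lemma is_face_in s : is_face s -> in_face s.
Proof. by case/existsP => f /eqP h; exists f; rewrite h. Qed.

Lemma lin_sub (q q' : nat -> R) : lin e q - lin e q' = lin e (fun i => q i - q' i).
Proof. by rewrite /lin; apply: vecP; rewrite !mxE; ring. Qed.

Lemma coplanar_det f k0 k1 k2 k3 : labels [:: k0; k1; k2; k3] ->
  vset [:: k0; k1; k2; k3] \subset face_verts f -> rdet (P k0) (P k1) (P k2) (P k3) = 0.
Proof.
case/and5P=> h0 h1 h2 h3 _; rewrite vset_sub => /and5P[f0 f1 f2 f3 _].
have [_ _ /(_ f)[[n [b [n0 nb]]] _] _] := hp.
have [fr _ hpt _ _] := hl; apply: (mulIf (triple_frame fr)); rewrite mul0r.
have nd k k' : lab k \in face_verts f -> lab k' \in face_verts f -> dot n (p (lab k) - p (lab k')) = 0.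
  by rewrite !inE => hk hk'; rewrite dotBr !nb // subrr.
have := triple_perp n0 (nd _ _ f1 f0) (nd _ _ f2 f0) (nd _ _ f3 f0).
rewrite !hpt // !lin_sub triple_lin => <-; congr (_ * _).
by rewrite /rdet /det_points; ring.
Qed.

Section Injective.
Hypothesis labI : {in [pred k | (k < 12)%N] &, injective lab}.

Variables (dom : domain) (hs : seq poly3).
Hypothesis hdom : in_domain c v u dom.
Hypothesis hhs : forall h, h \in hs -> 0 <= peval c v u h.

(** In one common face the five points would be coplanar and all five determinants zero, against
    strictness; in two faces the dependence gives a forbidden common point. *)
Lemma circuit_conflict A B : circuit_check dom hs A B -> in_face A -> in_face B -> False.
Proof.
move=> /(circuit_checkP hdom hhs)[k0 [k1 [k2 [k3 [k4 [s [-> -> /andP[un lt]]]]]]]].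
case=> D0 [D1 [D2 [D3 [D4 [hD [a0 a1 a2 a3 a4] strict]]]]] [f fA] [g gB].
have [sD sP] := four_dets_sum hD.
have [h0 h1 h2 h3 h4] : [/\ k0 < 12, k1 < 12, k2 < 12, k3 < 12 & k4 < 12]%N.
  by move: lt => /= /and5P[-> -> -> -> /andP[-> _]].
have fg : f != g.
  apply/eqP => fg; rewrite -fg in gB.
  have cop i j k l : {subset [:: i; j; k; l] <= [:: k0; k1; k2; k3; k4]} -> rdet (P i) (P j) (P k) (P l) = 0.
    move=> sub; apply: (@coplanar_det f); first by apply/allP => z /sub; move: z; apply/allP.
    move: fA gB; rewrite !vset_sub => /allP fA /allP gB; apply/allP => z /sub zz.
    by have : z \in [:: k0; k1] ++ [:: k2; k3; k4] by []; rewrite mem_cat => /orP[/fA|/gB].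
  move: hD; rewrite /four_dets -!/(rdet _ _ _ _) !cop ?oppr0;
    try by move=> z; rewrite !inE => /or4P[]->; rewrite ?orbT.
  by case=> *; subst; move: strict; rewrite mulr0 ltxx; case=> // -[].
have [fr _ hpt _ _] := hl.
apply: (@dependent_faces _ _ p (d * ip x x) hp labelled_sphere f g
  [:: (lab k0, s * D0); (lab k1, s * D1)]
  [:: (lab k2, - (s * D2)); (lab k3, - (s * D3)); (lab k4, - (s * D4))] fg).
- move: fA; rewrite vset_sub => /and3P[m0 m1 _] y.
  by move=> /[1!inE] /orP[/eqP->|/[1!inE]/eqP->].
- move: gB; rewrite vset_sub => /and4P[m2 m3 m4 _] y.
  by move=> /[1!inE] /orP[/eqP->|/[1!inE]/orP[/eqP->|/[1!inE]/eqP->]] /=; rewrite oppr_ge0.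
- rewrite !big_cons big_nil /= addr0.
  have e0 : s * D0 + s * D1 + s * D2 + s * D3 + s * D4 = 0 by rewrite -!mulrDr sD mulr0.
  by case: strict => [h|h|h|[h|h]]; lra.
- rewrite !big_cons !big_nil /= !addr0.
  have e0 : s * D0 + s * D1 + s * D2 + s * D3 + s * D4 = 0 by rewrite -!mulrDr sD mulr0.
  by lra.
- rewrite !big_cons !big_nil /= !addr0 !hpt //.
  apply/eqP; rewrite -subr_eq0; apply/eqP.
  transitivity (s *: lin e (fun j => D0 * P k0 j + D1 * P k1 j + D2 * P k2 j + D3 * P k3 j + D4 * P k4 j)).
    by rewrite /lin; apply: vecP; rewrite !mxE; ring.
  by rewrite /lin !sP // !scale0r !addr0 scaler0.
move=> y z; rewrite !inE => hy hz.
have ne i j : i \in [:: k0; k1] -> j \in [:: k2; k3; k4] -> lab i != lab j.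
  move=> hi hj; apply/eqP => /labI h.
  have lt' z' : z' \in [:: k0; k1] ++ [:: k2; k3; k4] -> (z' < 12)%N by move: z'; apply/allP.
  have eij : i = j by apply: h; rewrite inE lt' // mem_cat ?hi ?hj ?orbT.
  move: un; rewrite cat_uniq => /and3P[_ /hasP un _]; apply: un; exists j => //=.
  by rewrite -eij.
case/orP: hy => /eqP-> /=; case/or3P: hz => /eqP-> /=; apply: ne; rewrite !inE eqxx ?orbT //.
Qed.

End Injective.
End LabelledFaces.

(** * The combinatorial search *)

(* Faces are recorded by cyclic lists of labels [k < 12], the vertex labelled
   [k] being the image of vertex [0] under rotation [k]; the rotation [g] acts
   on labels by [mul12 g]. *)
Section LabelCombinatorics.
Local Open Scope nat_scope.
Implicit Types (s t it A B : seq nat) (L : seq (seq nat * seq nat)).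

Definition images s : seq (seq nat) := [seq map (mul12 g) s | g <- iota 0 12].
Definition contains_image s A : bool := has (fun A' => all (mem s) A') (images A).
(** The images of the two parts may come from different rotations: if a face contains [s], then by
    symmetry some faces contain [A] and [B] themselves. *)
Definition conflicting L s : bool :=
  has (fun AB => contains_image s AB.1 && contains_image s AB.2) L.

Definition same_labels s t : bool := all (mem s) t && all (mem t) s.
Definition is_image s t : bool := has (same_labels s) (images t).

Definition distinct_images it : seq (seq nat) :=
  foldr (fun s acc => if has (same_labels s) acc then acc else s :: acc) [::] (images it).

Lemma distinct_images_sub it : {subset distinct_images it <= images it}.
Proof.
rewrite /distinct_images; elim: (images it) => //= a acc IH s.
case: ifP => _; first by move=> /IH h; rewrite inE h orbT.
by rewrite !inE => /orP[->//|/IH->]; rewrite orbT.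
Qed.

Lemma same_labels_trans s s' s'' : same_labels s s' -> same_labels s' s'' -> same_labels s s''.
Proof.
move=> /andP[/allP a /allP b] /andP[/allP a' /allP b']; apply/andP.
by split; apply/allP => k; [move/a'/a|move/b/b'].
Qed.

Lemma is_image_distinct s it : is_image s it ->
  exists2 s', s' \in distinct_images it & same_labels s s'.
Proof.
rewrite /is_image /distinct_images; elim: (images it) => //= a acc IH.
case/orP => [ha|/IH[s' h1 h2]]; last by case: ifP => _; exists s' => //; rewrite inE h1 orbT.
case: ifP => [/hasP[b hb hab]|_]; last by exists a => //; rewrite inE eqxx.
by exists b => //; exact: same_labels_trans hab.
Qed.

Definition side s (j : nat) : bool :=
  let s' := rot 1 s in
  has (fun ab => ((ab.1 == 0) && (ab.2 == j)) || ((ab.1 == j) && (ab.2 == 0))) (zip s s').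

(* The seven orbits of pairs are represented by [0; j] with [0 < j < 8]. *)
Definition side_counts it : seq nat :=
  [seq count (fun s => side s j) (distinct_images it) | j <- iota 1 7].

(** What the orbit of [it] contributes to the sum of [size - 2] over all faces, the quantity bounded
    below by [genus_excess]. *)
Definition weight it : nat := size (distinct_images it) * (size it - 2).

(** With [candidate_triples], representatives of the 21 orbits of triples. In every case each of
    these nine contains images of both parts of one crossing pair, so it lies in no face. *)
Definition self_conflicting_triples : seq (seq nat) :=
  [:: [:: 0; 1; 2]; [:: 0; 2; 4]; [:: 0; 2; 5]; [:: 0; 2; 9]; [:: 0; 3; 5]; [:: 0; 3; 8];
      [:: 0; 3; 9]; [:: 0; 5; 11]; [:: 0; 6; 11]].

Definition candidate_triples : seq (seq nat) :=
  [:: [:: 0; 1; 4]; [:: 0; 1; 6]; [:: 0; 1; 8]; [:: 0; 1; 10]; [:: 0; 2; 8]; [:: 0; 3; 4];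
      [:: 0; 4; 8]; [:: 0; 4; 9]; [:: 0; 4; 10]; [:: 0; 4; 11]; [:: 0; 5; 10]; [:: 0; 7; 9]].

(** The order is cyclic, hence entries two apart are diagonals. [quad1] is coplanar only for a = b
    and [quad2] only for ac = b^2. *)
Definition quad1 : seq nat := [:: 0; 4; 1; 5].
Definition quad2 : seq nat := [:: 0; 1; 9; 8].
(** The orbits of quadruples that contain no self-conflicting triple, apart from [quad1] and
    [quad2]. They are excluded as noncoplanar or by a conflict. *)
Definition other_quads : seq (seq nat) :=
  [:: [:: 0; 1; 4; 7]; [:: 0; 1; 4; 8]; [:: 0; 1; 4; 9]; [:: 0; 1; 4; 11]; [:: 0; 1; 6; 8];
      [:: 0; 1; 6; 10]].

Definition items : seq (seq nat) := candidate_triples ++ [:: quad1; quad2].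

Definition target : seq (seq nat) := [:: [:: 0; 1; 4]; [:: 0; 3; 4]; [:: 0; 5; 10]; [:: 0; 7; 9]].
(* This solution fails to be a surface at the vertices. *)
Definition pinched : seq (seq nat) := [:: [:: 0; 4; 9]; [:: 0; 4; 11]; [:: 0; 5; 10]; [:: 0; 7; 9]].

Fixpoint combs k s : seq (seq nat) :=
  match k, s with
  | 0, _ => [:: [::]]
  | k'.+1, x :: s' => map (cons x) (combs k' s') ++ combs k s'
  | _, [::] => [::]
  end.

Lemma mem_combs t s : subseq t s -> t \in combs (size t) s.
Proof.
elim: s t => [|x s IH] [|y t] //= h.
rewrite mem_cat; move: h; case: eqP => [->|_] h; last by rewrite (IH (y :: t)) ?orbT.
by apply/orP; left; apply/map_f/IH.
Qed.

Lemma triples_check : all (fun t =>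
    has (contains_image t) self_conflicting_triples || has (is_image t) candidate_triples)
  (combs 3 (iota 0 12)).
Proof. by vm_compute. Qed.

Lemma quads_check : all (fun t =>
    [|| has (contains_image t) self_conflicting_triples, has (is_image t) other_quads,
        is_image t quad1 | is_image t quad2])
  (combs 4 (iota 0 12)).
Proof. by vm_compute. Qed.

(** Five labels always include a quadruple that cannot lie in a face, so a face has at most four
    vertices. *)
Lemma pentagons_check : all (fun t =>
    has (fun q => ~~ (is_image q quad1 || is_image q quad2)) (combs 4 t))
  (combs 5 (iota 0 12)).
Proof. by vm_compute. Qed.

Lemma images_check :
  pairwise (fun s t => ~~ same_labels s t) (flatten [seq distinct_images it | it <- items]).
Proof. by vm_compute. Qed.

Definition compatible L s t : bool :=
  all (fun AB => ~~ (contains_image s AB.1 && contains_image t AB.2 ||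
                     contains_image t AB.1 && contains_image s AB.2)) L.

Definition add_counts (x y : seq nat) : seq nat := [seq ab.1 + ab.2 | ab <- zip x y].
(* The entries of [cnt] count the faces on one edge of each orbit, of which there
   are at most two: this prunes the search. *)
Fixpoint search (final : seq nat -> bool) (comp : nat -> nat -> bool) (cs : seq (seq nat))
    (k : nat) (S cnt : seq nat) : bool :=
  match cs with
  | [::] => final S ==> all (fun n => (n == 0) || (n == 2)) cnt ==> false
  | c :: cs' => search final comp cs' k.+1 S cnt &&
      (if comp k k && all (comp k) S then
         let cnt' := add_counts c cnt in
         if all (fun n => n <= 2) cnt' then search final comp cs' k.+1 (k :: S) cnt' else true
       else true)
  end.

(** The bound is 28 = 2 * 12 + 4. The two exempted lists are the positions of [target] and [pinched]
    in [items]; the search accumulates indices in reverse. *)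
Definition leaf_check L (noncoplanar : seq (seq nat)) : bool :=
  let table := [seq [seq compatible L s t | t <- items] | s <- items] in
  let ws := [seq weight it | it <- items] in
  let final S :=
    (28 <= sumn [seq nth 0 ws k | k <- S]) &&
    ~~ ((rev S == [:: 0; 5; 10; 11]) || (rev S == [:: 7; 9; 10; 11])) in
  [&& all (conflicting L) self_conflicting_triples,
      all (fun q => (q \in noncoplanar) || conflicting L q) other_quads
    & search final (fun i j => nth true (nth [::] table i) j) [seq side_counts it | it <- items] 0
        [::] (nseq 7 0)].

(* Each case is given by the signs of some determinants ([true] for [<= 0]) and
   comes with pairs [(A, B)] of which, in that case, the convex hulls meet. *)
Definition leaves : seq (seq (bool * seq nat) * seq (seq nat * seq nat)) :=
  [:: ([:: (false, [:: 0; 1; 6; 9]); (false, [:: 0; 2; 4; 10]); (false, [:: 0; 2; 5; 8])],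
     [:: ([:: 4; 5], [:: 0; 1; 2]);
      ([:: 5; 8], [:: 0; 1; 6]);
      ([:: 4; 10], [:: 0; 1; 8]);
      ([:: 5; 8], [:: 0; 1; 10]);
      ([:: 5; 8], [:: 0; 2; 4]);
      ([:: 9; 10], [:: 0; 2; 5]);
      ([:: 4; 5], [:: 0; 2; 9]);
      ([:: 5; 7], [:: 0; 3; 4]);
      ([:: 1; 2], [:: 0; 3; 5]);
      ([:: 4; 6], [:: 0; 3; 8]);
      ([:: 1; 2], [:: 0; 3; 9]);
      ([:: 1; 7], [:: 0; 5; 11]);
      ([:: 1; 7], [:: 0; 6; 11]);
      ([:: 1; 6], [:: 0; 7; 9])]);
   ([:: (false, [:: 0; 1; 6; 9]); (false, [:: 0; 2; 4; 10]); (true, [:: 0; 2; 5; 8])],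
     [:: ([:: 4; 5], [:: 0; 1; 2]);
      ([:: 5; 8], [:: 0; 1; 6]);
      ([:: 4; 10], [:: 0; 1; 8]);
      ([:: 5; 8], [:: 0; 1; 10]);
      ([:: 8; 11], [:: 0; 2; 4]);
      ([:: 9; 10], [:: 0; 2; 5]);
      ([:: 4; 5], [:: 0; 2; 9]);
      ([:: 5; 7], [:: 0; 3; 4]);
      ([:: 1; 2], [:: 0; 3; 5]);
      ([:: 4; 6], [:: 0; 3; 8]);
      ([:: 1; 2], [:: 0; 3; 9]);
      ([:: 1; 7], [:: 0; 5; 11]);
      ([:: 1; 7], [:: 0; 6; 11]);
      ([:: 1; 6], [:: 0; 7; 9])]);
   ([:: (false, [:: 0; 1; 6; 9]); (true, [:: 0; 2; 4; 10])],
     [:: ([:: 4; 5], [:: 0; 1; 2]);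
      ([:: 5; 8], [:: 0; 1; 6]);
      ([:: 4; 10], [:: 0; 1; 8]);
      ([:: 5; 8], [:: 0; 1; 10]);
      ([:: 5; 8], [:: 0; 2; 4]);
      ([:: 4; 10], [:: 0; 2; 5]);
      ([:: 3; 5], [:: 0; 2; 9]);
      ([:: 5; 7], [:: 0; 3; 4]);
      ([:: 1; 2], [:: 0; 3; 5]);
      ([:: 4; 6], [:: 0; 3; 8]);
      ([:: 1; 2], [:: 0; 3; 9]);
      ([:: 1; 7], [:: 0; 5; 11]);
      ([:: 1; 7], [:: 0; 6; 11]);
      ([:: 1; 6], [:: 0; 7; 9])]);
   ([:: (true, [:: 0; 1; 6; 9]); (false, [:: 0; 1; 6; 10]); (false, [:: 0; 2; 4; 10]); (false, [:: 0; 2; 5; 8])],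
     [:: ([:: 4; 5], [:: 0; 1; 2]);
      ([:: 5; 8], [:: 0; 1; 6]);
      ([:: 5; 8], [:: 0; 1; 10]);
      ([:: 5; 8], [:: 0; 2; 4]);
      ([:: 9; 10], [:: 0; 2; 5]);
      ([:: 4; 10], [:: 0; 2; 8]);
      ([:: 4; 5], [:: 0; 2; 9]);
      ([:: 1; 2], [:: 0; 3; 5]);
      ([:: 4; 6], [:: 0; 3; 8]);
      ([:: 10; 11], [:: 0; 3; 9]);
      ([:: 1; 8], [:: 0; 4; 10]);
      ([:: 1; 7], [:: 0; 5; 11]);
      ([:: 1; 7], [:: 0; 6; 11])]);
   ([:: (true, [:: 0; 1; 6; 9]); (false, [:: 0; 1; 6; 10]); (false, [:: 0; 2; 4; 10]); (true, [:: 0; 2; 5; 8])],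
     [:: ([:: 4; 5], [:: 0; 1; 2]);
      ([:: 5; 8], [:: 0; 1; 6]);
      ([:: 5; 8], [:: 0; 1; 10]);
      ([:: 8; 11], [:: 0; 2; 4]);
      ([:: 9; 10], [:: 0; 2; 5]);
      ([:: 4; 10], [:: 0; 2; 8]);
      ([:: 4; 5], [:: 0; 2; 9]);
      ([:: 1; 2], [:: 0; 3; 5]);
      ([:: 4; 6], [:: 0; 3; 8]);
      ([:: 10; 11], [:: 0; 3; 9]);
      ([:: 1; 8], [:: 0; 4; 10]);
      ([:: 1; 7], [:: 0; 5; 11]);
      ([:: 1; 7], [:: 0; 6; 11])]);
   ([:: (true, [:: 0; 1; 6; 9]); (false, [:: 0; 1; 6; 10]); (true, [:: 0; 2; 4; 10])],
     [:: ([:: 4; 5], [:: 0; 1; 2]);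
      ([:: 5; 8], [:: 0; 1; 6]);
      ([:: 5; 8], [:: 0; 1; 10]);
      ([:: 5; 8], [:: 0; 2; 4]);
      ([:: 3; 10], [:: 0; 2; 5]);
      ([:: 3; 5], [:: 0; 2; 9]);
      ([:: 1; 2], [:: 0; 3; 5]);
      ([:: 4; 6], [:: 0; 3; 8]);
      ([:: 10; 11], [:: 0; 3; 9]);
      ([:: 1; 8], [:: 0; 4; 10]);
      ([:: 1; 7], [:: 0; 5; 11]);
      ([:: 1; 7], [:: 0; 6; 11]);
      ([:: 1; 8], [:: 0; 7; 9])]);
   ([:: (true, [:: 0; 1; 6; 9]); (true, [:: 0; 1; 6; 10]); (false, [:: 0; 1; 8; 9])],
     [:: ([:: 4; 5], [:: 0; 1; 2]);
      ([:: 3; 8], [:: 0; 2; 4]);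
      ([:: 3; 10], [:: 0; 2; 5]);
      ([:: 6; 11], [:: 0; 2; 9]);
      ([:: 1; 2], [:: 0; 3; 5]);
      ([:: 4; 6], [:: 0; 3; 8]);
      ([:: 10; 11], [:: 0; 3; 9]);
      ([:: 1; 7], [:: 0; 4; 9]);
      ([:: 1; 8], [:: 0; 4; 10]);
      ([:: 1; 7], [:: 0; 4; 11]);
      ([:: 1; 10], [:: 0; 5; 11]);
      ([:: 1; 10], [:: 0; 6; 11]);
      ([:: 1; 8], [:: 0; 7; 9])]);
   ([:: (true, [:: 0; 1; 6; 9]); (true, [:: 0; 1; 6; 10]); (true, [:: 0; 1; 8; 9])],
     [:: ([:: 4; 5], [:: 0; 1; 2]);
      ([:: 3; 8], [:: 0; 2; 4]);
      ([:: 9; 10], [:: 0; 2; 5]);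
      ([:: 4; 10], [:: 0; 2; 8]);
      ([:: 4; 5], [:: 0; 2; 9]);
      ([:: 1; 2], [:: 0; 3; 5]);
      ([:: 4; 6], [:: 0; 3; 8]);
      ([:: 10; 11], [:: 0; 3; 9]);
      ([:: 1; 7], [:: 0; 4; 9]);
      ([:: 1; 8], [:: 0; 4; 10]);
      ([:: 1; 7], [:: 0; 4; 11]);
      ([:: 1; 10], [:: 0; 5; 11]);
      ([:: 1; 10], [:: 0; 6; 11])])].

(* The last two conflicts say that the hexagon of coplanar points occurring for
   [b = c] is not a face. *)
Definition flat_leaf : seq (seq nat * seq nat) :=
  [:: ([:: 4; 5], [:: 0; 1; 2]); ([:: 0; 6], [:: 0; 6]); ([:: 0; 5], [:: 0; 7])].

(** The first five of [other_quads] are never coplanar for b > c. The determinant of the sixth is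
    one of those that distinguish the cases, so conflicts have to exclude it. *)
Lemma leaves_check : all (fun lf => leaf_check lf.2 (take 5 other_quads)) leaves.
Proof. by vm_compute. Qed.

Lemma flat_leaf_check : leaf_check flat_leaf [::].
Proof. by vm_compute. Qed.

End LabelCombinatorics.

(** * The map with 32 triangles *)

(** The orbits of [target] in blocks of 12, 12, 4 and 4, each obtained by rotating its first
    triangle. The cyclic orders of the four first triangles are chosen to orient the surface, so no
    boundary has to be reversed. *)
Definition triangle_table : seq (seq nat) :=
  [:: [:: 0; 4; 1]; [:: 1; 5; 0]; [:: 2; 6; 3]; [:: 3; 7; 2]; [:: 4; 8; 7]; [:: 5; 9; 6];
      [:: 6; 10; 5]; [:: 7; 11; 4]; [:: 8; 0; 10]; [:: 9; 1; 11]; [:: 10; 2; 8]; [:: 11; 3; 9];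
      [:: 0; 3; 4]; [:: 1; 2; 5]; [:: 2; 1; 6]; [:: 3; 0; 7]; [:: 4; 6; 8]; [:: 5; 7; 9];
      [:: 6; 4; 10]; [:: 7; 5; 11]; [:: 8; 9; 0]; [:: 9; 8; 1]; [:: 10; 11; 2]; [:: 11; 10; 3];
      [:: 0; 5; 10]; [:: 1; 4; 11]; [:: 2; 7; 8]; [:: 3; 6; 9]; [:: 0; 9; 7]; [:: 1; 8; 6];
      [:: 2; 11; 5]; [:: 3; 10; 4]]%N.

Definition triangle (f : nat) : seq nat := nth [::] triangle_table f.

Definition triangle_map : map_data :=
  @MapData 'I_12 'I_32 (fun f => [seq inord k | k <- triangle f]).

Fixpoint reach (T : eqType) (s : seq T) (adj : rel T) (n : nat) (S : seq T) : seq T :=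
  if n is n'.+1 then let S' := reach s adj n' S in [seq y <- s | (y \in S') || has (fun x => adj x y) S']
  else S.

Lemma reach_connect (T : eqType) (U : finType) (h : T -> U) (s : seq T) (adj : rel T) (e : rel U) n x y :
  {in s &, forall x y, adj x y -> e (h x) (h y)} -> x \in s -> y \in reach s adj n [:: x] ->
  connect e (h x) (h y).
Proof.
move=> hh xs; elim: n y => [|n IH] y /=; first by rewrite inE => /eqP->; exact: connect0.
rewrite mem_filter => /andP[/orP[/IH //|/hasP[z zr azy] ys]].
have zs : z \in s by case: n {IH} zr => [|n] /=; [rewrite inE => /eqP->|rewrite mem_filter => /andP[]].
by apply: connect_trans (IH _ zr) (connect1 _); exact: hh.
Qed.

Lemma triangle_shape_check : all (fun t => [&& uniq t, size t == 3 & all (fun k => k < 12) t]%N) triangle_table.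
Proof. by vm_compute. Qed.

Lemma triangle_pairs_check : all (fun t => all (fun k => all (fun k' => (k == k') ||
    (count (fun s => (k \in s) && (k' \in s)) triangle_table == 2)%N) t) t) triangle_table.
Proof. by vm_compute. Qed.

Definition share_edge_at (k f g : nat) : bool :=
  has (fun k' => (k' != k) && (k' \in triangle g)) (triangle f).

Lemma triangle_links_check : all (fun k =>
    let s := [seq f <- iota 0 32 | k \in triangle f] in
    (size s == 8)%N && all (fun f => all (fun g => g \in reach s (share_edge_at k) 4 [:: f]) s) s)
  (iota 0 12).
Proof. by vm_compute. Qed.

Lemma triangle_connected_check : all (fun k => all (fun k' =>
    k' \in reach (iota 0 12) (fun i j => (i != j) && has (fun t => (i \in t) && (j \in t)) triangle_table) 2 [:: k])
  (iota 0 12)) (iota 0 12).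
Proof. by vm_compute. Qed.

Lemma triangle_oriented_check : all (fun f => all (fun g => (f == g) || all (fun k => (k \notin triangle g) ||
    (next (triangle f) k != next (triangle g) k)) (triangle f)) (iota 0 32)) (iota 0 32).
Proof. by vm_compute. Qed.

Lemma triangle_meets_check : all (fun f => all (fun g => (f == g) ||
    (size [seq k <- triangle f | k \in triangle g] <= 2)%N) (iota 0 32)) (iota 0 32).
Proof. by vm_compute. Qed.

Lemma card_ord_count (n : nat) (P : pred nat) : #|[pred i : 'I_n | P i]| = count P (iota 0 n).
Proof. by rewrite -sum1_card big_mkcond -(big_mkord predT (fun i => if P i then 1 else 0)%N) -big_mkcond sum1_count /index_iota subn0. Qed.

Section TriangleFaces.
Variable M : map_data.
Implicit Types (f : face M) (w : vert M).

Lemma triangle_edge f w w' : uniq (bdry f) -> size (bdry f) = 3%N -> w \in bdry f -> w' \in bdry f ->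
  w != w' -> [set w; w']%SET \in face_edges f.
Proof.
move=> us s3 hw hw' ww'; have ss : (3 <= size (bdry f))%N by rewrite s3.
have [y [z [t [e1 e2 ut st ct]]]] := next_unfold us ss hw.
have t0 : t = [::] by have := perm_size (uniq_perm us ut st); rewrite s3; case: (t).
rewrite {}t0 in ut st ct.
have e3 : next (bdry f) z = w by move: ct => /= /and4P[_ _ /eqP].
move: hw'; rewrite st !inE eq_sym (negPf ww') /= => /orP[]/eqP->.
  by rewrite -e1; exact: imset_f.
have : [set z; next (bdry f) z]%SET \in face_edges f by apply: imset_f; rewrite st !inE eqxx !orbT.
by rewrite e3 finset.setUC.
Qed.

Lemma triangle_edgeP f (E : {set vert M}) : uniq (bdry f) -> size (bdry f) = 3%N ->
  (E \in face_edges f) = (E \subset face_verts f) && (#|E| == 2)%N.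
Proof.
move=> us s3; apply/idP/andP => [/imsetP[w hw eE]|[sub /cards2P[w [w' [ww' eE]]]]]; first rewrite {E}eE.
  have [n1 _ _] := next_neq us (eq_leq (esym s3)) hw.
  rewrite cards2 (eq_sym w) n1; split=> //; apply/fintype.subsetP => w'.
  by rewrite !inE => /orP[]/eqP-> //; rewrite mem_next.
rewrite eE; apply: triangle_edge => //; have := fintype.subsetP sub; rewrite eE => h.
  by have := h w; rewrite !inE eqxx => ->.
by have := h w'; rewrite !inE eqxx orbT => ->.
Qed.

End TriangleFaces.

(** The edges of a triangle are all its pairs of vertices, so corresponding vertex sets have
    corresponding edges. *)
Lemma triangle_edges_map (M N : map_data) (phi : vert M -> vert N) (f : face M) (g : face N) :
  bijective phi -> uniq (bdry f) -> size (bdry f) = 3%N -> uniq (bdry g) -> size (bdry g) = 3%N ->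
  face_verts g = [set phi w | w in face_verts f]%SET ->
  face_edges g = [set [set phi w | w in (e : {set vert M})] | e in face_edges f]%SET.
Proof.
case=> ihp K1 K2 uf sf ug sg fg.
have cardE (E : {set vert M}) : #|[set phi w | w in E]%SET| = #|E|.
  by rewrite card_imset //; exact: can_inj K1.
apply/setP => E; rewrite triangle_edgeP //.
apply/andP/imsetP => [[sub cE]|[E' + ->]]; last first.
  by rewrite triangle_edgeP // => /andP[s' c']; rewrite fg imsetS // cardE.
have eE : E = [set phi w | w in [set ihp w | w in E]]%SET.
  rewrite -imset_comp -[LHS]imset_id; apply: eq_imset => w /=; by rewrite K2.
exists [set ihp w | w in E]%SET => //; rewrite triangle_edgeP // -cardE -eE cE andbT.
apply/fintype.subsetP => w /imsetP[z hz ->].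
by move/fintype.subsetP: sub => /(_ z hz); rewrite fg => /imsetP[w' hw' ->]; rewrite K1.
Qed.

Section TriangleMap.
Local Notation M := triangle_map.
Implicit Types (f g : face M) (w : vert M).

Lemma triangle_shape f : [/\ uniq (triangle f), size (triangle f) = 3%N & all (fun k => k < 12)%N (triangle f)].
Proof.
have h : triangle f \in triangle_table by rewrite mem_nth // (ltn_ord f).
by have /and3P[-> /eqP-> ->] := allP triangle_shape_check _ h.
Qed.

Lemma val_bdry f : map val (bdry f) = triangle f.
Proof.
have [_ _ h] := triangle_shape f; rewrite /bdry /= -map_comp map_id_in // => k /(allP h) hk /=.
by rewrite inordK.
Qed.

Lemma mem_bdry f w : (w \in bdry f) = (val w \in triangle f).
Proof. by rewrite -val_bdry mem_map //; exact: val_inj. Qed.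

Lemma bdry_uniq f : uniq (bdry f).
Proof. by rewrite -(map_inj_uniq val_inj) val_bdry; case: (triangle_shape f). Qed.

Lemma bdry_size f : size (bdry f) = 3%N.
Proof. by rewrite -(size_map val) val_bdry; case: (triangle_shape f). Qed.

Lemma triangle_map_edgeP f (E : {set vert M}) :
  (E \in face_edges f) = (E \subset face_verts f) && (#|E| == 2)%N.
Proof. exact: triangle_edgeP (bdry_uniq f) (bdry_size f). Qed.

Lemma set2_edge f w w' : ([set w; w']%SET \in face_edges f) =
  [&& w != w', val w \in triangle f & val w' \in triangle f].
Proof.
rewrite triangle_map_edgeP cards2 eqSS eqb1 andbC; congr (_ && _).
rewrite -!mem_bdry; apply/fintype.subsetP/andP => [h|[h1 h2] z].
  by have := (h w, h w'); rewrite !inE !eqxx orbT => -[-> // -> //].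
by rewrite !inE => /orP[]/eqP->.
Qed.

Lemma triangle_closed_surface : closed_surface M.
Proof.
split.
- move=> w; have /andP[/eqP h _] := all_iotaP _ _ triangle_links_check w (ltn_ord w).
  have : (0 < size [seq f <- iota 0 32 | val w \in triangle f])%N by rewrite h.
  rewrite size_filter -has_count => /hasP[f]; rewrite mem_iota => hf wf.
  by exists (Ordinal hf : face M); rewrite mem_bdry.
- move=> E /bigcupP[f _ hE]; have /imsetP[w hw eE] := hE.
  have hE' := hE; rewrite eE set2_edge in hE'; case/and3P: hE' => ne h1 h2.
  have hf : triangle f \in triangle_table by rewrite mem_nth // (ltn_ord f).
  have := allP (allP (allP triangle_pairs_check _ hf) _ h1) _ h2.
  rewrite (inj_eq val_inj) (negPf ne) orFb => /eqP; apply: etrans.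
  have -> : triangle_table = [seq triangle i | i <- iota 0 32] by [].
  rewrite count_map.
  rewrite -(card_ord_count 32 (fun i => (val w \in triangle i) && (val (next (bdry f) w) \in triangle i))).
  by apply: eq_card => g; rewrite !inE eE set2_edge ne.
move=> w f g; rewrite !mem_bdry => hf hg.
have /andP[_] := all_iotaP _ _ triangle_links_check w (ltn_ord w).
set s := [seq _ <- _ | _] => /allP h.
have sf : val f \in s by rewrite mem_filter hf mem_iota (ltn_ord f).
have sg : val g \in s by rewrite mem_filter hg mem_iota (ltn_ord g).
have := allP (h _ sf) _ sg.
move/(@reach_connect _ _ (fun i => inord i : 'I_32) s _ (adjacent_at w) 4 (val f) (val g)) => hc.
suff : connect (adjacent_at w) (inord f : 'I_32) (inord g : 'I_32) by rewrite !inord_val.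
apply: hc => // i j; rewrite !mem_filter !mem_iota => /andP[wi hi] /andP[wj hj] /hasP[k ki /andP[kw kj]].
have hk : (k < 12)%N.
  by have [_ _ /allP/(_ k)] := triangle_shape (inord i : 'I_32); rewrite inordK // => /(_ ki).
apply/existsP; exists (inord k : 'I_12); rewrite /common_edge finset.in_setI !set2_edge.
by rewrite !inordK // -val_eqE /= inordK // kw ki kj wi wj.
Qed.

Lemma triangle_connected : connected_map M.
Proof.
split=> [|w w']; first by rewrite card_ord.
have := all_iotaP _ _ (all_iotaP _ _ triangle_connected_check w (ltn_ord w)) w' (ltn_ord w').
move/(@reach_connect _ _ (fun i => inord i : 'I_12) _ _ (@Defs.adjacent M) 2 (val w) (val w')) => hc.
suff : connect (@Defs.adjacent M) (inord w : 'I_12) (inord w' : 'I_12) by rewrite !inord_val.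
apply: hc; last by rewrite mem_iota ltn_ord.
move=> i j; rewrite !mem_iota => hi hj /andP[ij /hasP[t ht /andP[it jt]]].
have hf : (index t triangle_table < 32)%N by rewrite -[32%N]/(size triangle_table) index_mem.
apply/bigcupP; exists (Ordinal hf : face M) => //.
have vi k : (k < 12)%N -> val (inord k : 'I_12) = k by exact: inordK.
by rewrite set2_edge -(inj_eq val_inj) [X in triangle X]/= /triangle nth_index // !vi // ij it jt.
Qed.

Lemma triangle_orientable : orientable M.
Proof.
exists (fun _ => false) => /= f g w hf hg e.
have nx (h : face M) : val (next (bdry h) w) = next (triangle h) (val w).
  by rewrite -val_bdry (next_map val_inj) // bdry_uniq.
have := all_iotaP _ _ (all_iotaP _ _ triangle_oriented_check f (ltn_ord f)) g (ltn_ord g).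
case/orP => [/eqP/val_inj //|/allP/(_ (val w))]; rewrite -!mem_bdry hf hg /= => /(_ isT).
by rewrite -!nx e eqxx.
Qed.

Lemma triangle_map_polyhedral : polyhedral_map M.
Proof.
split; [|exact: triangle_closed_surface|exact: triangle_connected|exact: triangle_orientable|].
  by move=> f; rewrite bdry_uniq bdry_size.
move=> f g fg /=; set I := _ :&: _; have [le|gt] := leqP #|I| 1; [by left|right].
have I2 : #|I| = 2%N.
  apply/eqP; rewrite eqn_leq gt andbT.
  have := all_iotaP _ _ (all_iotaP _ _ triangle_meets_check f (ltn_ord f)) g (ltn_ord g).
  rewrite (inj_eq val_inj) (negPf fg) /=; apply: leq_trans.
  rewrite -(val_bdry f) filter_map size_map; set s := [seq _ <- _ | _].
  apply: leq_trans (card_size s); apply/subset_leq_card/fintype.subsetP => w.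
  by rewrite !inE mem_filter => /andP[-> h2]; rewrite /= -mem_bdry h2.
by rewrite finset.in_setI !triangle_map_edgeP I2 eqxx finset.subsetIl finset.subsetIr.
Qed.

Lemma triangle_degree w : #|[pred f : face M | w \in bdry f]| = 8%N.
Proof.
have /andP[/eqP h _] := all_iotaP _ _ triangle_links_check w (ltn_ord w); apply: etrans h.
rewrite size_filter -(card_ord_count 32 (fun i => val w \in triangle i)).
by apply: eq_card => f; rewrite !inE mem_bdry.
Qed.

End TriangleMap.

(** * Orbits of faces *)

Lemma mul12_inv_check : all (fun g => has (fun g' =>
    all (fun k => mul12 g' (mul12 g k) == k) (iota 0 12)) (iota 0 12)) (iota 0 12).
Proof. by vm_compute. Qed.

Lemma mul12_inv g : (g < 12)%N -> exists2 g', (g' < 12)%N &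
  forall k, (k < 12)%N -> mul12 g' (mul12 g k) = k.
Proof.
move=> hg; have := mul12_inv_check => /all_iotaP/(_ g hg)/hasP[g'].
by rewrite mem_iota => hg' /all_iotaP h; exists g' => // k hk; apply/eqP/h.
Qed.

Lemma labels_mul g s : (g < 12)%N -> labels s -> labels (map (mul12 g) s).
Proof. by move=> hg /allP h; rewrite /labels all_map; apply/allP => k /h /= /(mul12_lt hg). Qed.

Lemma imagesP s t : reflect (exists2 g, (g < 12)%N & t = map (mul12 g) s) (t \in images s).
Proof.
apply: (iffP mapP) => [[g]|[g hg ->]]; first by rewrite mem_iota => hg ->; exists g.
by exists g; rewrite ?mem_iota.
Qed.

Lemma leq_sum_subset (T : eqType) (F : T -> nat) (l l' : seq T) :
  uniq l -> {subset l <= l'} -> (\sum_(x <- l) F x <= \sum_(x <- l') F x)%N.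
Proof.
elim: l l' => [|x l IH] l'; first by rewrite big_nil.
move=> /= /andP[xl ul] sub; have xl' : x \in l' by apply: sub; rewrite inE eqxx.
rewrite (perm_big _ (perm_to_rem xl')) !big_cons leq_add2l; apply: IH => // y yl.
have : y \in l' by apply: sub; rewrite inE yl orbT.
by rewrite (perm_mem (perm_to_rem xl')) inE; case: eqP yl xl => // -> ->.
Qed.

(** Each edge is on two faces, so the right side is 2E - 2F, and Euler's formula turns it into 2V +
    4g - 4. *)
Lemma genus_excess (R : realType) (M : map_data) (p : vert M -> 'rV[R]_3) g : polyhedron p ->
  has_genus M g -> (2 <= g)%N -> (#|vert M| * 2 + 4 <= \sum_(f : face M) (size (bdry f) - 2))%N.
Proof.
move=> hp; rewrite /has_genus -addnn => hg g2; have dc := double_count hp.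
have sz : (\sum_(f : face M) (size (bdry f) - 2) + #|face M| * 2 = \sum_(f : face M) size (bdry f))%N.
  rewrite -sum_nat_const -big_split /=; apply: eq_bigr => f _.
  by rewrite subnK // ltnW // (face_size hp).
rewrite -(leq_add2r (#|face M| * 2)) sz dc; lia.
Qed.

Section FaceLabels.
Variables (R : realType) (M : map_data) (p : vert M -> 'rV[R]_3).
Local Notation E3 := 'rV[R]_3.
Hypothesis hp : polyhedron p.
Variables (e : nat -> E3) (d c v u : R) (lab : nat -> vert M).
Hypothesis hl : labelling p e d c v u lab.
Implicit Types (f : face M) (s t A B it : seq nat).

Local Notation vset := (vset lab).
Local Notation is_face := (is_face lab).
Local Notation in_face := (in_face lab).

Lemma vset_same s t : same_labels s t -> vset s = vset t.
Proof.
case/andP=> /allP st /allP ts; apply/setP => w; rewrite !inE.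
by apply/mapP/mapP => -[k ks ->]; exists k => //; [apply: ts|apply: st].
Qed.

Lemma in_face_image g s : (g < 12)%N -> labels s -> in_face (map (mul12 g) s) -> in_face s.
Proof.
move=> hg ls h; have [g' hg' e'] := mul12_inv hg.
have := in_face_mul hl hg' (labels_mul hg ls) h.
rewrite -map_comp map_id_in // => k ks /=.
by rewrite e' //; move/allP: ls; apply.
Qed.

Lemma is_face_image g s : (g < 12)%N -> labels s -> is_face (map (mul12 g) s) = is_face s.
Proof.
move=> hg ls; apply/idP/idP => h; last exact: (is_face_mul hl).
have [g' hg' e'] := mul12_inv hg.
have := is_face_mul hl hg' (labels_mul hg ls) h.
rewrite -map_comp map_id_in // => k ks /=.
by rewrite e' //; move/allP: ls; apply.
Qed.

Lemma in_face_contains s A : labels A -> contains_image s A -> in_face s -> in_face A.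
Proof.
move=> lA /hasP[A' /imagesP[g hg ->] /allP sub] h; apply: (in_face_image hg lA).
exact: in_faceS h.
Qed.

Lemma is_face_is_image s t : labels t -> is_image s t -> is_face s = is_face t.
Proof.
move=> lt /hasP[t' /imagesP[g hg ->] /vset_same h].
by rewrite -(is_face_image hg lt) /is_face h.
Qed.

Definition face_labels f : seq nat := [seq k <- iota 0 12 | lab k \in face_verts f].

Lemma vset_face_labels f : vset (face_labels f) = face_verts f.
Proof.
apply/setP => w; rewrite inE; apply/mapP/idP => [[k]|hw].
  by rewrite mem_filter => /andP[h _] ->.
have [k hk e'] := lab_surj hl w; exists k => //.
by rewrite mem_filter mem_iota hk -e' hw.
Qed.

Lemma is_face_labels f : is_face (face_labels f).
Proof. by apply/existsP; exists f; rewrite vset_face_labels. Qed.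

Lemma labels_face_labels f : labels (face_labels f).
Proof. by apply/allP => k; rewrite mem_filter mem_iota => /andP[]. Qed.

Hypothesis labI : {in [pred k | (k < 12)%N] &, injective lab}.

Lemma card_vset s : uniq s -> labels s -> #|vset s| = size s.
Proof.
move=> us /allP ls; rewrite cardsE (card_uniqP _) ?size_map // map_inj_in_uniq //.
by move=> k k' /ls h /ls h'; apply: labI.
Qed.

Lemma size_face_labels f : size (face_labels f) = size (bdry f).
Proof.
rewrite -card_vset ?labels_face_labels ?filter_uniq ?iota_uniq // vset_face_labels.
by rewrite cardsE (card_uniqP (face_uniq hp f)).
Qed.

Lemma mem_vset s k : (k < 12)%N -> labels s -> (lab k \in vset s) = (k \in s).
Proof.
move=> hk /allP ls; rewrite inE; apply/mapP/idP => [[k' k's /labI h]|ks].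
  by rewrite h // inE ls.
by exists k.
Qed.

Lemma card_vert : #|vert M| = 12%N.
Proof.
rewrite -cardsT -(size_iota 0 12) -card_vset ?iota_uniq //.
congr #|pred_of_set _|; apply/setP => w; have [k hk ->] := lab_surj hl w.
by rewrite finset.in_setT mem_vset // mem_iota.
Qed.

Variable g0 : nat.
Hypothesis genus : has_genus M g0.
Hypothesis genus2 : (2 <= g0)%N.

Lemma genus_weight : (28 <= \sum_(f : face M) (size (bdry f) - 2))%N.
Proof. by have := genus_excess hp genus genus2; rewrite card_vert. Qed.

(** Faces are determined by their vertex sets, and each of these is among the distinct images of the
    representatives in [l] that are faces. So the total weight of these is at least the sum over all
    faces. *)
Lemma weight_bound (l : seq (seq nat)) :
  (forall s, s \in l -> labels s /\ uniq s) ->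
  (forall f, has (is_image (face_labels f)) l) ->
  (28 <= sumn [seq weight it | it <- l & is_face it])%N.
Proof.
move=> hl' cls; apply: leq_trans genus_weight _.
pose cand := flatten [seq distinct_images it | it <- l & is_face it].
have candP s : s \in cand -> exists2 it, it \in l & s \in images it.
  move=> /flatten_mapP[it]; rewrite mem_filter => /andP[_ itl] hs; exists it => //.
  exact: distinct_images_sub.
have -> : sumn [seq weight it | it <- l & is_face it] = (\sum_(s <- cand) (size s - 2))%N.
  rewrite /cand big_flatten big_map sumnE big_map; apply: eq_big_seq => it.
  rewrite mem_filter => /andP[_ itl]; rewrite /weight -sum1_size big_distrl /=.
  apply: eq_big_seq => s hs; rewrite mul1n.
  by have /imagesP[g _ ->] := distinct_images_sub hs; rewrite size_map.
pose F (S : {set vert M}) := (#|S| - 2)%N.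
have lab_im s g : labels s -> (g < 12)%N -> labels (map (mul12 g) s) by move=> ls hg; exact: labels_mul.
have un_im s g : uniq s -> labels s -> (g < 12)%N -> uniq (map (mul12 g) s).
  move=> us /allP ls hg; rewrite map_inj_in_uniq // => k k' /ls hk /ls hk' h.
  have [g' _ h'] := mul12_inv hg.
  by rewrite -(h' k) // -(h' k') // h.
have -> : (\sum_(s <- cand) (size s - 2) = \sum_(S <- map vset cand) F S)%N.
  rewrite big_map; apply: eq_big_seq => s /candP[it /hl'[li ui] /imagesP[g hg ->]].
  by rewrite /F card_vset ?lab_im ?un_im.
have -> : (\sum_(f : face M) (size (bdry f) - 2) = \sum_(S <- [seq face_verts f | f <- enum (face M)]) F S)%N.
  rewrite big_map -big_enum; apply: eq_bigr => f _; rewrite /F.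
  by rewrite cardsE (card_uniqP (face_uniq hp f)).
apply: leq_sum_subset; first by rewrite map_inj_uniq ?enum_uniq //; exact: (face_verts_inj hp).
move=> S /mapP[f _ ->]; have /hasP[it itl im] := cls f.
have itF : is_face it by rewrite -(is_face_is_image _ im) ?is_face_labels //; case: (hl' it itl).
have [s' hs' ss'] := is_image_distinct im.
apply/mapP; exists s'; last by rewrite -vset_face_labels; exact: vset_same.
by apply/flatten_mapP; exists it; rewrite // mem_filter itF.
Qed.

End FaceLabels.

Lemma items_check : all (fun it => uniq it && labels it && ((size it == 3) || (size it == 4))%N) items.
Proof. by vm_compute. Qed.

Lemma item_labels it : it \in items -> labels it /\ uniq it.
Proof. by move=> h; have := allP items_check it h => /andP[/andP[]]. Qed.

Lemma mul12_uniq g s : (g < 12)%N -> labels s -> uniq s -> uniq (map (mul12 g) s).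
Proof.
move=> hg /allP ls us; rewrite map_inj_in_uniq // => k k' /ls hk /ls hk' h.
have [g' _ h'] := mul12_inv hg.
by rewrite -(h' k) // -(h' k') // h.
Qed.

Lemma four_items it : it \in items -> size it = 4%N -> it = quad1 \/ it = quad2.
Proof.
rewrite mem_cat => /orP[h|]; last by rewrite !inE => /orP[]/eqP->; [left|right].
have /allP : all (fun s => size s == 3)%N candidate_triples by [].
by move/(_ it h)/eqP => ->.
Qed.

(** * Counting the faces on an edge *)

Section EdgeCounts.
Variables (R : realType) (M : map_data) (p : vert M -> 'rV[R]_3).
Local Notation E3 := 'rV[R]_3.
Hypothesis hp : polyhedron p.
Variables (e : nat -> E3) (d c v u : R) (lab : nat -> vert M).
Hypothesis hl : labelling p e d c v u lab.
Hypothesis labI : {in [pred k | (k < 12)%N] &, injective lab}.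
Implicit Types (f : face M) (s t A B it : seq nat).

Local Notation vset := (vset lab).
Local Notation is_face := (is_face lab).
Local Notation in_face := (in_face lab).
Local Notation x := (coords c v u).
Local Notation P k := (mv (rotation k) x).

Lemma vset2 k k' : vset [:: k; k'] = [set lab k; lab k']%SET.
Proof. by apply/setP => w; rewrite !inE. Qed.

Lemma vset2C k k' : vset [:: k; k'] = vset [:: k'; k].
Proof. by rewrite !vset2 finset.setUC. Qed.

Lemma quad_edges f (s0 s1 s2 s3 : nat) : uniq [:: s0; s1; s2; s3] -> labels [:: s0; s1; s2; s3] ->
  face_verts f = vset [:: s0; s1; s2; s3] ->
  vset [:: s0; s2] \notin face_edges f -> vset [:: s1; s3] \notin face_edges f ->
  vset [:: s0; s1] \in face_edges f /\ vset [:: s0; s3] \in face_edges f.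
Proof.
move=> us ls hf d02 d13; have usf := face_uniq hp f; have ssf := face_size hp f.
have inb w : (w \in bdry f) = (w \in map lab [:: s0; s1; s2; s3]).
  by transitivity (w \in face_verts f); [rewrite inE|rewrite hf inE].
have h0 : lab s0 \in bdry f by rewrite inb !inE eqxx.
have nb w w' : w \in bdry f -> [set w; w']%SET \in face_edges f -> w = lab s0 -> w' \in bdry f ->
    w' != lab s0 -> w' \in [:: lab s1; lab s3].
  move=> _ hE ew hw' w'0; move: hw'; rewrite inb !inE (negPf w'0) /= orbCA.
  case/orP => // /eqP e2; move: d02; rewrite vset2 -e2 -ew hE //.
have [a1 a2 a3] := next_neq usf ssf h0.
have nE : [set lab s0; next (bdry f) (lab s0)]%SET \in face_edges f by exact: imset_f.
have n1 : next (bdry f) (lab s0) \in [:: lab s1; lab s3].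
  by apply: (nb (lab s0)) => //; rewrite mem_next.
pose w := prev (bdry f) (lab s0).
have hw : w \in bdry f by rewrite mem_prev.
have ew : next (bdry f) w = lab s0 by rewrite next_prev.
have [b1 b2 b3] := next_neq usf ssf hw; rewrite ew in b1 b2 b3.
have wE : [set lab s0; w]%SET \in face_edges f by rewrite finset.setUC -ew; exact: imset_f.
have n2 : w \in [:: lab s1; lab s3].
  by apply: (nb (lab s0)) => //; rewrite eq_sym.
rewrite !vset2; move: n1 n2; rewrite !inE => /orP[]/eqP e1 /orP[]/eqP e2; split;
  by [rewrite -e1|rewrite -e2|move: b2; rewrite e1 e2 eqxx].
Qed.

Lemma crossing_pairs f k0 k1 k2 k3 (a0 a1 a2 a3 : R) :
  labels [:: k0; k1; k2; k3] -> uniq [:: k0; k1; k2; k3] ->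
  vset [:: k0; k1] \in face_edges f -> vset [:: k2; k3] \subset face_verts f ->
  [/\ 0 <= a0, 0 <= a1, 0 <= a2 & 0 <= a3] -> 0 < a0 + a1 -> a0 + a1 = a2 + a3 ->
  (forall j, (j < 3)%N -> a0 * P k0 j + a1 * P k1 j = a2 * P k2 j + a3 * P k3 j) -> False.
Proof.
move=> lt un hE hv [p0 p1 p2 p3] s0 ss hd.
have [fr _ hpt _ _] := hl.
have [h0 h1 h2 h3] : [/\ k0 < 12, k1 < 12, k2 < 12 & k3 < 12]%N.
  by move: lt => /= /and5P[-> -> -> -> _].
apply: (@dependent_edge _ _ p _ hp (labelled_sphere hl) f f
  [:: (lab k0, a0); (lab k1, a1)] [:: (lab k2, a2); (lab k3, a3)] _ hE).
- by move=> y /[1!inE] /orP[/eqP->|/[1!inE]/eqP->] /=; rewrite vset2 !inE eqxx ?orbT.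
- move: hv; rewrite vset_sub => /and3P[m2 m3 _] y.
  by move=> /[1!inE] /orP[/eqP->|/[1!inE]/eqP->].
- by rewrite !big_cons big_nil addr0.
- by rewrite !big_cons !big_nil /= !addr0.
- rewrite !big_cons !big_nil /= !addr0 !hpt //.
  have l2 b0 b1 (q q' : nat -> R) : b0 *: lin e q + b1 *: lin e q' =
      lin e (fun j => b0 * q j + b1 * q' j).
    by rewrite /lin; apply: vecP; rewrite !mxE; ring.
  by rewrite !l2; apply: lin_ext; exact: hd.
move=> y z; rewrite vset2 !inE => hy hz.
have ne i j : i \in [:: k0; k1] -> j \in [:: k2; k3] -> lab i != lab j.
  move=> hi hj; apply/eqP => /labI h.
  have lt' z' : z' \in [:: k0; k1] ++ [:: k2; k3] -> (z' < 12)%N by move: z'; apply/allP.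
  have eij : i = j by apply: h; rewrite inE lt' // mem_cat ?hi ?hj ?orbT.
  move: un; rewrite -[[:: k0; k1; k2; k3]]/([:: k0; k1] ++ [:: k2; k3]) cat_uniq.
  by case/and3P=> _ /hasP un _; apply: un; exists j => //=; rewrite -eij.
by case/orP: hy => /eqP->; case/orP: hz => /eqP->; apply: ne; rewrite !inE eqxx ?orbT.
Qed.

Hypothesis gen : 0 < v \/ 0 < u /\ 0 < c.

(** The two diagonals cross, and a crossed segment is no edge. Coplanarity supplies the crossing:
    the diagonals of [quad1] have the same midpoint once a = b, and those of [quad2] are divided in
    the ratio of a to b once ac = b^2. *)
Lemma quad_diagonals f it : it = quad1 \/ it = quad2 -> face_verts f = vset it ->
  vset [:: nth 0%N it 0; nth 0%N it 2] \notin face_edges f /\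
  vset [:: nth 0%N it 1; nth 0%N it 3] \notin face_edges f.
Proof.
have [_ [c0 v0 u0] _ _ _] := hl.
have sub it' k k' : k \in it' -> k' \in it' -> face_verts f = vset it' -> vset [:: k; k'] \subset face_verts f.
  move=> hk hk' ->; rewrite vset_sub /= andbT; apply/andP; split; rewrite inE; exact: map_f.
case=> -> hf.
  have := @coplanar_det _ _ _ hp _ _ _ _ _ _ hl f 0 4 1 5 isT.
  rewrite hf fintype.subxx => /(_ isT); rewrite /rdet /det_points /mv /rotation /coords /= => D.
  have u00 : u = 0.
    (* The determinant is a multiple of u(ab - c^2), and the second factor is positive. *)
    have h : u * ((c + v + u) * (c + v) - c ^+ 2) = 0 by move: D; lra.
    have : 0 < (c + v + u) * (c + v) - c ^+ 2 by case: gen => [v1|[u1 c1]]; nra.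
    by move=> q; move/eqP: h; rewrite mulf_eq0 (gt_eqF q) orbF => /eqP.
  split; apply/negP => hE.
    apply: (@crossing_pairs f 0 1 4 5 1 1 1 1 isT isT hE); [exact: (sub quad1)|split; exact: ler01|lra|by []|].
    by case=> [|[|[|//]]] _; rewrite /mv /rotation /coords /= ?u00; ring.
  apply: (@crossing_pairs f 4 5 0 1 1 1 1 1 isT isT hE); [exact: (sub quad1)|split; exact: ler01|lra|by []|].
  by case=> [|[|[|//]]] _; rewrite /mv /rotation /coords /= ?u00; ring.
have := @coplanar_det _ _ _ hp _ _ _ _ _ _ hl f 0 1 9 8 isT.
rewrite hf fintype.subxx => /(_ isT); rewrite /rdet /det_points /mv /rotation /coords /= => D.
have ac : (c + v + u) * c = (c + v) ^+ 2.
  (* The determinant is a multiple of (a - c)(ac - b^2), with a > c. *)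
  have h : (u + v) * ((c + v + u) * c - (c + v) ^+ 2) = 0 by move: D; lra.
  have q : 0 < u + v by case: gen => [v1|[u1 c1]]; lra.
  by move/eqP: h; rewrite mulf_eq0 (gt_eqF q) /= subr_eq0 => /eqP.
have a0 : 0 < c + v + u by case: gen => [v1|[u1 c1]]; lra.
have b0 : 0 <= c + v by lra.
split; apply/negP => hE.
  apply: (@crossing_pairs f 0 9 1 8 (c + v + u) (c + v) (c + v + u) (c + v) isT isT hE); [exact: (sub quad2)|split=> //; exact: ltW|lra|by []|].
  by case=> [|[|[|//]]] _; rewrite /mv /rotation /coords /=; lra.
rewrite vset2C in hE.
apply: (@crossing_pairs f 8 1 9 0 (c + v) (c + v + u) (c + v) (c + v + u) isT isT hE); [exact: (sub quad2)|split=> //; exact: ltW|lra|by []|].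
by case=> [|[|[|//]]] _; rewrite /mv /rotation /coords /=; lra.
Qed.

Lemma image_diagonals f it g : it = quad1 \/ it = quad2 -> (g < 12)%N ->
  face_verts f = vset (map (mul12 g) it) ->
  vset (map (mul12 g) [:: nth 0%N it 0; nth 0%N it 2]) \notin face_edges f /\
  vset (map (mul12 g) [:: nth 0%N it 1; nth 0%N it 3]) \notin face_edges f.
Proof.
move=> hit hg hf; have [g' hg' e'] := mul12_inv hg.
have [lit uit] : labels it /\ uniq it by apply: item_labels; case: hit => ->.
have [phi [psi [iso hphi]]] := lab_sym hl hg'.
have im s : labels s -> [set phi w | w in vset (map (mul12 g) s)]%SET = vset s.
  move=> ls; rewrite (vset_map (labels_mul hg ls) hphi) -map_comp map_id_in // => k ks /=.
  by rewrite e' //; move/allP: ls; apply.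
have hf' : face_verts (psi f) = vset it by rewrite (iso_face_verts iso) hf im.
have back s : labels s -> vset (map (mul12 g) s) \in face_edges f -> vset s \in face_edges (psi f).
  by move=> ls hE; have [_ _ ->] := iso; rewrite -(im s ls); exact: imset_f.
have [n1 n2] := quad_diagonals hit hf'.
by split; [apply: contraNN n1 | apply: contraNN n2]; apply: back; case: hit => ->.
Qed.

Lemma size_face_vset f s : labels s -> uniq s -> face_verts f = vset s -> size (bdry f) = size s.
Proof.
move=> ls us hf; rewrite -(card_vset labI us ls) -hf cardsE.
by rewrite (card_uniqP (face_uniq hp f)).
Qed.

Lemma edge_labels f s k k' : (k < 12)%N -> (k' < 12)%N -> labels s -> face_verts f = vset s ->
  vset [:: k; k'] \in face_edges f -> k \in s /\ k' \in s.
Proof.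
move=> hk hk' ls hf /face_edge_sub; rewrite hf vset_sub /= andbT => /andP[].
by rewrite !(mem_vset labI).
Qed.

(** In a triangle any two vertices form an edge. For quadrangles the geometric exclusion of the
    diagonals shows that the cyclic order read by [side] is that of the actual boundary. *)
Lemma sideP f it s j : it \in items -> s \in images it -> face_verts f = vset s ->
  (0 < j < 12)%N -> (vset [:: 0%N; j] \in face_edges f) = side s j.
Proof.
move=> hit /imagesP[g hg es] hf /andP[j0 j12].
have [lit uit] := item_labels hit.
have ls : labels s by rewrite es; exact: labels_mul.
have us : uniq s by rewrite es; exact: mul12_uniq.
have ms k : (lab k \in bdry f) = (lab k \in vset s) by rewrite -hf inE.
have := allP items_check it hit => /andP[_ /orP[] /eqP sz].
  have sf : size (bdry f) = 3%N by rewrite (size_face_vset ls us hf) es size_map.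
  have s3 : size s = 3%N by rewrite es size_map.
  clear es; case: s s3 ls us hf ms => [|a [|b [|a' [|]]]] // _ ls us hf ms.
  apply/idP/idP => [hE|].
    have [] := edge_labels (isT : (0 < 12)%N) j12 ls hf hE.
    rewrite /side /= !inE => /or3P[]/eqP e0 /or3P[]/eqP ej; rewrite -?e0 -?ej ?eqxx ?orbT //;
      by move: j0; rewrite ej -e0.
  move=> hs; have [m0 mj] : 0%N \in [:: a; b; a'] /\ j \in [:: a; b; a'].
    by move: hs; rewrite /side /= orbF => /or3P[] /orP[] /andP[/eqP-> /eqP->];
      rewrite !inE !eqxx ?orbT.
  rewrite vset2; apply: (triangle_edge (face_uniq hp f)); rewrite ?ms ?(mem_vset labI) //.
  by apply/eqP => /labI h; move: j0; rewrite -h ?inE.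
have [q1 q2] : vset [:: nth 0%N s 0; nth 0%N s 2] \notin face_edges f /\
    vset [:: nth 0%N s 1; nth 0%N s 3] \notin face_edges f.
  have := image_diagonals (four_items hit sz) hg; rewrite -es => /(_ _ hf).
  by rewrite es /= !(nth_map 0%N) ?sz.
have s4 : size s = 4%N by rewrite es size_map.
clear es; case: s s4 ls us hf ms q1 q2 => [|a [|b [|a' [|b' [|]]]]] // _ ls us hf ms /= q1 q2.
have [e1 e2] := quad_edges us ls hf q1 q2.
have perm : same_labels [:: a; b; a'; b'] [:: a'; b'; a; b].
  by rewrite /same_labels /= !inE !eqxx !orbT.
have us' : uniq [:: a'; b'; a; b].
  by rewrite (perm_uniq (_ : perm_eq _ [:: a; b; a'; b'])) // (perm_catC [:: a'; b'] [:: a; b]).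
have ls' : labels [:: a'; b'; a; b].
  by apply/allP => k hk; move/allP: ls; apply; move: hk; rewrite !inE orbC -!orbA orbC -!orbA.
have q1' : vset [:: a'; a] \notin face_edges f by rewrite vset2C.
have q2' : vset [:: b'; b] \notin face_edges f by rewrite vset2C.
have [e3 e4] := quad_edges us' ls' (etrans hf (vset_same lab perm)) q1' q2'.
apply/idP/idP => [hE|].
  have [] := edge_labels (isT : (0 < 12)%N) j12 ls hf hE.
  rewrite /side /= !inE => /or4P[]/eqP e0 /or4P[]/eqP ej; rewrite -?e0 -?ej ?eqxx ?orbT //;
    try by move: j0; rewrite ej -e0.
  - by move: q1; rewrite -e0 -ej hE.
  - by move: q2; rewrite -e0 -ej hE.
  - by move: q1'; rewrite -e0 -ej hE.
  - by move: q2'; rewrite -e0 -ej hE.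
rewrite /side /= orbF => /or4P[] /orP[] /andP[/eqP<- /eqP<-] //; by rewrite vset2C.
Qed.

Lemma uniq_vset_images : uniq (map vset (flatten [seq distinct_images it | it <- items])).
Proof.
have := images_check; set l := flatten _.
have lP s : s \in l -> labels s.
  move=> /flatten_mapP[it hit /distinct_images_sub/imagesP[g hg ->]].
  by apply: labels_mul => //; case: (item_labels hit).
elim: l lP => //= s l IH lP /andP[h1 h2]; rewrite IH ?andbT // => [|t tl]; last first.
  by apply: lP; rewrite inE tl orbT.
apply/mapP => -[t tl e']; move/allP: h1 => /(_ t tl) /negP; apply.
have ls : labels s by apply: lP; rewrite inE eqxx.
have lt : labels t by apply: lP; rewrite inE tl orbT.
apply/andP; split; apply/allP => k hk.
  have k12 : (k < 12)%N by move/allP: lt; apply.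
  by suff : k \in s by []; rewrite -(mem_vset labI k12 ls) e' (mem_vset labI).
have k12 : (k < 12)%N by move/allP: ls; apply.
by suff : k \in t by []; rewrite -(mem_vset labI k12 lt) -e' (mem_vset labI).
Qed.

Hypothesis classified : forall f, has (is_image (face_labels lab f)) items.

(** Distinct images have distinct vertex sets, so the sum counts the faces having the pair [[0; j]]
    as a side: two if the pair is an edge, none otherwise. *)
Lemma edge_count j : (0 < j < 8)%N ->
  sumn [seq count (fun s => side s j) (distinct_images it) | it <- items & is_face it]
    \in [:: 0; 2]%N.
Proof.
move=> /andP[j0 j8]; set n := sumn _; have j12 : (0 < j < 12)%N by rewrite j0 (ltn_trans j8).
set E := vset [:: 0%N; j].
pose cand := [seq s <- flatten [seq distinct_images it | it <- items & is_face it] | side s j].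
have nE : n = size cand.
  by rewrite /n /cand size_filter count_flatten -map_comp.
have uc : uniq (map vset cand).
  apply: subseq_uniq uniq_vset_images; apply: map_subseq.
  apply: subseq_trans (filter_subseq _ _) _.
  elim: (items) => //= it l IH; case: ifP => _ /=; first by rewrite cat_subseq.
  by rewrite (subseq_trans IH) // suffix_subseq // suffix_suffix.
have ce : #|[set f | E \in face_edges f]%SET| = n.
  rewrite -(card_imset _ (face_verts_inj hp)) nE -(size_map vset) -(card_uniqP uc).
  apply: eq_card => S; apply/imsetP/mapP => [[f + ->]|[s]].
    rewrite inE => hE; have /hasP[it hit im] := classified f.
    have [s hs ss] := is_image_distinct im.
    have hf : face_verts f = vset s by rewrite -(vset_face_labels hl) (vset_same lab ss).
    exists s => //; rewrite mem_filter -(sideP hit (distinct_images_sub hs) hf j12) hE andTb.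
    apply/flatten_mapP; exists it; last by [].
    rewrite mem_filter hit andbT.
    by rewrite -(is_face_is_image hl _ im) ?(is_face_labels hl) //; case: (item_labels hit).
  rewrite mem_filter => /andP[hs /flatten_mapP[it]]; rewrite mem_filter => /andP[isf hit] hd ->.
  have hi := distinct_images_sub hd; have /imagesP[g hg es] := hi.
  have : is_face s by rewrite es (is_face_image hl) //; case: (item_labels hit).
  case/existsP => f /eqP hf; exists f => //.
  by rewrite inE /E (sideP hit hi hf j12).
have [eE|eE] := boolP (E \in edges M).
  have [_ [_ two _] _ _ _] := polyhedron_map hp.
  by rewrite -ce two ?inE ?eqxx ?orbT.
rewrite inE; apply/orP; left; rewrite -ce cards_eq0; apply/eqP/setP => f; rewrite !inE.
by apply: contraNF eE => hE; apply/bigcupP; exists f.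
Qed.

End EdgeCounts.

(** Soundness: [bs] marks the orbits that occur. They follow one branch to its end, and the pruning
    never cuts it, because counts only grow and end at 0 or 2. *)
Lemma searchP final comp (bs : seq bool) (cs : seq (seq nat)) (k : nat) (S cnt : seq nat) :
  size bs = size cs -> (forall c, c \in cs -> size c = 7%N) -> size cnt = 7%N ->
  search final comp cs k S cnt ->
  (forall i j, i \in S ++ mask bs (iota k (size cs)) -> j \in S ++ mask bs (iota k (size cs)) -> comp i j) ->
  (forall i, (i < 7)%N -> (nth 0 cnt i + sumn [seq nth 0 c i | c <- mask bs cs])%N \in [:: 0; 2]%N) ->
  ~~ final (catrev (mask bs (iota k (size cs))) S).
Proof.
elim: cs bs k S cnt => [|c cs IH] [|b bs] k S cnt //=.
  move=> _ _ sc; case: (final S) => //= h _ hn; move: h; suff -> : all (fun n => (n == 0%N) || (n == 2)) cnt by [].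
  apply/(all_nthP 0%N) => i; rewrite sc => hi.
  by have := hn i hi; rewrite addn0 !inE.
case=> sb hs sc /andP[h1 h2] hc hn.
have hs' c' : c' \in cs -> size c' = 7%N by move=> h; apply: hs; rewrite inE h orbT.
case: b hc hn => /= hc hn; last exact: (IH bs k.+1 S cnt).
move: h2; rewrite hc ?mem_cat ?inE ?eqxx ?orbT //=.
have -> : all (comp k) S.
  by apply/allP => i iS; apply: hc; rewrite mem_cat ?iS // inE eqxx orbT.
have sz : size c = 7%N by apply: hs; rewrite inE eqxx.
have szc : size (add_counts c cnt) = 7%N by rewrite size_map size_zip sz sc.
have nthc i : (i < 7)%N -> nth 0%N (add_counts c cnt) i = (nth 0%N c i + nth 0%N cnt i)%N.
  by move=> hi; rewrite (nth_map (0, 0)%N) ?size_zip ?sz ?sc // nth_zip ?sz ?sc.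
have hn' i : (i < 7)%N -> (nth 0 (add_counts c cnt) i + sumn [seq nth 0 c' i | c' <- mask bs cs])%N \in [:: 0; 2]%N.
  by move=> hi; have := hn i hi; rewrite nthc // addnCA addnA.
have -> : all (fun n => n <= 2)%N (add_counts c cnt).
  apply/(all_nthP 0%N) => i; rewrite szc => hi; have := hn' i hi.
  have := leq_addr (sumn [seq nth 0%N c' i | c' <- mask bs cs]) (nth 0%N (add_counts c cnt) i).
  by move=> h0 /[!inE] /orP[]/eqP h; rewrite h in h0; exact: leq_trans h0 _.
move=> h2; apply: (IH bs k.+1 (k :: S) (add_counts c cnt)) => // i j.
have mv z (m : seq nat) : (z \in (k :: S) ++ m) = (z \in S ++ k :: m).
  by rewrite !mem_cat !inE -orbA orbCA.
by rewrite !mv; apply: hc.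
Qed.

Lemma subseq_combs k (s t : seq nat) : t \in combs k s -> subseq t s /\ size t = k.
Proof.
elim: s k t => [|x s IH] [|k] t //=; try by rewrite inE => /eqP->.
rewrite mem_cat => /orP[/mapP[t' /IH[h1 h2] ->]|/IH[h1 h2]].
  by rewrite /= eqxx h2.
by split=> //; exact: (subseq_trans h1 (subseq_cons s x)).
Qed.

(** * From a list of conflicts to the orbits of faces *)

Section Leaf.
Variables (R : realType) (M : map_data) (p : vert M -> 'rV[R]_3).
Hypothesis hp : polyhedron p.
Variables (e : nat -> 'rV[R]_3) (d c v u : R) (lab : nat -> vert M).
Hypothesis hl : labelling p e d c v u lab.
Hypothesis labI : {in [pred k | (k < 12)%N] &, injective lab}.
Hypothesis gen : 0 < v \/ 0 < u /\ 0 < c.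
Variable g0 : nat.
Hypothesis genus : has_genus M g0.
Hypothesis genus2 : (2 <= g0)%N.

Local Notation is_face := (is_face lab).
Local Notation in_face := (in_face lab).

Variables (L : seq (seq nat * seq nat)) (noncoplanar : seq (seq nat)).
Hypothesis hL : forall AB, AB \in L -> [/\ labels AB.1, labels AB.2 &
  in_face AB.1 -> in_face AB.2 -> False].
Hypothesis hN : forall q, q \in noncoplanar -> in_face q -> False.
Hypothesis chk : leaf_check L noncoplanar.

Lemma conflicting_not_in_face s : conflicting L s -> in_face s -> False.
Proof.
case/hasP=> AB /hL[lA lB h] /andP[cA cB] hs.
by apply: h; apply: (in_face_contains hl _ _ hs).
Qed.

Lemma triple_not_in_face s : has (contains_image s) self_conflicting_triples -> in_face s -> False.
Proof.
case/hasP => t ht ct hs; case/and3P: chk => /allP/(_ t ht) h _ _.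
apply: (conflicting_not_in_face h); apply: (in_face_contains hl _ ct hs).
by have /allP := (isT : all labels self_conflicting_triples); apply.
Qed.

Lemma quad_faces t : t \in combs 4 (iota 0 12) -> in_face t -> is_image t quad1 || is_image t quad2.
Proof.
move=> ht hf; have := allP quads_check t ht => /or4P[h|/hasP[q hq h]|->|->]; rewrite ?orbT //.
  by case: (triple_not_in_face h hf).
exfalso; have lq : labels q by have /allP := (isT : all labels other_quads); apply.
have hq' : in_face q.
  case/hasP: h => t' /imagesP[g hg et'] /andP[/allP h _]; apply: (in_face_image hl hg lq).
  by rewrite -et'; apply: in_faceS hf => k kt'; apply: h.
case/and3P: chk => _ /allP/(_ q hq) /orP[h'|h'] _; [exact: (hN h' hq')|exact: (conflicting_not_in_face h' hq')].
Qed.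

(** Every part of a face is [in_face], so the first four and the first five labels of a larger face
    can be tested on their own. *)
Lemma leaf_classified (f : face M) : has (is_image (face_labels lab f)) items.
Proof.
set s := face_labels lab f.
have sf : in_face s by apply: is_face_in; exact: (is_face_labels hl).
have ss : subseq s (iota 0 12) by exact: filter_subseq.
have s3 : (3 <= size s)%N by rewrite (size_face_labels hp hl labI) (face_size hp).
have inS k : (k <= size s)%N -> take k s \in combs k (iota 0 12) /\ in_face (take k s).
  move=> hk; split; last by apply: in_faceS sf => x; exact: mem_take.
  have := mem_combs (subseq_trans (take_subseq s k) ss).
  by rewrite size_takel.
have [e3|e3] := eqVneq (size s) 3%N.
  have [h _] := inS 3%N s3; rewrite -e3 take_size e3 in h.
  have := allP triples_check s h => /orP[h'|h']; first by case: (triple_not_in_face h' sf).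
  by rewrite /items has_cat h'.
have s4 : (4 <= size s)%N by rewrite ltn_neqAle eq_sym e3.
have [e4|e4] := eqVneq (size s) 4%N.
  have [h h'] := inS 4%N s4; have := quad_faces h h'; rewrite -e4 take_size => h2.
  by rewrite /items has_cat [X in _ || X]/= orbF h2 orbT.
have s5 : (5 <= size s)%N by rewrite ltn_neqAle eq_sym e4.
have [h h'] := inS 5%N s5; have := allP pentagons_check _ h => /hasP[q /subseq_combs[q1 q2]].
have [t1 t2] := subseq_combs h.
have hq : q \in combs 4 (iota 0 12) by have := mem_combs (subseq_trans q1 t1); rewrite q2.
by rewrite quad_faces //; apply: in_faceS h' => x; apply: mem_subseq.
Qed.

Lemma leaf_solutions : [seq it <- items | is_face it] = target \/
  [seq it <- items | is_face it] = pinched.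
Proof.
set bs := map is_face items.
have em (T : Type) (l : seq T) (F : seq nat -> T) : l = map F items ->
    mask bs l = map F [seq it <- items | is_face it].
  by move=> ->; rewrite -map_mask filter_mask.
have emi : mask bs (iota 0 14) = [seq index it items | it <- items & is_face it] by exact: em.
have wb := weight_bound hp hl labI genus genus2 item_labels leaf_classified.
case/and3P: chk => _ _ hs.
set sol := catrev (mask bs (iota 0 14)) [::].
have : ~~ ((28 <= sumn [seq nth 0 [seq weight it | it <- items] k | k <- sol])%N &&
    ~~ ((rev sol == [:: 0; 5; 10; 11]%N) || (rev sol == [:: 7; 9; 10; 11]%N))).
  apply: (searchP (bs := bs) _ _ _ hs); [by rewrite !size_map| |by []| |].
  - by move=> c' /mapP[it _ ->]; rewrite size_map size_iota.
  - rewrite size_map emi => i j /mapP[s1 + ->] /mapP[s2 + ->].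
    rewrite !mem_filter => /andP[f1 i1] /andP[f2 i2].
    rewrite (nth_map [::]) ?index_mem // (nth_map [::]) ?index_mem // !nth_index //.
    apply/allP => AB /hL[lA lB h]; apply/negP => /orP[]/andP[h1 h2]; apply: h;
      [apply: (in_face_contains hl lA h1)|apply: (in_face_contains hl lB h2)
      |apply: (in_face_contains hl lA h1)|apply: (in_face_contains hl lB h2)]; exact: is_face_in.
  - move=> i hi; rewrite nth_nseq hi add0n (em _ _ side_counts) // -map_comp.
    set X := sumn _; have -> : X = sumn [seq count (fun s => side s i.+1) (distinct_images it)
        | it <- items & is_face it].
      congr sumn; apply: eq_map => it /=.
      by rewrite (nth_map 0%N) ?size_iota // nth_iota.
    exact: (edge_count hp hl labI gen leaf_classified).
rewrite /sol catrevE cats0 revK map_rev sumn_rev.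
have -> : sumn [seq nth 0 [seq weight it | it <- items] k | k <- mask bs (iota 0 14)] =
   sumn [seq weight it | it <- items & is_face it].
  rewrite emi -map_comp; congr sumn; apply/eq_in_map => it; rewrite mem_filter => /andP[_ hit].
  change (nth 0%N [seq weight it' | it' <- items] (index it items) = weight it).
  by rewrite (nth_map [::]) ?index_mem // nth_index.
rewrite wb andTb negbK emi => hh.
have back : [seq it <- items | is_face it] =
    [seq nth [::] items k | k <- [seq index it items | it <- items & is_face it]].
  rewrite -map_comp map_id_in // => it; rewrite mem_filter => /andP[_ hit].
  exact: nth_index.
by rewrite back; case/orP: hh => /eqP->; [left|right].
Qed.

Lemma leaf_orbits : exists2 S, S = target \/ S = pinched &
  all is_face S /\ forall f, has (is_image (face_labels lab f)) S.
Proof.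
exists [seq it <- items | is_face it]; first exact: leaf_solutions.
split=> [|f]; first exact: filter_all.
have /hasP[it hit im] := leaf_classified f; apply/hasP; exists it => //.
rewrite mem_filter hit andbT -(is_face_is_image hl _ im) ?(is_face_labels hl) //.
by case: (item_labels hit).
Qed.

End Leaf.

(** * The generic case b > c *)

Definition distinct_check (dom : domain) : bool :=
  all (fun k => all (fun k' => (k == k') || has (fun i =>
      coef_gt0 dom (psub (point_poly k i) (point_poly k' i)) ||
      coef_gt0 dom (psub (point_poly k' i) (point_poly k i))) (iota 0 3))
    (iota 0 12)) (iota 0 12).

Definition det_poly (q : seq nat) : poly3 :=
  pdet (point_poly (nth 0%N q 0)) (point_poly (nth 0%N q 1)) (point_poly (nth 0%N q 2))
    (point_poly (nth 0%N q 3)).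

Definition signed_det (h : bool * seq nat) : poly3 :=
  if h.1 then popp (det_poly h.2) else det_poly h.2.

(** Since v = b - c and u = a - b, the generic domain is b > c; the flat one is b = c with a > b and
    c > 0, where the orbit still has twelve points. *)
Definition generic_domain : domain := Domain (false, true, false) (false, false, false).
Definition flat_domain : domain := Domain (true, false, true) (false, true, false).

Lemma generic_distinct : distinct_check generic_domain.
Proof. by vm_compute. Qed.

Lemma flat_distinct : distinct_check flat_domain.
Proof. by vm_compute. Qed.

Lemma generic_noncoplanar : all (fun q =>
    coef_gt0 generic_domain (det_poly q) || coef_gt0 generic_domain (popp (det_poly q)))
  (take 5 other_quads).
Proof. by vm_compute. Qed.

Lemma generic_circuits : all (fun lf =>
    all (fun AB => labels AB.1 && labels AB.2 &&
      circuit_check generic_domain (map signed_det lf.1) AB.1 AB.2) lf.2) leaves.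
Proof. by vm_compute. Qed.

Section Cases.
Variables (R : realType) (M : map_data) (p : vert M -> 'rV[R]_3).
Hypothesis hp : polyhedron p.
Variables (e : nat -> 'rV[R]_3) (d c v u : R) (lab : nat -> vert M).
Hypothesis hl : labelling p e d c v u lab.

Local Notation is_face := (is_face lab).
Local Notation in_face := (in_face lab).
Local Notation P k := (mv (rotation k) (coords c v u)).

Lemma distinct_labels dom : in_domain c v u dom -> distinct_check dom ->
  {in [pred k | (k < 12)%N] &, injective lab}.
Proof.
move=> hd hc k k' hk hk' ekk.
have := hc => /all_iotaP/(_ k hk)/all_iotaP/(_ k' hk')/orP[/eqP //|/hasP[i]].
rewrite mem_iota => hi hh; exfalso.
have [fr _ hpt _ _] := hl.
have : lin e (P k) = lin e (P k') by rewrite -!hpt ?ekk.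
move/(lin_inj fr)/(_ i hi) => h.
by case/orP: hh => /(coef_gt0P hd); rewrite pevalB !peval_point h subrr ltxx.
Qed.

Lemma peval_det_poly k0 k1 k2 k3 :
  peval c v u (det_poly [:: k0; k1; k2; k3]) = rdet (P k0) (P k1) (P k2) (P k3).
Proof. by rewrite /det_poly peval_det; congr rdet; apply/funext => i /=; rewrite peval_point. Qed.

(** A decision tree in which each determinant is asked for only where it matters. The inequalities
    are weak, so the eight cases overlap on their common walls. *)
Lemma generic_leaf : 0 < v -> exists2 lf, lf \in leaves &
  forall h, h \in map signed_det lf.1 -> 0 <= peval c v u h.
Proof.
move=> v0.
have sg q : 0 <= peval c v u (signed_det (false, q)) \/ 0 <= peval c v u (signed_det (true, q)).
  rewrite /signed_det pevalN oppr_ge0; case: (leP 0 (peval c v u (det_poly q))) => h; [by left|].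
  by right; exact: ltW.
have found n : (n < size leaves)%N ->
    (forall h, h \in map signed_det (nth ([::], [::]) leaves n).1 -> 0 <= peval c v u h) ->
    exists2 lf, lf \in leaves & forall h, h \in map signed_det lf.1 -> 0 <= peval c v u h.
  by move=> hn h; exists (nth ([::], [::]) leaves n); rewrite ?mem_nth.
have all2 (s : seq poly3) : foldr (fun h acc => 0 <= peval c v u h /\ acc) True s ->
    forall h, h \in s -> 0 <= peval c v u h.
  by elim: s => //= h s IH [h0 /IH hs] h'; rewrite inE => /orP[/eqP->|/hs].
case: (sg [:: 0; 1; 6; 9]%N) => h3.
  case: (sg [:: 0; 2; 4; 10]%N) => h6; last by apply: (found 2%N isT); apply: all2.
  by case: (sg [:: 0; 2; 5; 8]%N) => h7; [apply: (found 0%N isT)|apply: (found 1%N isT)]; apply: all2.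
case: (sg [:: 0; 1; 6; 10]%N) => h4.
  case: (sg [:: 0; 2; 4; 10]%N) => h6; last by apply: (found 5%N isT); apply: all2.
  by case: (sg [:: 0; 2; 5; 8]%N) => h7; [apply: (found 3%N isT)|apply: (found 4%N isT)]; apply: all2.
by case: (sg [:: 0; 1; 8; 9]%N) => h5; [apply: (found 6%N isT)|apply: (found 7%N isT)]; apply: all2.
Qed.

Variable g0 : nat.
Hypothesis genus : has_genus M g0.
Hypothesis genus2 : (2 <= g0)%N.

Lemma generic_domainP : 0 < v -> in_domain c v u generic_domain.
Proof. by move=> v0; have [_ pos _ _ _] := hl; split. Qed.

Lemma flat_domainP : v = 0 -> 0 < u -> 0 < c -> in_domain c v u flat_domain.
Proof. by move=> v0 u0 c0; have [_ pos _ _ _] := hl; split. Qed.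

Lemma generic_orbits : 0 < v -> exists2 S, S = target \/ S = pinched &
  all is_face S /\ forall f, has (is_image (face_labels lab f)) S.
Proof.
move=> v0; have hd := generic_domainP v0; have labI := distinct_labels hd generic_distinct.
have [lf hlf hs] := generic_leaf v0.
apply: (leaf_orbits hp hl labI (or_introl v0) genus genus2 _ _ (allP leaves_check _ hlf)).
  move=> AB hAB; have /allP/(_ AB hAB)/andP[/andP[lA lB] ck] := allP generic_circuits _ hlf.
  by split=> //; exact: (circuit_conflict hp hl labI hd hs ck).
move=> q hq [f hf].
have nz : peval c v u (det_poly q) != 0.
  have := allP generic_noncoplanar q hq => /orP[] /(coef_gt0P hd); first by move/gt_eqF => ->.
  by rewrite pevalN oppr_gt0 => /lt_eqF->.
have [k0 [k1 [k2 [k3 [eq lq]]]]] : exists k0 k1 k2 k3, q = [:: k0; k1; k2; k3] /\ labels q.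
  move: hq; rewrite !inE => /or4P[|||/orP[|]] /eqP->; do 4 eexists; split; by [].
move: lq hf nz; rewrite eq peval_det_poly => lq hf.
by rewrite (coplanar_det hp hl lq hf) eqxx.
Qed.

End Cases.

(** For b = c the twelve points are the vertices of a truncated tetrahedron. This is one of its
    hexagons, in cyclic order, in the plane x - y + z = a. *)
Definition hexagon : seq nat := [:: 0; 1; 9; 11; 7; 4]%N.

Lemma hexagon_plane_check : all (fun k => (k \in hexagon) ||
    (coef_gt0 flat_domain (det_poly [:: 0; 1; 4; k]%N) ||
     coef_gt0 flat_domain (popp (det_poly [:: 0; 1; 4; k]%N)))) (iota 0 12).
Proof. by vm_compute. Qed.

(** The three pairs are diagonals of [hexagon], one long and two short; [[:: 0; 1; 2]] is excluded
    by a circuit, and [[:: 0; 4; 8]] is a triangle of the truncated tetrahedron. *)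
Lemma flat_faces_check : all (fun t => [|| contains_image t [:: 0; 11]%N, contains_image t [:: 1; 11]%N,
    contains_image t [:: 0; 9]%N, contains_image t [:: 0; 1; 2]%N | is_image t [:: 0; 4; 8]%N])
  (combs 3 (iota 0 12)).
Proof. by vm_compute. Qed.

Lemma flat_quads_check : all (fun t => has (contains_image t)
    [:: [:: 0; 11]; [:: 1; 11]; [:: 0; 9]; [:: 0; 1; 2]]%N)
  (combs 4 (iota 0 12)).
Proof. by vm_compute. Qed.

Section Crossing.
Variables (R : realType) (M : map_data) (p : vert M -> 'rV[R]_3).
Hypothesis hp : polyhedron p.
Variables (e : nat -> 'rV[R]_3) (d c v u : R) (lab : nat -> vert M).
Hypothesis hl : labelling p e d c v u lab.
Local Notation vset := (vset lab).
Local Notation P k := (mv (rotation k) (coords c v u)).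

Lemma crossing_faces f g k0 k1 k2 k3 (a0 a1 a2 a3 : R) : labels [:: k0; k1; k2; k3] ->
  {in [:: k0; k1] & [:: k2; k3], forall i j, lab i != lab j} ->
  vset [:: k0; k1] \subset face_verts f -> vset [:: k2; k3] \subset face_verts g ->
  [/\ 0 <= a0, 0 <= a1, 0 <= a2 & 0 <= a3] -> 0 < a0 + a1 -> a0 + a1 = a2 + a3 ->
  (forall j, (j < 3)%N -> a0 * P k0 j + a1 * P k1 j = a2 * P k2 j + a3 * P k3 j) -> f = g.
Proof.
move=> lt ne hA hB [p0 p1 p2 p3] s0 ss hd'.
have [fr _ hpt _ _] := hl.
have [h0 h1 h2 h3] : [/\ k0 < 12, k1 < 12, k2 < 12 & k3 < 12]%N.
  by move: lt => /= /and5P[-> -> -> -> _].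
have [//|fg] := eqVneq f g; exfalso.
apply: (@dependent_faces _ _ p _ hp (labelled_sphere hl) f g
  [:: (lab k0, a0); (lab k1, a1)] [:: (lab k2, a2); (lab k3, a3)] fg).
- move: hA; rewrite vset_sub => /and3P[m2 m3 _] y.
  by move=> /[1!inE] /orP[/eqP->|/[1!inE]/eqP->].
- move: hB; rewrite vset_sub => /and3P[m2 m3 _] y.
  by move=> /[1!inE] /orP[/eqP->|/[1!inE]/eqP->].
- by rewrite !big_cons big_nil addr0.
- by rewrite !big_cons !big_nil /= !addr0.
- rewrite !big_cons !big_nil /= !addr0 !hpt //.
  have l2 b0 b1 (q q' : nat -> R) : b0 *: lin e q + b1 *: lin e q' =
      lin e (fun j => b0 * q j + b1 * q' j).
    by rewrite /lin; apply: vecP; rewrite !mxE; ring.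
  by rewrite !l2; apply: lin_ext; exact: hd'.
move=> y z; rewrite !inE => /orP[]/eqP-> /orP[]/eqP-> /=; apply: ne;
  by rewrite !inE eqxx ?orbT.
Qed.

End Crossing.

Section Flat.
Variables (R : realType) (M : map_data) (p : vert M -> 'rV[R]_3).
Hypothesis hp : polyhedron p.
Variables (e : nat -> 'rV[R]_3) (d c v u : R) (lab : nat -> vert M).
Hypothesis hl : labelling p e d c v u lab.
Hypotheses (v0 : v = 0) (u0 : 0 < u) (c0 : 0 < c).
Variable g0 : nat.
Hypothesis genus : has_genus M g0.
Hypothesis genus2 : (2 <= g0)%N.

Local Notation is_face := (is_face lab).
Local Notation in_face := (in_face lab).
Local Notation vset := (vset lab).
Local Notation P k := (mv (rotation k) (coords c v u)).

Let hd : in_domain c v u flat_domain.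
Proof. exact: (flat_domainP hl v0 u0 c0). Qed.
Let labI : {in [pred k | (k < 12)%N] &, injective lab}.
Proof. exact: (distinct_labels hl hd flat_distinct). Qed.

Lemma flat_crossing f g k0 k1 k2 k3 (a0 a1 a2 a3 : R) :
  labels [:: k0; k1; k2; k3] -> uniq [:: k0; k1; k2; k3] ->
  vset [:: k0; k1] \subset face_verts f -> vset [:: k2; k3] \subset face_verts g ->
  [/\ 0 <= a0, 0 <= a1, 0 <= a2 & 0 <= a3] -> 0 < a0 + a1 -> a0 + a1 = a2 + a3 ->
  (forall j, (j < 3)%N -> a0 * P k0 j + a1 * P k1 j = a2 * P k2 j + a3 * P k3 j) -> f = g.
Proof.
move=> lt un hA hB; apply: (crossing_faces hp hl lt _ hA hB) => i j hi hj; apply/eqP => /labI h.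
have lt' z' : z' \in [:: k0; k1] ++ [:: k2; k3] -> (z' < 12)%N by move: z'; apply/allP.
have eij : i = j by apply: h; rewrite inE lt' // mem_cat ?hi ?hj ?orbT.
move: un; rewrite -[[:: k0; k1; k2; k3]]/([:: k0; k1] ++ [:: k2; k3]) cat_uniq.
by case/and3P=> _ /hasP un _; apply: un; exists j => //=; rewrite -eij.
Qed.

(** Two long diagonals of the hexagon cross, and crossing pairs of vertices can only lie in one
    face. *)
Lemma cross_long f g : vset [:: 0; 11]%N \subset face_verts f ->
  vset [:: 1; 7]%N \subset face_verts g -> f = g.
Proof.
move=> hf hg; apply: (flat_crossing (a0 := u) (a1 := 2 * c) (a2 := u) (a3 := 2 * c) _ _ hf hg) => //.
- by have u1 := u0; have c1 := c0; split; lra.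
- by have u1 := u0; have c1 := c0; lra.
- by case=> [|[|[|//]]] _; rewrite /mv /rotation /coords /= ?v0; ring.
Qed.

Lemma cross_short f g : vset [:: 1; 11]%N \subset face_verts f ->
  vset [:: 0; 9]%N \subset face_verts g -> f = g.
Proof.
move=> hf hg; apply: (flat_crossing (a0 := 2 * c + u) (a1 := u) (a2 := u) (a3 := 2 * c + u) _ _ hf hg) => //.
- by have u1 := u0; have c1 := c0; split; lra.
- by have u1 := u0; have c1 := c0; lra.
- by have u1 := u0; have c1 := c0; lra.
- by case=> [|[|[|//]]] _; rewrite /mv /rotation /coords /= ?v0; ring.
Qed.

Lemma in_faceP s : in_face s -> labels s -> forall g, (g < 12)%N ->
  exists f, vset (map (mul12 g) s) \subset face_verts f.
Proof. by move=> h ls g hg; have [f] := in_face_mul hl hg ls h; exists f. Qed.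

(** Rotations carry [[0; 6]] to all three long diagonals of one hexagon. These cross pairwise, so
    one face contains all six vertices; no other vertex is in their plane. *)
Lemma long_hexagon : in_face [:: 0; 6]%N -> is_face hexagon.
Proof.
move=> h6.
have [f hf] : exists f, vset [:: 0; 11]%N \subset face_verts f.
  by have [f] := in_faceP h6 isT (isT : (11 < 12)%N); rewrite (_ : map _ _ = [:: 11; 0]%N) // vset2C; exists f.
have [f1 hf1] : exists f, vset [:: 1; 7]%N \subset face_verts f.
  exact: (in_faceP h6 isT (isT : (1 < 12)%N)).
have [f2 hf2] : exists f, vset [:: 9; 4]%N \subset face_verts f.
  by have [f2] := in_faceP h6 isT (isT : (4 < 12)%N); rewrite (_ : map _ _ = [:: 4; 9]%N) // vset2C; exists f2.
have e1 : f = f1 by exact: cross_long.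
have e2 : f = f2.
  rewrite vset2C in hf.
  apply: (flat_crossing (a0 := u) (a1 := 2 * c) (a2 := u) (a3 := 2 * c) _ _ hf hf2) => //.
  - by have u1 := u0; have c1 := c0; split; lra.
  - by have u1 := u0; have c1 := c0; lra.
  - by case=> [|[|[|//]]] _; rewrite /mv /rotation /coords /= ?v0; ring.
rewrite -{}e1 in hf1; rewrite -{}e2 in hf2.
have sub : vset hexagon \subset face_verts f.
  move: hf hf1 hf2; rewrite !vset_sub /= !andbT.
  by case/andP=> -> -> /andP[-> ->] /andP[-> ->].
apply/existsP; exists f; rewrite finset.eqEsubset sub andbT.
apply/fintype.subsetP => w; have [k hk ->] := lab_surj hl w => hw.
have /orP[kh|nz] := all_iotaP _ _ hexagon_plane_check k hk; first by rewrite inE map_f.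
have := sub; rewrite vset_sub => /and5P[m0 m1 _ _ /and3P[_ m4 _]].
have s4 : vset [:: 0; 1; 4; k]%N \subset face_verts f by rewrite vset_sub /= m0 m1 m4 hw.
have l4 : labels [:: 0; 1; 4; k]%N by rewrite /labels /= hk.
have := coplanar_det hp hl l4 s4; rewrite -peval_det_poly => z.
by case/orP: nz => /(coef_gt0P hd); rewrite ?pevalN z ?oppr0 ltxx.
Qed.

(** The images [[1; 11]] and [[0; 9]] are crossing short diagonals of the hexagon. The face
    containing both contains the long diagonal from 0 to 11, an image of [[0; 6]]. *)
Lemma short_long : in_face [:: 0; 5]%N -> in_face [:: 0; 7]%N -> in_face [:: 0; 6]%N.
Proof.
move=> h5 h7.
have [f hf] : exists f, vset [:: 1; 11]%N \subset face_verts f.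
  by have [f] := in_faceP h5 isT (isT : (11 < 12)%N); rewrite (_ : map _ _ = [:: 11; 1]%N) // vset2C; exists f.
have [g hg] : exists f, vset [:: 0; 9]%N \subset face_verts f.
  by have [f'] := in_faceP h7 isT (isT : (9 < 12)%N); rewrite (_ : map _ _ = [:: 9; 0]%N) // vset2C; exists f'.
have e1 := cross_short hf hg; rewrite -{}e1 in hg.
apply: (@in_face_image _ _ _ _ _ _ _ _ _ hl 11 [:: 0; 6]%N) => //.
exists f; move: hf hg; rewrite !vset_sub /= !andbT.
by case/andP=> _ -> /andP[-> _].
Qed.

Lemma hexagon_images s A : is_face hexagon -> labels A ->
  (forall f g, face_verts f = vset hexagon -> vset A \subset face_verts g -> f = g) ->
  labels s -> is_face s -> contains_image s A -> is_image s hexagon.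
Proof.
move=> /existsP[f /eqP hf] lA hA ls hs /hasP[A' /imagesP[g hg ->]] /allP sub.
have [g' hg' e'] := mul12_inv hg.
have /existsP[f' /eqP hf'] := is_face_mul hl hg' ls hs.
have ff : f = f'.
  apply: hA => //; rewrite hf' vset_sub; apply/allP => k kA; rewrite inE; apply: map_f.
  rewrite -(e' k); last by move/allP: lA; apply.
  by apply/map_f/sub/map_f.
have eS : vset (map (mul12 g') s) = vset hexagon by rewrite -hf' -ff.
have [g2 hg2 e2] := mul12_inv hg'; have [phi [psi [_ hphi]]] := lab_sym hl hg2.
have lh : labels hexagon by [].
have eS2 : vset s = vset (map (mul12 g2) hexagon).
  rewrite -(vset_map lh hphi) -eS (vset_map (labels_mul hg' ls) hphi) -map_comp map_id_in // => k ks /=.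
  by apply: e2; move/allP: ls; apply.
apply/hasP; exists (map (mul12 g2) hexagon); first by apply/imagesP; exists g2.
have lim := labels_mul hg2 lh.
apply/andP; split; apply/allP => k hk.
  have k12 : (k < 12)%N by move/allP: lim; apply.
  by suff : k \in s by []; rewrite -(mem_vset labI k12 ls) eS2 (mem_vset labI).
have k12 : (k < 12)%N by move/allP: ls; apply.
by suff : k \in map (mul12 g2) hexagon by []; rewrite -(mem_vset labI k12 lim) -eS2 (mem_vset labI).
Qed.

Lemma base_triangle : in_face [:: 4; 5]%N -> in_face [:: 0; 1; 2]%N -> False.
Proof.
have ck : circuit_check flat_domain [::] [:: 4; 5]%N [:: 0; 1; 2]%N by vm_compute.
by apply: (circuit_conflict hp hl labI hd _ ck).
Qed.

(** Once a hexagon is a face, no other face contains one of its diagonals. Only the four hexagons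
    and four triangles remain, of total weight 4 * 4 + 4 = 20, less than 28. *)
Lemma no_hexagon : is_face hexagon -> False.
Proof.
move=> hx; have [fx /eqP hfx] := existsP hx.
have hex_in A : all (mem hexagon) A -> vset A \subset face_verts fx.
  by rewrite hfx vset_sub => /allP h; apply/allP => k /h kh; rewrite inE; exact: map_f.
have fxE f : face_verts f = vset hexagon -> f = fx.
  by move=> h; apply: (face_verts_inj hp); rewrite h hfx.
have a1 f g : face_verts f = vset hexagon -> vset [:: 0; 11]%N \subset face_verts g -> f = g.
  by move=> /fxE-> h; apply/esym; apply: (cross_long h); exact: hex_in.
have a2 f g : face_verts f = vset hexagon -> vset [:: 1; 11]%N \subset face_verts g -> f = g.
  by move=> /fxE-> h; apply/esym; apply: (cross_short h); exact: hex_in.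
have a3 f g : face_verts f = vset hexagon -> vset [:: 0; 9]%N \subset face_verts g -> f = g.
  by move=> /fxE-> h; apply: (cross_short _ h); exact: hex_in.
have no012 s : contains_image s [:: 0; 1; 2]%N -> in_face s -> False.
  move=> /(in_face_contains hl (isT : labels [:: 0; 1; 2]%N)) h /h h'.
  apply: (base_triangle _ h'); apply: (@in_face_image _ _ _ _ _ _ _ _ _ hl 8 [:: 4; 5]%N) => //.
  by apply: in_faceS h' => z; rewrite !inE => /orP[]/eqP->.
have cls f : has (is_image (face_labels lab f)) [:: hexagon; [:: 0; 4; 8]%N].
  set s := face_labels lab f.
  have sf : is_face s by exact: (is_face_labels hl).
  have ls : labels s by exact: labels_face_labels.
  have ss : subseq s (iota 0 12) by exact: filter_subseq.
  have s3 : (3 <= size s)%N by rewrite (size_face_labels hp hl labI) (face_size hp).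
  have up k A : contains_image (take k s) A -> contains_image s A.
    case/hasP => A' hA /allP h; apply/hasP; exists A' => //; apply/allP => z /h; exact: mem_take.
  have big A : A \in [:: [:: 0; 11]; [:: 1; 11]; [:: 0; 9]; [:: 0; 1; 2]]%N -> contains_image s A ->
      is_image s hexagon.
    rewrite !inE => /or4P[] /eqP-> h.
    - exact: (hexagon_images hx _ a1 ls sf h).
    - exact: (hexagon_images hx _ a2 ls sf h).
    - exact: (hexagon_images hx _ a3 ls sf h).
    - by case: (no012 _ h); exact: is_face_in.
  have hex : is_image s hexagon -> has (is_image s) [:: hexagon; [:: 0; 4; 8]%N].
    by move=> h; apply/hasP; exists hexagon; rewrite // inE eqxx.
  have [e3|e3] := eqVneq (size s) 3%N.
    have := mem_combs ss; rewrite e3 => /(allP flat_faces_check) /or4P[h|h|h|/orP[h|h]].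
    - by apply/hex/(big [:: 0; 11]%N).
    - by apply/hex/(big [:: 1; 11]%N).
    - by apply/hex/(big [:: 0; 9]%N).
    - by apply/hex/(big [:: 0; 1; 2]%N).
    - by apply/hasP; exists [:: 0; 4; 8]%N; rewrite // !inE eqxx orbT.
  have s4 : (4 <= size s)%N by rewrite ltn_neqAle eq_sym e3.
  have := mem_combs (subseq_trans (take_subseq s 4) ss); rewrite size_takel //.
  by move/(allP flat_quads_check)/hasP => [A hA /up h]; exact: hex (big A hA h).
have lP s : s \in [:: hexagon; [:: 0; 4; 8]%N] -> labels s /\ uniq s.
  by rewrite !inE => /orP[]/eqP->.
have := weight_bound hp hl labI genus genus2 lP cls.
rewrite sumnE big_map leqNgt => /negP; apply; rewrite ltnS.
apply: (@leq_trans (\sum_(it <- [:: hexagon; [:: 0; 4; 8]%N]) weight it)).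
  apply: leq_sum_subset; last exact: mem_subseq (filter_subseq _ _).
  exact: filter_uniq.
have -> : (\sum_(it <- [:: hexagon; [:: 0; 4; 8]%N]) weight it = 20)%N.
  by rewrite !big_cons big_nil; vm_compute.
by [].
Qed.

Lemma flat_orbits : exists2 S, S = target \/ S = pinched &
  all is_face S /\ forall f, has (is_image (face_labels lab f)) S.
Proof.
apply: (leaf_orbits hp hl labI (or_intror (conj u0 c0)) genus genus2 _ _ flat_leaf_check) => // AB.
rewrite !inE => /or3P[] /eqP-> /=; split=> //.
- exact: base_triangle.
- by move=> h _; apply: no_hexagon; exact: long_hexagon.
- by move=> h5 h7; apply: no_hexagon; apply: long_hexagon; exact: short_long.
Qed.

End Flat.

(** * Orbits with fewer than twelve points *)

Fixpoint masks (n : nat) : seq (seq bool) :=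
  if n is n'.+1 then map (cons true) (masks n') ++ map (cons false) (masks n') else [:: [::]].

Lemma mem_masks (b : seq bool) : b \in masks (size b).
Proof.
by elim: b => //= -[] b IH; rewrite mem_cat map_f ?orbT // inE; do ?[exact: inj_map].
Qed.

Section Degenerate.
Variables (R : realType) (M : map_data) (p : vert M -> 'rV[R]_3).
Hypothesis hp : polyhedron p.
Variables (e : nat -> 'rV[R]_3) (d c v u : R) (lab : nat -> vert M).
Hypothesis hl : labelling p e d c v u lab.
Variable g0 : nat.
Hypothesis genus : has_genus M g0.
Hypothesis genus2 : (2 <= g0)%N.

Local Notation in_face := (in_face lab).
Local Notation vset := (vset lab).
Local Notation P k := (mv (rotation k) (coords c v u)).

Lemma few_faces (l : seq nat) (ok : pred (seq bool)) : (forall w, exists2 k, k \in l & w = lab k) ->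
  (forall f, ok [seq lab k \in face_verts f | k <- l]) ->
  (10 <= \sum_(b <- masks (size l) | ok b) (count id b - 2))%N.
Proof.
move=> hl' hok.
have szf (f : face M) : (size (bdry f) <= count id [seq lab k \in face_verts f | k <- l])%N.
  have -> : size (bdry f) = #|face_verts f|.
    by rewrite cardsE (card_uniqP (face_uniq hp f)).
  rewrite count_map -size_filter; set l' := [seq k <- l | _].
  apply: (@leq_trans #|[set w in map lab l']%SET|).
    apply/subset_leq_card/fintype.subsetP => w hw; have [k kl ek] := hl' w.
    rewrite inE ek; apply: map_f; by rewrite mem_filter kl andbT /= -ek.
  by rewrite cardsE (leq_trans (card_size _)) // size_map.
have [_ [h1 _ _] _ _ _] := polyhedron_map hp.
have [f0 _] := h1 (lab 0%N).
have V3 : (3 <= #|vert M|)%N.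
  apply: leq_trans (face_size hp f0) _; rewrite -(card_uniqP (face_uniq hp f0)).
  exact: max_card.
apply: (@leq_trans (\sum_(f : face M) (size (bdry f) - 2))).
  by apply: leq_trans (genus_excess hp genus genus2); rewrite -[10%N]/(3 * 2 + 4)%N leq_add2r leq_mul2r V3.
apply: (@leq_trans (\sum_(b <- [seq [seq lab k \in face_verts f | k <- l] | f <- enum (face M)])
    (count id b - 2))).
  by rewrite big_map -big_enum leq_sum // => f _; rewrite leq_sub2r.
rewrite -(big_filter (masks _) ok); apply: leq_sum_subset.
  rewrite map_inj_uniq ?enum_uniq // => f g fg; apply: (face_verts_inj hp); apply/setP => w.
  have [k kl ->] := hl' w.
  have := congr1 (fun b => nth true b (index k l)) fg.
  by rewrite !(nth_map 0%N) ?index_mem // nth_index.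
move=> b /mapP[f _ ->]; rewrite mem_filter hok /=.
by have := mem_masks [seq lab k \in face_verts f | k <- l]; rewrite size_map.
Qed.

Lemma same_label k k' : (k < 12)%N -> (k' < 12)%N ->
  (forall i, (i < 3)%N -> P k i = P k' i) -> lab k = lab k'.
Proof.
move=> hk hk' h; have [_ _ hpt _ _] := hl; apply: (polyhedron_inj hp).
by rewrite !hpt //; apply: lin_ext; apply: h.
Qed.

Lemma four_vertices : v = 0 -> u = 0 -> False.
Proof.
move=> v0 u0.
(* Four triples count 1 each and the full set counts 2. *)
have E : (\sum_(b <- masks (size [:: 0; 1; 2; 3]) | predT b) (count id b - 2) = 6)%N.
  by rewrite -big_filter -(big_map (fun b => count id b - 2)%N predT id) -sumnE; vm_compute.
suff : (10 <= \sum_(b <- masks (size [:: 0; 1; 2; 3]) | predT b) (count id b - 2))%N by rewrite E.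
apply: few_faces => // w; have [k hk ->] := lab_surj hl w; exists (k %% 4)%N.
  by have := ltn_pmod k (isT : (0 < 4)%N); case: (k %% 4)%N => [|[|[|[|]]]].
apply: same_label => //; first by rewrite (ltn_trans (ltn_pmod _ _)).
by move: k hk => [|[|[|[|[|[|[|[|[|[|[|[|//]]]]]]]]]]]] _ [|[|[|//]]] _;
  rewrite /mv /rotation /coords /= ?v0 ?u0 ?addr0.
Qed.

(** The points are those of an octahedron. Its three axes cross at the centre, so one in a face
    would bring all three into that face, which is planar. Without antipodal pairs only eight
    triangles are left. *)
Lemma six_vertices : v = 0 -> c = 0 -> 0 < u -> False.
Proof.
move=> v0 c0 u0.
have anti : in_face [:: 0; 2]%N -> False.
  move=> h.
  have [f hf] := h.
  have [f1 hf1] : in_face [:: 4; 5]%N := in_face_mul hl (isT : (4 < 12)%N) (isT : labels [:: 0; 2]%N) h.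
  have [f2 hf2] : in_face [:: 8; 11]%N := in_face_mul hl (isT : (8 < 12)%N) (isT : labels [:: 0; 2]%N) h.
  have [fr _ hpt _ _] := hl.
  have ne k k' i : (k < 12)%N -> (k' < 12)%N -> (i < 3)%N -> P k i != P k' i -> lab k != lab k'.
    move=> hk hk' hi; apply: contraNneq => ek; apply/eqP.
    by apply: (lin_inj fr) hi; rewrite -!hpt ?ek.
  have e1 : f = f1.
    apply: (crossing_faces (a0 := 1) (a1 := 1) (a2 := 1) (a3 := 1) hp hl _ _ hf hf1) => //.
    - move=> i j; rewrite !inE => /orP[]/eqP-> /orP[]/eqP->; apply: (ne _ _ 0%N) => //;
        by rewrite /mv /rotation /coords /= ?v0 ?c0 ?addr0 ?add0r ?oppr0 ?oppr_eq0 gt_eqF //.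
    - by case=> [|[|[|//]]] _; rewrite /mv /rotation /coords /= ?v0 ?c0; ring.
  have e2 : f = f2.
    apply: (crossing_faces (a0 := 1) (a1 := 1) (a2 := 1) (a3 := 1) hp hl _ _ hf hf2) => //.
    - move=> i j; rewrite !inE => /orP[]/eqP-> /orP[]/eqP->; apply: (ne _ _ 0%N) => //;
        by rewrite /mv /rotation /coords /= ?v0 ?c0 ?addr0 ?add0r ?oppr0 ?oppr_eq0 gt_eqF //.
    - by case=> [|[|[|//]]] _; rewrite /mv /rotation /coords /= ?v0 ?c0; ring.
  have s4 : vset [:: 0; 2; 4; 8]%N \subset face_verts f.
    move: hf hf1 hf2; rewrite -e1 -e2 !vset_sub /= !andbT.
    by case/andP=> -> -> /andP[-> _] /andP[-> _].
  have := coplanar_det hp hl (isT : labels [:: 0; 2; 4; 8]%N) s4; rewrite /rdet /det_points /mv /rotation /coords /= v0 c0.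
  move=> h0; have : 0 < u * (u * u) by rewrite !mulr_gt0.
  by lra.
have anti4 : in_face [:: 4; 5]%N -> False.
  by move=> h; apply: anti; exact: (@in_face_image _ _ _ _ _ _ _ _ _ hl 4 [:: 0; 2]%N isT isT h).
have anti8 : in_face [:: 8; 11]%N -> False.
  by move=> h; apply: anti; exact: (@in_face_image _ _ _ _ _ _ _ _ _ hl 8 [:: 0; 2]%N isT isT h).
pose ok (b : seq bool) := [&& ~~ (nth true b 0 && nth true b 1), ~~ (nth true b 2 && nth true b 3)
  & ~~ (nth true b 4 && nth true b 5)].
have E : (\sum_(b <- masks (size [:: 0; 2; 4; 5; 8; 11]) | ok b) (count id b - 2) = 8)%N.
  by rewrite -big_filter -(big_map (fun b => count id b - 2)%N predT id) -sumnE; vm_compute.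
have nin k k' f : (in_face [:: k; k'] -> False) -> ~~ ((lab k \in face_verts f) && (lab k' \in face_verts f)).
  by move=> h; apply/negP => hk; apply: h; exists f; rewrite vset_sub /= andbT.
suff : (10 <= \sum_(b <- masks (size [:: 0; 2; 4; 5; 8; 11]) | ok b) (count id b - 2))%N by rewrite E.
apply: few_faces => [w|f]; last by apply/and3P; split; exact: nin.
have [k hk ->] := lab_surj hl w.
(* For each label, the chosen label of the same point of the octahedron. *)
exists (nth 0 [:: 0; 0; 2; 2; 4; 5; 5; 4; 8; 11; 8; 11] k)%N.
  by move: k hk => [|[|[|[|[|[|[|[|[|[|[|[|//]]]]]]]]]]]].
apply: same_label => //; first by move: k hk => [|[|[|[|[|[|[|[|[|[|[|[|//]]]]]]]]]]]].
by move: k hk => [|[|[|[|[|[|[|[|[|[|[|[|//]]]]]]]]]]]] _ [|[|[|//]]] _;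
  rewrite /mv /rotation /coords /= ?v0 ?c0 ?addr0 ?add0r ?oppr0.
Qed.

Lemma generic_position : [\/ 0 < v | [/\ v = 0, 0 < u & 0 < c]].
Proof.
have [_ [c0 v0 u0] _ _ _] := hl.
have [v1|v1] := ltP 0 v; first by left.
have {}v1 : v = 0 by apply/le_anti; rewrite v0 v1.
have [u1|u1] := ltP 0 u; last by case: four_vertices => //; apply/le_anti; rewrite u0 u1.
have [c1|c1] := ltP 0 c; first by right.
by case: six_vertices => //; apply/le_anti; rewrite c0 c1.
Qed.

Lemma face_orbits : exists2 S, S = target \/ S = pinched &
  all (is_face lab) S /\ forall f, has (is_image (face_labels lab f)) S.
Proof.
case: generic_position => [v1|[v1 u1 c1]]; first exact: (generic_orbits hp hl genus genus2).
exact: (flat_orbits hp hl v1 u1 c1 genus genus2).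
Qed.

Lemma generic_labels : {in [pred k | (k < 12)%N] &, injective lab}.
Proof.
case: generic_position => [v1|[v1 u1 c1]].
  exact: (distinct_labels hl (generic_domainP hl v1) generic_distinct).
exact: (distinct_labels hl (flat_domainP hl v1 u1 c1) flat_distinct).
Qed.

End Degenerate.

(** * Uniqueness *)

(* The link of vertex [0] in [pinched] has one component on each of these sets. *)
Definition link1 : seq nat := [:: 4; 7; 9; 11]%N.
Definition link2 : seq nat := [:: 5; 6; 8; 10]%N.

Lemma pinched_link_check : all (fun s => [|| 0%N \notin s, all (mem (0%N :: link1)) s
    | all (mem (0%N :: link2)) s])
  (flatten [seq images it | it <- pinched]).
Proof. by vm_compute. Qed.

Lemma triangle_target_check : all (fun t => has (is_image t) target) triangle_table.
Proof. by vm_compute. Qed.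

Lemma target_triangle_check :
  all (fun s => has (same_labels s) triangle_table) (flatten [seq images it | it <- target]).
Proof. by vm_compute. Qed.

Lemma triangle_distinct_check : all (fun i => all (fun j => (i == j) ||
    ~~ same_labels (triangle i) (triangle j)) (iota 0 32)) (iota 0 32).
Proof. by vm_compute. Qed.

Section Types.
Variables (R : realType) (M : map_data) (p : vert M -> 'rV[R]_3).
Hypothesis hp : polyhedron p.
Variables (e : nat -> 'rV[R]_3) (d c v u : R) (lab : nat -> vert M).
Hypothesis hl : labelling p e d c v u lab.
Hypothesis labI : {in [pred k | (k < 12)%N] &, injective lab}.

Local Notation is_face := (is_face lab).
Local Notation face_labels := (face_labels lab).
Local Notation vset := (vset lab).

Lemma mem_face_labels f k : (k < 12)%N -> (k \in face_labels f) = (lab k \in face_verts f).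
Proof. by move=> hk; rewrite mem_filter mem_iota /= hk andbT. Qed.

(** Two faces with a common edge at vertex 0 share a second label, and [link1] and [link2] are
    disjoint. So adjacency at 0 preserves the component, while [[0; 4; 9]] and [[0; 5; 10]] lie in
    different ones. *)
Lemma not_pinched : all is_face pinched -> ~ (forall f, has (is_image (face_labels f)) pinched).
Proof.
move=> hf cls.
pose side (f : face M) := has (mem link1) (face_labels f).
have sideE f k : 0%N \in face_labels f -> k \in face_labels f -> k != 0%N -> side f = (k \in link1).
  move=> h0 hk k0; have /hasP[it hit /hasP[t ht /andP[/allP s1 /allP s2]]] := cls f.
  have ht' : t \in flatten [seq images it | it <- pinched] by apply/flatten_mapP; exists it.
  have [/negP|h|h] := or3P (allP pinched_link_check t ht'); first by move/(_ (s2 _ h0)).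
    have : k \in 0%N :: link1 := allP h k (s2 _ hk); rewrite inE (negPf k0) orFb => kl.
    by rewrite kl; apply/hasP; exists k.
  have : k \in 0%N :: link2 := allP h k (s2 _ hk); rewrite inE (negPf k0) orFb => kl.
  have -> : (k \in link1) = false by apply/negP; move: kl; rewrite /link1 /link2 !inE => /or4P[]/eqP->.
  apply/negP => /hasP[k' hk' kA]; have : k' \in 0%N :: link2 := allP h k' (s2 _ hk').
  by move: (kA : k' \in link1); rewrite /link1 /link2 !inE => /or4P[]/eqP->.
have cl : fingraph.closed (adjacent_at (lab 0%N)) side.
  move=> f g /existsP[w]; rewrite /common_edge finset.in_setI => /andP[h1 h2].
  have [x hx ex] := face_edgeP h1.
  have [nx _ _] := next_neq (face_uniq hp f) (face_size hp f) hx.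
  have [k hk ew] := lab_surj hl w.
  have k0 : k != 0%N.
    apply: contraNneq nx => k0; move: ex; rewrite ew k0 finset.setUid => /setP ex.
    by have := ex x; have := ex (next (bdry f) x); rewrite !inE !eqxx orbT /= => /eqP-> /eqP->.
  have mf (h : face M) : [set w; lab 0%N]%SET \in face_edges h ->
      0%N \in face_labels h /\ k \in face_labels h.
    move/face_edge_sub/fintype.subsetP => hs.
    by rewrite !mem_face_labels //; split; apply: hs; rewrite !inE ?ew eqxx ?orbT.
  have [f0 fk] := mf f h1; have [g0 gk] := mf g h2.
  by rewrite -![_ \in side]/(side _) (sideE f k) // (sideE g k).
have [_ [_ _ link] _ _ _] := polyhedron_map hp.
case/and4P: hf => /existsP[f /eqP hf] _ /existsP[g /eqP hg] _.
have m0 (h : face M) s : face_verts h = vset (0%N :: s) -> lab 0%N \in bdry h.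
  move=> hs; suff : lab 0%N \in face_verts h by rewrite inE.
  by rewrite hs inE mem_head.
have fg : connect (adjacent_at (lab 0%N)) f g := link _ _ _ (m0 _ _ hf) (m0 _ _ hg).
have mv' (h : face M) s k : labels s -> face_verts h = vset s -> k \in s -> k \in face_labels h.
  move=> ls hs ks; rewrite mem_face_labels ?hs; first by rewrite inE map_f.
  by move/allP: ls; apply.
have sf : side f by rewrite (sideE f 4%N) // (mv' f [:: 0; 4; 9]%N).
have sg : side g = false by rewrite (sideE g 5%N) // (mv' g [:: 0; 5; 10]%N).
by have := fingraph.closed_connect cl fg; rewrite -![_ \in side]/(side _) sf sg.
Qed.

Lemma target_isomorphic : all is_face target -> (forall f, has (is_image (face_labels f)) target) ->
  map_isomorphic triangle_map M.
Proof.
move=> hf cls.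
have shape (i : 'I_32) : labels (triangle i) /\ uniq (triangle i).
  by case: (triangle_shape i) => h1 _ h2.
have ex (i : 'I_32) : exists f, face_verts f = vset (triangle i).
  have hi : triangle i \in triangle_table by rewrite mem_nth // (ltn_ord i).
  have /hasP[it hit im] := allP triangle_target_check _ hi.
  have lit : labels it by move: hit; rewrite !inE => /or4P[]/eqP->.
  have := allP hf it hit; rewrite -(is_face_is_image hl lit im) => /existsP[f /eqP h].
  by exists f.
have [psi hpsi] := choice ex.
pose phi (w : 'I_12) := lab w.
have phiI : injective phi by move=> w w' /labI h; apply/val_inj/h; rewrite inE ltn_ord.
have phiB : bijective phi.
  by apply: inj_card_bij => //; rewrite (card_vert hl labI) card_ord.
exists phi, psi; split=> //.
  have psiI : injective psi.
    move=> i j eij; apply/val_inj/eqP.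
    have /orP[//|] := all_iotaP _ _ (all_iotaP _ _ triangle_distinct_check i (ltn_ord i)) j (ltn_ord j).
    have [li _] := shape i; have [lj _] := shape j.
    have eS : vset (triangle i) = vset (triangle j) by rewrite -!hpsi eij.
    case/negP; apply/andP; split; apply/allP => k hk.
      by have k12 := allP lj k hk; rewrite -[mem _ _]/(k \in _) -(mem_vset labI k12 li) eS (mem_vset labI).
    by have k12 := allP li k hk; rewrite -[mem _ _]/(k \in _) -(mem_vset labI k12 lj) -eS (mem_vset labI).
  have sur f : exists i, psi i = f.
    have /hasP[it hit /hasP[t ht st]] := cls f.
    have ht' : t \in flatten [seq images it | it <- target] by apply/flatten_mapP; exists it.
    have /hasP[t' ht'' tt'] := allP target_triangle_check t ht'.
    have hi : (index t' triangle_table < 32)%N by rewrite -[32%N]/(size triangle_table) index_mem.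
    exists (Ordinal hi); apply: (face_verts_inj hp); rewrite hpsi /triangle /= nth_index //.
    by rewrite -(vset_face_labels hl f); apply/esym/vset_same/(same_labels_trans st).
  have [chi hchi] := choice sur.
  by exists chi => // i; apply: psiI.
move=> i; have [li ui] := shape i; have [_ szi _] := triangle_shape i.
have psz : size (bdry (psi i)) = 3%N by rewrite (size_face_vset hp labI li ui (hpsi i)).
have fvE : face_verts (psi i) = [set phi w | w in face_verts (i : face triangle_map)]%SET.
  apply/setP => w; rewrite hpsi inE; apply/mapP/imsetP => [[k hk ->]|[w' hw' ->]].
    have hk12 := allP li k hk; exists (Ordinal hk12) => //.
    by rewrite inE mem_bdry.
  by exists (val w') => //; rewrite inE mem_bdry in hw'.
exact: (@triangle_edges_map triangle_map M phi i (psi i) phiB (bdry_uniq i) (bdry_size i) (face_uniq hp _) psz fvE).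
Qed.

End Types.

Lemma tetrahedral_type_unique (R : realType) (M : map_data) :
  tetrahedral_type R M -> map_isomorphic triangle_map M.
Proof.
case=> -[g g2 hg] [p [hp hv]].
have V0 : (0 < #|vert M|)%N by have [_ _ []] := polyhedron_map hp.
have [e [d [c [v [u [lab hl]]]]]] := labelling_exists (polyhedron_inj hp) V0 hv.
have labI := generic_labels hp hl hg g2.
have [S hS [h1 h2]] := face_orbits hp hl hg g2.
case: hS => eS; rewrite {}eS in h1 h2; first exact: (target_isomorphic hp hl labI h1 h2).
by case: (not_pinched hp hl h1 h2).
Qed.

(** * Realization *)

(** Integer coordinates of the realization, so that separation and convexity are decided by exact
    computation over [int] and then transferred to [R]. *)
Definition ipoint (k i : nat) : int := mv (rotation k) (nth 0 [:: 5; 2; 1]) i.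
Definition idot (a : seq int) (k : nat) : int :=
  nth 0 a 0 * ipoint k 0 + nth 0 a 1 * ipoint k 1 + nth 0 a 2 * ipoint k 2.
Definition idet (i j k : nat) : int :=
  ipoint i 0 * (ipoint j 1 * ipoint k 2 - ipoint j 2 * ipoint k 1) +
  ipoint i 1 * (ipoint j 2 * ipoint k 0 - ipoint j 0 * ipoint k 2) +
  ipoint i 2 * (ipoint j 0 * ipoint k 1 - ipoint j 1 * ipoint k 0).

Definition coords_of (k : nat) : seq int := [:: ipoint k 0; ipoint k 1; ipoint k 2].

Lemma sphere_check : all (fun k => idot (coords_of k) k == 30) (iota 0 12).
Proof. by vm_compute. Qed.

Lemma points_check : all (fun i => all (fun j => (i == j) || (coords_of i != coords_of j))
  (iota 0 12)) (iota 0 12).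
Proof. by vm_compute. Qed.

Lemma independent_check : all (fun t => idet (nth 0%N t 0) (nth 0%N t 1) (nth 0%N t 2) != 0)
  triangle_table.
Proof. by vm_compute. Qed.

Lemma mul_triangle_check : all (fun g => all (fun f =>
    has (fun f' => same_labels (map (mul12 g) (triangle f)) (triangle f')) (iota 0 32))
  (iota 0 32)) (iota 0 12).
Proof. by vm_compute. Qed.

Lemma triangle_orbits_check : all (fun f => has (fun g =>
    has (fun f' => same_labels (map (mul12 g) (triangle f')) (triangle f)) [:: 0; 12; 24; 28]%N)
  (iota 0 12)) (iota 0 32).
Proof. by vm_compute. Qed.

(* The four rows are for the triangles 0, 12, 24, 28, one for each orbit.  The
   entry [:: a0; a1; a2; b] in column [g] is a plane [a . x = b] through the
   common vertices of the two triangles which otherwise separates them. *)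
Definition separating_planes : seq (nat * seq (seq int)) :=
  zip [:: 0; 12; 24; 28]%N
  [:: [:: [::]; [:: 0; 1; -2; 0]; [:: -1; 0; 0; -1]; [:: -1; 0; 0; -1]; [:: -1; 0; 0; -2];
          [:: 0; 0; -2; 3]; [:: 0; 0; -2; 3]; [:: -1; 0; 0; -2]; [:: 0; 1; 0; 2];
          [:: 0; -1; 0; 2]; [:: -2; 0; 0; -3]; [:: -2; 0; 0; -3]; [:: -2; 2; -1; -7];
          [:: -1; 0; -1; -4]; [:: -1; 0; -1; -4]; [:: -2; 3; -1; -5]; [:: -1; 0; 0; -2];
          [:: -1; -1; 0; -2]; [:: -1; 0; 0; -2]; [:: -1; -1; 0; -2]; [:: -3; 2; -2; -13];
          [:: -1; 0; -1; -4]; [:: -1; 0; 0; -1]; [:: -1; 0; 0; -1]; [:: 0; 1; -1; 1];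
          [:: -1; -1; 0; -3]; [:: -2; 0; 0; -3]; [:: -2; 0; 0; -3]; [:: -3; 2; -2; -13];
          [:: -1; 0; -1; -4]; [:: -1; -1; 0; -2]; [:: -1; 0; 0; -2]];
      [:: [:: 2; -2; 1; 7]; [:: 1; 0; -1; 4]; [:: -1; 0; -1; 4]; [:: -2; 3; 1; 5];
          [:: -2; 2; 3; 13]; [:: 0; 0; -1; 0]; [:: 0; 0; -1; 0]; [:: 0; -1; 1; 4];
          [:: 0; 1; 0; 2]; [:: 0; -1; -1; 2]; [:: -2; 2; 0; 7]; [:: 0; -1; 0; 2]; [::];
          [:: 0; 0; -1; 0]; [:: 0; 0; -1; 0]; [:: 2; -5; 0; 0]; [:: -2; 5; 0; 1];
          [:: 4; -10; 0; 1]; [:: -2; 5; 0; 1]; [:: 4; -10; 0; 1]; [:: 0; 2; -5; -1];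
          [:: 0; 4; -10; -1]; [:: 0; -4; -10; -1]; [:: 0; -2; -5; -1]; [:: 0; 1; -1; 1];
          [:: 1; -2; 1; 5]; [:: -1; 1; 1; 5]; [:: 0; -1; -1; 1]; [:: 5; -12; 0; 1];
          [:: 0; 4; -10; -1]; [:: 0; -4; -10; -1]; [:: -3; 7; 0; 1]];
      [:: [:: 0; -1; 1; -1]; [:: 1; -1; 0; 3]; [:: -2; 0; 0; 3]; [:: -2; 0; 0; 3];
          [:: 0; 0; 2; 3]; [:: -1; -1; 0; -1]; [:: -1; 0; -1; 3]; [:: 0; 0; 2; 3];
          [:: 0; 1; 1; 3]; [:: 0; -2; 0; 3]; [:: -1; 0; 1; -1]; [:: 0; -2; 0; 3];
          [:: 0; -1; 1; -1]; [:: -1; -2; 1; -5]; [:: -1; -1; 1; -5]; [:: 0; -1; 1; -1];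
          [:: -1; -1; 1; -5]; [:: -1; -1; 0; -1]; [:: -2; -1; 1; -5]; [:: -1; -1; 0; -1];
          [:: -1; -1; 2; -5]; [:: -1; -1; 1; -5]; [:: -1; 0; 1; -1]; [:: -1; 0; 1; -1]; [::];
          [:: 0; -1; 1; 0]; [:: -1; 0; 1; 0]; [:: -1; -1; 0; 0]; [:: 0; -1; 1; -1];
          [:: -1; -1; 1; -5]; [:: -1; -1; 0; -1]; [:: -1; 0; 1; -1]];
      [:: [:: 3; -2; 2; 13]; [:: 1; 0; -1; 4]; [:: -1; 0; -1; 2]; [:: -1; 0; 0; 2];
          [:: 0; 1; 1; 4]; [:: 0; 0; -1; 2]; [:: -1; 0; -1; 2]; [:: 2; -2; 3; 13];
          [:: 0; 1; 0; 2]; [:: 2; -3; 2; 13]; [:: -1; 1; 0; 2]; [:: -1; -1; 0; 4];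
          [:: -5; 12; 0; -1]; [:: 0; 4; -10; 1]; [:: 0; 4; -10; 1]; [:: -3; 7; 0; -1];
          [:: -4; 10; 0; 1]; [:: -7; 0; -3; -1]; [:: -4; 10; 0; 1]; [:: -12; 0; -5; -1];
          [:: 0; 3; -7; -1]; [:: 0; 5; -12; -1]; [:: -10; 0; -4; 1]; [:: -10; 0; -4; 1];
          [:: 0; 1; -1; 1]; [:: 1; -1; 1; 5]; [:: -1; 1; 0; 1]; [:: -1; 0; -1; 1]; [::];
          [:: 0; 3; -7; 0]; [:: -7; 0; -3; 0]; [:: -3; 7; 0; 0]]].

Definition separates (c : seq int) (s t : seq nat) : bool :=
  all (fun k => let x := idot c k - nth 0 c 3 in
    if k \in s then if k \in t then x == 0 else x < 0 else (k \in t) ==> (0 < x)) (iota 0 12).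

Lemma separating_planes_check : all (fun row => all (fun g => (row.1 == g) ||
    separates (nth [::] row.2 g) (triangle row.1) (triangle g)) (iota 0 32)) separating_planes.
Proof. by vm_compute. Qed.

Lemma next3 (T : eqType) (x y z : T) : uniq [:: x; y; z] ->
  [/\ next [:: x; y; z] x = y, next [:: x; y; z] y = z & next [:: x; y; z] z = x].
Proof.
rewrite /= !inE negb_or andbT => /andP[/andP[xy xz] yz].
by rewrite !eqxx (eq_sym y) (negPf xy) (eq_sym z x) (negPf xz) (eq_sym z) (negPf yz).
Qed.

Lemma triple_cycle (R : realType) (x y z : 'rV[R]_3) : triple y z x = triple x y z.
Proof. by rewrite /triple !dotE !mxE /=; ring. Qed.

Section Realize.
Variable R : realType.
Local Notation E3 := 'rV[R]_3.
Local Notation M := triangle_map.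
Implicit Types (f : face M) (w : vert M) (g : nat) (A B : {set vert M}).

Definition std (i : nat) : E3 := \row_j (i == j)%:R.

Lemma std_frame : frame std 1.
Proof.
split=> // i j; case: i => [|[|[|//]]]; case: j => [|[|[|//]]] _ _;
  by rewrite dotE !mxE /=; ring.
Qed.

Definition base (i : nat) : R := (nth 0 [:: 5; 2; 1] i : int)%:~R.
Definition point (k : nat) : E3 := lin std (mv (rotation k) base).
Definition place (w : vert M) : E3 := point (val w).

Lemma mv_base k i : mv (rotation k) base i = (ipoint k i)%:~R.
Proof. by rewrite /ipoint /mv /base; case: (rotation k i).1; rewrite /= ?intrN. Qed.

Definition ivec (c : seq int) : E3 := lin std (fun i => (nth 0 c i)%:~R).

Lemma dot_ivec c k : dot (ivec c) (point k) = (idot c k)%:~R.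
Proof.
rewrite (dot_lin std_frame) mul1r /ip !mv_base /idot.
by rewrite !intrD !intrM.
Qed.

Lemma pointE k : point k = ivec (coords_of k).
Proof. by apply: lin_ext; rewrite mv_base. Qed.

Lemma triple_point i j k : (idet i j k != 0) = (triple (point i) (point j) (point k) != 0).
Proof.
rewrite triple_lin mulf_eq0 (negPf (triple_frame std_frame)) orbF !mv_base.
by rewrite -!(intrM, intrB, intrD) intr_eq0.
Qed.

Lemma place_sphere w : dot (place w) (place w) = 30.
Proof.
rewrite /place {1}pointE dot_ivec.
by have /eqP-> := all_iotaP _ _ sphere_check w (ltn_ord w).
Qed.

Lemma place_inj : injective place.
Proof.
move=> w w' e; apply/val_inj/eqP.
have /orP[//|/negP[]] := all_iotaP _ _ (all_iotaP _ _ points_check w (ltn_ord w)) w' (ltn_ord w').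
have h := lin_inj std_frame e; rewrite /coords_of.
have hi i : (i < 3)%N -> ipoint w i = ipoint w' i.
  by move=> hi; apply: (@intr_inj R); rewrite -!mv_base h.
by rewrite !hi.
Qed.

Definition vmul (g : nat) (w : vert M) : vert M := inord (mul12 g w).

Lemma val_vmul g w : (g < 12)%N -> val (vmul g w) = mul12 g w.
Proof. by move=> hg; rewrite /= inordK // mul12_lt. Qed.

Lemma vmul_inj g : (g < 12)%N -> injective (vmul g).
Proof.
move=> hg w w' /(congr1 val); rewrite !val_vmul // => e; apply/val_inj.
have [g' _ h] := mul12_inv hg; have := congr1 (mul12 g') e.
by rewrite !h // ltn_ord.
Qed.

Lemma place_vmul T g w : (g < 12)%N -> acts std T g -> place (vmul g w) = place w *m T.
Proof.
move=> hg hT; rewrite /place val_vmul // /point hT (lin_same3 _ _ (rotation_mul hg (ltn_ord w))).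
by apply: lin_ext; rewrite mv_compose.
Qed.

Lemma face_vertsE f w : (w \in face_verts f) = (val w \in triangle f).
Proof. by rewrite inE mem_bdry. Qed.

Lemma card_face_verts f : #|face_verts f| = 3%N.
Proof. by rewrite cardsE (card_uniqP (bdry_uniq f)) bdry_size. Qed.

Lemma triangle_verts_inj : injective (@face_verts M).
Proof.
move=> f g e; apply/eqP/negP => /negP fg.
have [_ _ _ _ /(_ f g fg)] := triangle_map_polyhedral.
rewrite /= -e finset.setIid card_face_verts => -[//|].
by rewrite finset.in_setI triangle_map_edgeP card_face_verts andbF.
Qed.

Lemma same_labels_verts g f f' : (g < 12)%N ->
  same_labels (map (mul12 g) (triangle f)) (triangle f') ->
  face_verts f' = [set vmul g w | w in face_verts f]%SET.
Proof.
move=> hg /andP[/allP h1 /allP h2]; apply/setP => w; rewrite face_vertsE.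
apply/idP/imsetP => [/h1 /mapP[k hk ew]|[w' hw' ->]].
  have [_ _ /allP/(_ k hk) k12] := triangle_shape f.
  by exists (Ordinal k12); rewrite ?face_vertsE //; apply/val_inj; rewrite val_vmul.
by rewrite val_vmul //; apply/h2/map_f; rewrite -face_vertsE.
Qed.

Lemma face_action g : (g < 12)%N -> exists psi : face M -> face M, bijective psi /\
  forall f, face_verts (psi f) = [set vmul g w | w in face_verts f]%SET.
Proof.
move=> hg; have ex f : exists f', face_verts f' = [set vmul g w | w in face_verts f]%SET.
  have /hasP[f'] := all_iotaP _ _ (all_iotaP _ _ mul_triangle_check g hg) f (ltn_ord f).
  by rewrite mem_iota => hf' h; exists (Ordinal hf' : face M); exact: same_labels_verts.
have [psi hpsi] := choice ex; exists psi; split=> //.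
apply: injF_bij => f f' e; apply: triangle_verts_inj.
by apply: (imset_inj (vmul_inj hg)); rewrite -!hpsi e.
Qed.

Definition separated A B : Prop := exists a b, forall w,
  [/\ w \in A -> w \in B -> dot a (place w) = b,
      w \in A -> w \notin B -> dot a (place w) < b
    & w \in B -> w \notin A -> b < dot a (place w)].

Lemma separatesP c (f g : face M) : separates c (triangle f) (triangle g) ->
  separated (face_verts f) (face_verts g).
Proof.
move=> h; exists (ivec c), (nth 0 c 3)%:~R => w; rewrite !face_vertsE dot_ivec.
have := all_iotaP _ _ h w (ltn_ord w); cbv zeta.
case: ifP => hf; last by move=> /implyP hx; split=> // hg _; rewrite ltr_int -subr_gt0 hx.
case: ifP => hg hx; split=> // _ _; last by rewrite ltr_int -subr_lt0.
by move: hx; rewrite subr_eq0 => /eqP->.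
Qed.

Lemma separated_vmul g A B : (g < 12)%N -> separated A B ->
  separated [set vmul g w | w in A]%SET [set vmul g w | w in B]%SET.
Proof.
move=> hg [a [b h]]; have hT := rotation_mxP std_frame g; set T := rotation_mx _ _ _ in hT.
exists (a *m T), b => w.
have [w' ->] : exists w', w = vmul g w'.
  by have [ih _ K] := injF_bij (vmul_inj hg); exists (ih w).
rewrite !(mem_imset _ _ (vmul_inj hg)) (place_vmul _ hg hT) (acts_isometry std_frame hT).
exact: h.
Qed.

(** A rotation takes [f] to the representative of its orbit, for which the planes are tabulated; the
    plane is then rotated back. *)
Lemma faces_separated (f g : face M) : f != g -> separated (face_verts f) (face_verts g).
Proof.
move=> fg; have /hasP[k hk /hasP[i hi sl]] := all_iotaP _ _ triangle_orbits_check f (ltn_ord f).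
have {}hk : (k < 12)%N by move: hk; rewrite mem_iota.
have hi32 : (i < 32)%N by move: hi; rewrite !inE => /or4P[]/eqP->.
have ef := same_labels_verts (f := Ordinal hi32) hk sl.
have [psi [[ipsi K1 K2] hpsi]] := face_action hk.
have eg : face_verts g = [set vmul k w | w in face_verts (ipsi g)]%SET by rewrite -hpsi K2.
rewrite ef eg; apply: separated_vmul => //.
have nij : i != ipsi g.
  by apply: contraNneq fg => e; apply/eqP/triangle_verts_inj; rewrite ef eg; congr (imset _ (mem (face_verts _))); exact: val_inj.
have /hasP[row hrow /eqP ei] : has (fun row => row.1 == i) separating_planes.
  by move: hi; rewrite !inE => /or4P[]/eqP->.
have := all_iotaP _ _ (allP separating_planes_check _ hrow) (ipsi g) (ltn_ord _).
by rewrite ei (negPf nij) => /(@separatesP _ (Ordinal hi32)).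
Qed.

(** A common point lies on the separating plane, so its weights sit on the vertices in that plane,
    which belong to both sets. *)
Lemma hull_separated A B : separated A B -> hull place A `&` hull place B = hull place (A :&: B)%SET.
Proof.
case=> a [b h]; apply/seteqP; split=> [x [[l wl ex] [l' wl' ex']]|x hx]; last first.
  by split; apply: hullS hx; [exact: finset.subsetIl|exact: finset.subsetIr].
have leA i : i \in A -> dot a (place i) <= b.
  by move=> iA; have [h1 h2 _] := h i; have [iB|iB] := boolP (i \in B); [rewrite h1|exact/ltW/h2].
have geB i : i \in B -> b <= dot a (place i).
  by move=> iB; have [h1 _ h2] := h i; have [iA|iA] := boolP (i \in A); [rewrite h1|exact/ltW/h2].
have e : dot a (bary place l) = b.
  apply/le_anti; rewrite (dot_bary_le wl leA) /= -ex ex'; exact: dot_bary_ge wl' geB.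
exists l => //; have := weights_supp (P := fun i => i \in B) wl.
rewrite (_ : [set i in A | i \in B]%SET = (A :&: B)%SET); last by apply/setP => i; rewrite !inE.
apply=> i li; have ei := dot_bary_supp wl leA e li; apply: contraT => iB.
have iA : i \in A by case: wl => _ lA _; apply: contraNT li => /lA->.
by have [_ h2 _] := h i; have := h2 iA iB; rewrite ei ltxx.
Qed.

Lemma triangle_corners f : exists x y z, [/\ bdry f = [:: x; y; z], uniq [:: x; y; z] &
  triple (place x) (place y) (place z) != 0].
Proof.
have u := bdry_uniq f; have := bdry_size f; have := val_bdry f.
case: (bdry f) u => [|x [|y [|z [|? ?]]]] // u et _; exists x, y, z; split=> //.
rewrite -triple_point; have hf : triangle f \in triangle_table by rewrite mem_nth // (ltn_ord f).
by have := allP independent_check _ hf; rewrite -et.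
Qed.

Lemma corner_separated x y z : uniq [:: x; y; z] -> triple (place x) (place y) (place z) != 0 ->
  hull place [set x; y]%SET `&` hull place [set y; z]%SET = [set place y].
Proof.
rewrite /= !inE negb_or andbT => /andP[/andP[xy xz] yz] D0.
rewrite hull_separated.
  rewrite (_ : (_ :&: _)%SET = [set y]%SET) ?hull1 //; apply/setP => w; rewrite !inE.
  case: (eqVneq w y) => [|wy]; rewrite ?orbT ?orbF //=.
  by case: (eqVneq w x) => //= ->; exact/negbTE.
set D := triple _ _ _ in D0; have D2 : 0 < D ^+ 2 by rewrite lt_def sqr_ge0 expf_neq0.
(* This plane passes through the origin and the corner [y]. Its form takes the values [- D ^+ 2] at
   [x] and [D ^+ 2] at [z], which separates the two sides at the corner. *)
exists (D *: (cross (place x) (place y) - cross (place y) (place z))), 0 => w; rewrite !inE dotZl dotBl -!triple_dot.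
have same (q r : E3) : triple q r q = 0 by rewrite -triple_cycle triplevv.
have sD : D * D = D ^+ 2 by rewrite expr2.
split.
- move=> /orP[]/eqP-> /orP[]/eqP e; rewrite ?triplevv ?same ?subrr ?mulr0 //.
  + by rewrite e eqxx in xy. + by rewrite e eqxx in xz.
- case/orP=> /eqP->; last by rewrite eqxx.
  by move=> _; rewrite same triple_cycle sub0r mulrN sD oppr_lt0.
case/orP=> /eqP->; first by rewrite eqxx orbT.
by move=> _; rewrite triplevv subr0 -/D sD.
Qed.

Lemma triangle_simple f : simple_polygon place f.
Proof.
have [x [y [z [ef u D]]]] := triangle_corners f.
have [xy xz yz] : [/\ x != y, x != z & y != z].
  by move: u; rewrite /= !inE negb_or andbT => /andP[/andP[-> ->] ->].
have [nx ny nz] : [/\ next (bdry f) x = y, next (bdry f) y = z & next (bdry f) z = x].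
  by rewrite ef; exact: next3.
have D1 : triple (place y) (place z) (place x) != 0.
  by rewrite triple_cycle.
have D2 : triple (place z) (place x) (place y) != 0.
  by rewrite -triple_cycle.
have u1 : uniq [:: y; z; x] by rewrite /= !inE negb_or yz ![_ == x]eq_sym xy xz.
have u2 : uniq [:: z; x; y] by rewrite /= !inE negb_or xy !(eq_sym z) xz yz.
have im (s t : set (vert M)) w : s `&` t = [set w] -> place @` (s `&` t) = [set place w].
  by move->; rewrite image_set1.
have cap (q r t : vert M) : uniq [:: q; r; t] -> [set q; r] `&` [set r; t] = [set r].
  rewrite /= !inE negb_or andbT => /andP[/andP[qr qt] rt].
  apply/seteqP; split=> w /=; last by move=> ->; split; [right|left].
  by case=> -[->|->] [e|e] //; rewrite e eqxx in qt.
have seg (q r t : vert M) : uniq [:: q; r; t] -> triple (place q) (place r) (place t) != 0 ->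
    segment (place q) (place r) `&` segment (place r) (place t) = place @` ([set q; r] `&` [set r; t]).
  by move=> h1 h2; rewrite !segment_hull corner_separated // (im _ _ r) // cap.
move=> v w; rewrite {1 2}ef !inE /edge_segment => /or3P[]/eqP-> /or3P[]/eqP->;
  rewrite ?eqxx // ?nx ?ny ?nz => _; try exact: seg;
  by rewrite setIC [X in _ @` X]setIC; exact: seg.
Qed.

Lemma triangle_planar f : planar place f.
Proof.
have [x [y [z [ef u D]]]] := triangle_corners f.
set a := cross (place y - place x) (place z - place x); exists a, (dot a (place x)); split.
  apply: contraNneq D => a0.
  have -> : triple (place x) (place y) (place z) = dot a (place x).
    by rewrite /a; move: (place x) (place y) (place z) => q r t; rewrite /triple !dotE !mxE /= ?mxE; ring.
  by rewrite a0 dotC dot0r.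
move=> v; rewrite ef !inE /a => /or3P[]/eqP-> //;
  by move: (place x) (place y) (place z) => q r t; rewrite !dotE !mxE /= ?mxE; ring.
Qed.

Lemma triangle_region f : region place f = hull place (face_verts f).
Proof.
have ss : (3 <= size (bdry f))%N by rewrite bdry_size.
have [n [b cn]] := exists_convex_normal place_inj place_sphere (bdry_uniq f) ss (@triangle_simple f) (triangle_planar f).
exact: (region_triangle place_inj (bdry_uniq f) ss cn (bdry_size f)).
Qed.

Lemma triangle_face_to_face : face_to_face place.
Proof.
move=> f g fg; rewrite !triangle_region (hull_separated (faces_separated fg)).
set I := (_ :&: _)%SET.
have [_ _ _ _ /(_ f g fg)] := triangle_map_polyhedral; rewrite -/I => -[I1|hE].
  have [I0|[w wI]] := set_0Vmem I.
    constructor 1; rewrite I0; apply/seteqP; split=> // x [l /weights0].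
    by rewrite eqxx.
  have eI : I = [set w]%SET by apply/esym/eqP; rewrite eqEcard finset.sub1set wI cards1.
  constructor 2; exists w; move: (wI); rewrite finset.in_setI !inE => /andP[h1 h2].
  by split=> //; rewrite eI hull1.
constructor 3; have := hE; rewrite finset.in_setI => /andP[/face_edgeP[w hw eI] _].
exists w, (next (bdry f) w); split; first by rewrite /common_edge -eI.
by rewrite segment_hull -eI.
Qed.

Lemma triangle_polyhedron : polyhedron place.
Proof.
split; [exact: triangle_map_polyhedral|exact: place_inj| |exact: triangle_face_to_face].
by move=> f; split; [exact: triangle_planar|exact: triangle_simple].
Qed.

End Realize.

(** Points 1 and 2 are singled out by their inner products with point 0, and likewise after
    rotation. Hence the image of vertex 0 determines a symmetry, which rules out reflections. *)
Lemma congruence_check : all (fun k => (mul12 k 0 == k) && all (fun j => all (fun m =>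
    (idot (coords_of m) k == idot (coords_of j) 0) ==> (m == mul12 k j)) (iota 0 12)) [:: 1; 2]%N)
  (iota 0 12).
Proof. by vm_compute. Qed.

Lemma transitive_check : all (fun i => all (fun j => has (fun k => mul12 k i == j) (iota 0 12))
  (iota 0 12)) (iota 0 12).
Proof. by vm_compute. Qed.

Lemma mulmx_ext (R : realType) (x y z : 'rV[R]_3) (A B : 'M[R]_3) : triple x y z != 0 ->
  x *m A = x *m B -> y *m A = y *m B -> z *m A = z *m B -> A = B.
Proof.
move=> D hx hy hz; apply/row_matrixP => i; rewrite !rowE; move: (delta_mx 0 i) => v.
have e : triple x y z *: v = triple v y z *: x + triple x v z *: y + triple x y v *: z.
  by rewrite /triple; apply: vecP; rewrite !dotE !mxE /=; ring.
apply: (scalerI D); rewrite !scalemxAl e !mulmxDl -!scalemxAl.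
by rewrite hx hy hz.
Qed.

Section Symmetry.
Variable R : realType.
Local Notation E3 := 'rV[R]_3.
Local Notation std := (std R).
Local Notation place := (@place R).
Local Notation M := triangle_map.

Definition tetra (j : 'I_4) : E3 := lin std (mv (rotation j) (fun=> 1)).

Lemma tetra_inord k : (k < 4)%N -> tetra (inord k) = lin std (mv (rotation k) (fun=> 1)).
Proof. by move=> hk; rewrite /tetra inordK. Qed.

Lemma tetra_regular : regular_tetrahedron tetra.
Proof.
exists 8 => //; apply: ord4P; apply: ord4P; rewrite ?eqxx // => _; rewrite !tetra_inord // lin_sub (dot_lin (std_frame R)) /ip /mv /rotation /=; ring.
Qed.

Lemma tetra_centered : centered tetra.
Proof.
rewrite /centered !big_ord_recl big_ord0 addr0 /tetra /lin /mv /rotation /=.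
by apply: vecP; rewrite !mxE; ring.
Qed.

Lemma tetra_axisE i : (i < 3)%N -> tetra_axis tetra i = 2 *: std i.
Proof.
case: i => [|[|[|//]]] _; rewrite /tetra_axis !tetra_inord //;
  by rewrite /lin /mv /rotation /=; apply: vecP; rewrite !mxE; ring.
Qed.

Lemma acts_tetra_std A k : acts (tetra_axis tetra) A k <-> acts std A k.
Proof.
have two : (2 : R) != 0 by rewrite pnatr_eq0.
have e q : lin (tetra_axis tetra) q = 2 *: lin std q.
  by rewrite /lin !tetra_axisE // !scalerDr !scalerA ![2 * _]mulrC.
split=> h q; last by rewrite !e -scalemxAl h.
by apply: (scalerI two); rewrite scalemxAl -!e h.
Qed.

Lemma region_action k (psi : face M -> face M) A : (k < 12)%N -> acts std A k ->
  (forall f, face_verts (psi f) = [set vmul k w | w in face_verts f]%SET) ->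
  forall f, region place (psi f) = act A (region place f).
Proof.
move=> hk hA hpsi f; rewrite !triangle_region hpsi act_hull hull_imset; congr hull.
by apply/funext => w /=; rewrite (place_vmul _ hk hA).
Qed.

Lemma rotation_symmetry A k : (k < 12)%N -> acts std A k -> symmetry place A.
Proof.
move=> hk hA; have [psi [bpsi hpsi]] := face_action hk.
have hreg := region_action hk hA hpsi.
split; first exact: acts_isometry (std_frame R) _ _ hA.
  have [ipsi _ K] := bpsi.
  apply/seteqP; split=> [_ [x [f _ hx] <-]|x [f _ hx]].
    by exists (psi f) => //; rewrite hreg; exists x.
  by move: hx; rewrite -(K f) hreg => -[y hy <-]; exists y => //; exists (ipsi f).
exists (vmul k), psi; split=> //; last by move=> w; exact: place_vmul.
have bk := injF_bij (vmul_inj hk).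
split=> // f; exact: (triangle_edges_map bk (bdry_uniq f) (bdry_size f) (bdry_uniq _) (bdry_size _)).
Qed.

(** The symmetry and the rotation with the same image of vertex 0 agree on the vertices 0, 1 and 2,
    which are linearly independent. *)
Lemma symmetry_rotation A : symmetry place A -> exists2 k, (k < 12)%N & acts std A k.
Proof.
case=> iso _ [phi [psi [_ hphi _]]].
pose o (j : nat) : vert M := (inord j : 'I_12).
set k := val (phi (o 0%N)); have hk : (k < 12)%N by exact: ltn_ord.
exists k => //; have hB := rotation_mxP (std_frame R) k; set B := rotation_mx _ _ _ in hB.
suff -> : A = B by [].
have /andP[/eqP k0 hc] := all_iotaP _ _ congruence_check k hk.
have key j : j \in [:: 0; 1; 2]%N -> place (o j) *m A = place (o j) *m B.
  move=> hj; have j12 : (j < 12)%N by move: hj; rewrite !inE => /or3P[]/eqP->.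
  rewrite -hphi -(place_vmul _ hk hB); congr place; apply/val_inj; rewrite val_vmul // inordK //.
  move: hj; rewrite inE => /orP[/eqP->|hj]; first by rewrite k0.
  have := all_iotaP _ _ (allP hc j hj) _ (ltn_ord (phi (o j))) => /implyP h; apply/eqP/h.
  apply/eqP/(@intr_inj R); rewrite -!dot_ivec -!pointE.
  have := iso (place (o j)) (place (o 0%N)); rewrite -!hphi => e.
  by move: e; rewrite /place /= !inordK.
have D : triple (place (o 0%N)) (place (o 1%N)) (place (o 2%N)) != 0.
  by rewrite /place /= !inordK // -triple_point.
by apply: (mulmx_ext D); apply: key.
Qed.

Lemma triangle_map_symmetric : vertex_transitive_tetrahedral place.
Proof.
split.
  exists tetra; split; [exact: tetra_regular|exact: tetra_centered|move=> A; split].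
    case/symmetry_rotation => k hk /acts_tetra_std.
    exact: (acts_tetrahedral_rotation tetra_regular tetra_centered).
  case/(tetrahedral_rotation_acts tetra_regular tetra_centered) => k hk /acts_tetra_std.
  exact: rotation_symmetry.
move=> w w'.
have /hasP[k] := all_iotaP _ _ (all_iotaP _ _ transitive_check w (ltn_ord w)) w' (ltn_ord w').
rewrite mem_iota => hk /eqP e; have hA := rotation_mxP (std_frame R) k.
exists (rotation_mx std 1 k); first exact: rotation_symmetry hk hA.
by rewrite -(place_vmul _ hk hA); congr place; apply/val_inj; rewrite val_vmul.
Qed.

End Symmetry.

(** * The convex hull *)

(* The label of the point realizing each vertex of the icosahedron. *)
Definition ico_label (k : nat) : nat := nth 0%N [:: 0; 1; 4; 8; 10; 5; 11; 7; 2; 6; 9; 3]%N k.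

Definition ico_cells : seq (seq nat) :=
  [seq [:: k] | k <- iota 0 12] ++ icosahedron_table ++
  flatten [seq [:: [:: nth 0 t 0; nth 0 t 1]; [:: nth 0 t 1; nth 0 t 2]; [:: nth 0 t 2; nth 0 t 0]]%N
          | t <- icosahedron_table].

(* Planes [a . x = b] supporting the hull of the 12 points along the faces and
   edges; the vertices lie on a sphere. *)
Definition supporting_planes : seq (seq int) :=
  [seq rcons (coords_of k) 30 | k <- iota 0 12] ++
  [:: [:: 3; -1; 2; 15]; [:: 3; 1; -2; 15]; [:: 1; 1; 1; 8]; [:: 1; 1; -1; 6];
      [:: 2; 3; -1; 15]; [:: 1; -1; 1; 6]; [:: 1; -1; -1; 8]; [:: 2; -3; 1; 15];
      [:: -3; -1; -2; 15]; [:: -3; 1; 2; 15]; [:: -1; 1; -1; 8]; [:: -1; 1; 1; 6];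
      [:: -2; 3; 1; 15]; [:: -1; -1; -1; 6]; [:: -1; -1; 1; 8]; [:: -2; -3; -1; 15];
      [:: -1; 2; 3; 15]; [:: 1; -2; 3; 15]; [:: -1; -2; -3; 15]; [:: 1; 2; -3; 15];
      [:: 1; 0; 0; 5]; [:: 4; 0; 3; 23]; [:: 4; 2; -3; 21]; [:: 3; 4; 0; 23]; [:: 3; 4; -2; 21];
      [:: 4; -2; 3; 21]; [:: 4; 0; -3; 23]; [:: 3; -4; 0; 23]; [:: 3; -4; 2; 21];
      [:: -1; 0; 0; 5]; [:: -4; 0; -3; 23]; [:: -4; 2; 3; 21]; [:: -3; 4; 2; 21];
      [:: -3; 4; 0; 23]; [:: -4; -2; -3; 21]; [:: -4; 0; 3; 23]; [:: -3; -4; -2; 21];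
      [:: -3; -4; 0; 23]; [:: 0; 0; 1; 5]; [:: 0; 3; 4; 23]; [:: 2; -3; 4; 21];
      [:: 0; 0; -1; 5]; [:: 0; -3; -4; 23]; [:: 2; 3; -4; 21]; [:: -2; -3; -4; 21];
      [:: 0; 3; -4; 23]; [:: -2; 3; 4; 21]; [:: 0; -3; 4; 23]; [:: 0; 1; 0; 5]; [:: 0; -1; 0; 5]].

(* For each non-edge [i; j] of the hull, three more points whose convex hull is
   crossed by the segment from [i] to [j]. *)
Definition hull_circuits : seq (seq nat) :=
  [:: [:: 0; 2; 1; 4; 10]; [:: 0; 3; 1; 2; 4]; [:: 0; 6; 1; 5; 8]; [:: 0; 7; 1; 2; 4];
      [:: 0; 9; 1; 2; 3]; [:: 0; 11; 1; 2; 4]; [:: 1; 2; 0; 3; 5]; [:: 1; 3; 0; 4; 9];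
      [:: 1; 6; 0; 2; 5]; [:: 1; 7; 0; 4; 9]; [:: 1; 8; 0; 2; 3]; [:: 1; 10; 0; 2; 5];
      [:: 2; 4; 0; 7; 8]; [:: 2; 5; 0; 3; 6]; [:: 2; 9; 0; 3; 5]; [:: 2; 11; 0; 1; 3];
      [:: 3; 4; 0; 2; 7]; [:: 3; 5; 0; 6; 9]; [:: 3; 8; 0; 2; 4]; [:: 3; 10; 0; 1; 2];
      [:: 4; 5; 0; 1; 2]; [:: 4; 6; 0; 1; 2]; [:: 4; 9; 0; 2; 11]; [:: 4; 10; 0; 2; 8];
      [:: 5; 7; 0; 1; 3]; [:: 5; 8; 0; 2; 10]; [:: 5; 11; 0; 2; 9]; [:: 6; 7; 0; 2; 3];
      [:: 6; 8; 0; 2; 10]; [:: 6; 11; 0; 2; 9]; [:: 7; 9; 0; 2; 11]; [:: 7; 10; 0; 2; 8];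
      [:: 8; 9; 0; 2; 3]; [:: 8; 11; 0; 2; 4]; [:: 9; 10; 0; 2; 5]; [:: 10; 11; 0; 1; 2]]%N.

Definition exposes (c : seq int) (s : seq nat) : bool :=
  all (fun k => let x := idot c k - nth 0 c 3 in if k \in s then x == 0 else x < 0) (iota 0 12).

Definition crossing_circuit (K : seq nat) : bool :=
  if K is [:: i; j; k; l; m] then
    all (fun k => k < 12)%N K &&
    if four_dets +%R (fun x y => x - y) *%R ipoint -%R i j k l m is [:: D0; D1; D2; D3; D4] then
      [&& 0 < D0, 0 < D1, D2 < 0, D3 < 0 & D4 < 0] || [&& D0 < 0, D1 < 0, 0 < D2, 0 < D3 & 0 < D4]
    else false
  else false.

Definition clique (s : seq nat) : bool :=
  pairwise (fun i j => ~~ has (fun K => take 2 K == [:: i; j]) hull_circuits) s.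

Lemma ico_label_check : perm_eq [seq ico_label k | k <- iota 0 12] (iota 0 12).
Proof. by vm_compute. Qed.

Lemma ico_table_check : all (fun t => [&& uniq t, size t == 3 & all (fun k => k < 12) t]%N)
  icosahedron_table.
Proof. by vm_compute. Qed.

Lemma exposes_check : all (fun s => (has (fun c => exposes c (map ico_label s)) supporting_planes) &&
  all (fun k => k < 12)%N s) ico_cells.
Proof. by vm_compute. Qed.

Lemma ico_cells_proper : all (fun s => (s != [::]) && ~~ all (mem (map ico_label s)) (iota 0 12)) ico_cells.
Proof. by vm_compute. Qed.

Lemma circuits_check : all crossing_circuit hull_circuits.
Proof. by vm_compute. Qed.

(** The pairs that are not crossed form the edge graph of an icosahedron, whose nonempty cliques are
    its vertices, edges and triangles. The vertices of a proper face of the hull form a clique. *)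
Lemma cliques_check : all (fun n => all (fun s =>
    clique s ==> has (fun t => same_labels s (map ico_label t)) ico_cells) (combs n (iota 0 12))) [:: 1; 2; 3]%N.
Proof. by vm_compute. Qed.

Lemma no_large_clique : all (fun s => ~~ clique s) (combs 4 (iota 0 12)).
Proof. by vm_compute. Qed.

Section Icosahedron.
Variable R : realType.
Local Notation E3 := 'rV[R]_3.
Local Notation std := (std R).
Local Notation point := (@point R).
Local Notation place := (@place R).
Local Notation M := triangle_map.
Implicit Types (c : {set vert icosahedron}) (s : seq nat) (w : vert M).

Definition ico_point (w : 'I_12) : vert M := inord (ico_label w).

Lemma ico_label_lt k : (k < 12)%N -> (ico_label k < 12)%N.
Proof.
move=> hk; have : ico_label k \in iota 0 12.
  by rewrite -(perm_mem ico_label_check) map_f // mem_iota.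
by rewrite mem_iota.
Qed.

Lemma val_ico_point (w : 'I_12) : val (ico_point w) = ico_label w.
Proof. by rewrite /= inordK // ico_label_lt. Qed.

Lemma ico_label_inj : {in [pred k | (k < 12)%N] &, injective ico_label}.
Proof.
have u : uniq [seq ico_label k | k <- iota 0 12] by rewrite (perm_uniq ico_label_check) iota_uniq.
move=> k k' hk hk' e; have sz : size [seq ico_label k | k <- iota 0 12] = 12%N by [].
apply/eqP; rewrite -(nth_uniq 0%N _ _ u) ?sz // !(nth_map 0%N) ?size_iota //.
by rewrite !nth_iota // e.
Qed.

Lemma ico_point_inj : injective ico_point.
Proof.
move=> w w' /(congr1 val); rewrite !val_ico_point => /ico_label_inj h.
by apply/val_inj/h; rewrite inE ltn_ord.
Qed.

Definition labelled (n : nat) s : {set 'I_n} := [set w : 'I_n | val w \in s]%SET.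

Lemma ico_point_labelled s : all (fun k => k < 12)%N s ->
  [set ico_point w | w in labelled 12 s]%SET = labelled 12 (map ico_label s).
Proof.
move=> /allP hs; apply/setP => w; apply/imsetP/idP => [[w']|].
  by rewrite !inE => h ->; rewrite val_ico_point map_f.
rewrite inE => /mapP[k ks e]; exists (Ordinal (hs k ks)); first by rewrite inE.
by apply/val_inj; rewrite val_ico_point.
Qed.

Lemma ico_bdry (f : face icosahedron) : exists x y z, [/\ bdry f = [:: x; y; z],
  uniq [:: x; y; z] & nth [::] icosahedron_table f = [:: val x; val y; val z]].
Proof.
set t := nth [::] icosahedron_table f.
have /and3P[ut /eqP st /allP lt] : [&& uniq t, size t == 3 & all (fun k => k < 12) t]%N.
  by apply: (allP ico_table_check); rewrite mem_nth // (ltn_ord f).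
have ev : map val (bdry f) = t.
  rewrite /bdry /= -/t -map_comp map_id_in // => k /lt hk /=.
  by rewrite inordK.
rewrite -ev in ut st *; rewrite size_map in st; rewrite map_inj_uniq in ut; last exact: val_inj.
by case: (bdry f) ut st => [|x [|y [|z [|? ?]]]] // ut _; exists x, y, z.
Qed.

Lemma labelled_mem s (c : {set 'I_12}) : (forall w, (w \in c) = (val w \in s)) -> c = labelled 12 s.
Proof. by move=> h; apply/setP => w; rewrite inE h. Qed.

Lemma ico_cellP c : cell c <-> exists2 s, s \in ico_cells & c = labelled 12 s.
Proof.
have edge_cell (f : face icosahedron) s (t := nth [::] icosahedron_table f) :
    s \in [:: [:: nth 0 t 0; nth 0 t 1]; [:: nth 0 t 1; nth 0 t 2]; [:: nth 0 t 2; nth 0 t 0]]%N ->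
    s \in ico_cells.
  move=> h; rewrite mem_cat mem_cat; apply/or3P; constructor 3.
  by apply/flatten_mapP; exists (nth [::] icosahedron_table f); rewrite // mem_nth // (ltn_ord f).
have face_cell (f : face icosahedron) : nth [::] icosahedron_table f \in ico_cells.
  by rewrite mem_cat mem_cat (mem_nth [::]) ?orbT // (ltn_ord f).
split=> [[[w ->]|/bigcupP[f _ /imsetP[w hw ->]]|[f ->]]|[s hs ->]].
- exists [:: val w]; last by apply: labelled_mem => w'; rewrite !inE.
  by rewrite mem_cat map_f ?mem_iota //= ltn_ord.
- have [x [y [z [ef u et]]]] := ico_bdry f; have [nx ny nz] := next3 u.
  move: hw; rewrite ef !inE => /or3P[]/eqP->; rewrite ?nx ?ny ?nz.
  + exists [:: val x; val y]; last by apply: labelled_mem => w'; rewrite !inE.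
    by apply: (edge_cell f); rewrite et !inE eqxx.
  + exists [:: val y; val z]; last by apply: labelled_mem => w'; rewrite !inE.
    by apply: (edge_cell f); rewrite et !inE eqxx ?orbT.
  exists [:: val z; val x]; last by apply: labelled_mem => w'; rewrite !inE.
  by apply: (edge_cell f); rewrite et !inE eqxx ?orbT.
- exists (nth [::] icosahedron_table f) => //; apply: labelled_mem => w.
  have [x [y [z [ef u et]]]] := ico_bdry f.
  by rewrite inE ef et !inE.
have fE t : t \in icosahedron_table -> exists f : face icosahedron, t = nth [::] icosahedron_table f.
  move=> ht; have hi : (index t icosahedron_table < 20)%N.
    by rewrite -[20%N]/(size icosahedron_table) index_mem.
  by exists (Ordinal hi); rewrite /= nth_index.
move: hs; rewrite mem_cat mem_cat => /or3P[/mapP[k]|/fE[f ->]|/flatten_mapP[t /fE[f ->]]].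
- rewrite mem_iota => hk ->; constructor 1; exists (Ordinal hk : 'I_12).
  by apply/esym/labelled_mem => w; rewrite !inE.
- constructor 3; exists f; apply/esym/labelled_mem => w.
  by have [x [y [z [ef u et]]]] := ico_bdry f; rewrite inE ef et !inE.
have [x [y [z [ef u et]]]] := ico_bdry f; have [nx ny nz] := next3 u.
have ed (v : vert icosahedron) : v \in [:: x; y; z] ->
    [set v; next [:: x; y; z] v]%SET \in edges icosahedron.
  by move=> hv; apply/bigcupP; exists f => //; rewrite -ef; apply: imset_f; rewrite ef.
have l2 (v v' : 'I_12) : labelled 12 [:: val v; val v'] = [set v; v']%SET.
  by apply/esym/labelled_mem => w; rewrite !inE.
rewrite et !inE /= => /or3P[]/eqP->; rewrite l2; constructor 2.
- by rewrite -nx; apply: ed; rewrite !inE eqxx.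
- by rewrite -ny; apply: ed; rewrite !inE eqxx ?orbT.
by rewrite -nz; apply: ed; rewrite !inE eqxx ?orbT.
Qed.

Lemma body_hull : convex_hull (body place) = hull place [set: vert M]%SET.
Proof.
apply: convex_hull_eq => [w _|x [f _]].
  have [_ [h _ _] _ _ _] := triangle_map_polyhedral; have [f hf] := h w.
  by exists f => //; rewrite triangle_region; apply: hull_pt; rewrite inE.
by rewrite triangle_region; apply: hullS; exact: finset.subsetT.
Qed.

Lemma exposesP (cc : seq int) s : exposes cc s -> forall w,
  dot (ivec R cc) (place w) <= (nth 0 cc 3)%:~R /\
  (dot (ivec R cc) (place w) == (nth 0 cc 3)%:~R) = (val w \in s).
Proof.
move=> h w; have := all_iotaP _ _ h w (ltn_ord w); cbv zeta; rewrite /place dot_ivec.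
case: ifP => hs; first by rewrite subr_eq0 => /eqP->; rewrite lexx eqxx.
by rewrite subr_lt0 => h'; rewrite ler_int ltW // eqr_int lt_eqF.
Qed.

Lemma dot_point (a : E3) k : dot a (point k) = dot a (std 0) * (ipoint k 0)%:~R +
  dot a (std 1) * (ipoint k 1)%:~R + dot a (std 2) * (ipoint k 2)%:~R.
Proof. by rewrite /point /lin !dotDr !dotZr !mv_base; ring. Qed.

(** A supporting plane through both ends of the segment contains the crossing point, hence the whole
    triangle, all of whose weights are nonzero. Four of the five points are affinely independent, so
    no such plane exists. *)
Lemma circuit_exposes (a : E3) (b : R) i j k l m : crossing_circuit [:: i; j; k; l; m] ->
  (forall w, dot a (place w) <= b) -> dot a (point i) = b -> dot a (point j) = b -> a = 0.
Proof.
rewrite /crossing_circuit; case eD : (four_dets _ _ _ _ _ _ _ _ _ _) => [|D0 [|D1 [|D2 [|D3 [|D4 [|? ?]]]]]];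
  rewrite ?andbF // => /andP[lt hD] le hi hj.
have [sD sP] := four_dets_sum eD.
have le' n : n \in [:: i; j; k; l; m] -> dot a (point n) - b <= 0.
  by move=> /(allP lt) hn; rewrite subr_le0; have := le (Ordinal hn).
have sR : D0%:~R + D1%:~R + D2%:~R + D3%:~R + D4%:~R = 0 :> R.
  by rewrite -!intrD sD.
have sd : D2%:~R * (dot a (point k) - b) + D3%:~R * (dot a (point l) - b) +
    D4%:~R * (dot a (point m) - b) = 0.
  have e n : (n < 3)%N -> D0%:~R * (ipoint i n)%:~R + D1%:~R * (ipoint j n)%:~R + D2%:~R * (ipoint k n)%:~R
      + D3%:~R * (ipoint l n)%:~R + D4%:~R * (ipoint m n)%:~R = 0 :> R.
    by move=> hn; rewrite -!intrM -!intrD sP.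
  have e' : D0%:~R * dot a (point i) + D1%:~R * dot a (point j) + D2%:~R * dot a (point k)
      + D3%:~R * dot a (point l) + D4%:~R * dot a (point m) = 0.
    rewrite !dot_point; transitivity (dot a (std 0) * 0 + dot a (std 1) * 0 + dot a (std 2) * 0 : R);
      last by rewrite !mulr0 !addr0.
    by rewrite -{1}(e 0%N) // -{1}(e 1%N) // -(e 2%N) //; ring.
  rewrite hi hj in e'; apply: etrans e'; rewrite -[LHS]addr0 -(mul0r b) -sR; ring.
have [lk ll lm] : [/\ dot a (point k) - b <= 0, dot a (point l) - b <= 0 & dot a (point m) - b <= 0].
  by split; apply: le'; rewrite !inE eqxx ?orbT.
have D0n : (D0%:~R : R) != 0.
  by rewrite intr_eq0; case/orP: hD => /and5P[h _ _ _ _]; [rewrite gt_eqF|rewrite lt_eqF].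
have zero (x y z : R) (d2 d3 d4 : int) : [&& d2 < 0, d3 < 0 & d4 < 0] -> x <= 0 -> y <= 0 -> z <= 0 ->
    d2%:~R * x + d3%:~R * y + d4%:~R * z = 0 -> [/\ x = 0, y = 0 & z = 0].
  move=> /and3P[]; rewrite -!(ltrz0 R) => h2 h3 h4 x0 y0 z0 e.
  have px : 0 <= d2%:~R * x by rewrite mulr_le0 // ltW.
  have py : 0 <= d3%:~R * y by rewrite mulr_le0 // ltW.
  have pz : 0 <= d4%:~R * z by rewrite mulr_le0 // ltW.
  split; [apply: (mulfI (negbT (lt_eqF h2)))|apply: (mulfI (negbT (lt_eqF h3)))
    |apply: (mulfI (negbT (lt_eqF h4)))]; rewrite mulr0; lra.
have [ek el em] : [/\ dot a (point k) - b = 0, dot a (point l) - b = 0 & dot a (point m) - b = 0].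
  case/orP: hD => /and5P[_ _ h2 h3 h4]; first by apply: (zero _ _ _ D2 D3 D4); rewrite // h2 h3 h4.
  apply: (zero _ _ _ (- D2) (- D3) (- D4)); rewrite ?oppr_lt0 ?h2 ?h3 ?h4 //.
  by rewrite !intrN !mulNr -!opprD sd oppr0.
apply/eqP; apply: contraNT D0n => an0.
have perp n : dot a (point n) - b = 0 -> dot a (point n - point j) = 0 by rewrite dotBr hj.
have := triple_perp an0 (perp _ ek) (perp _ el) (perp _ em).
rewrite /point !lin_sub triple_lin => /eqP; rewrite mulf_eq0 (negPf (triple_frame (std_frame R))) orbF.
congr (_ == 0); rewrite !mv_base; case: eD => <- _ _ _ _.
by rewrite /det_points !(intrD, intrM, intrB); ring.
Qed.

Definition ico_face c : set E3 := hull place [set ico_point w | w in c]%SET.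

Lemma exposed_clique (a : E3) b (l : seq nat) : (forall w, dot a (place w) <= b) ->
  subseq l (iota 0 12) -> (forall k, k \in l -> dot a (point k) = b) -> a != 0 -> clique l.
Proof.
move=> le sub hl a0; apply/(pairwiseP 0%N) => x y hx hy xy; apply/negP => /hasP[K hK /eqP hij].
have := allP circuits_check K hK; case: K hij {hK} => [|i [|j [|k [|l' [|m [|? ?]]]]]] // [ei ej] cc.
move/negP: a0; apply; apply/eqP; apply: (circuit_exposes cc le); apply: hl.
  by rewrite ei mem_nth.
by rewrite ej mem_nth.
Qed.

(** Extremality of the vertices lets inclusion of hulls reflect inclusion of cells. Supporting
    planes expose every cell, and the clique property shows that there are no further proper
    faces. *)
Lemma hull_icosahedron : combinatorially_isomorphic (convex_hull (body place)) icosahedron.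
Proof.
rewrite body_hull; exists ico_face; split.
  move=> c c' _ _; split=> [h|h]; last by apply: hullS; exact: imsetS.
  apply/fintype.subsetP => w wc; rewrite -(mem_imset _ _ ico_point_inj).
  by apply: (sphere_hull_mem (@place_sphere R) (@place_inj R)); apply/h/hull_pt/imset_f.
move=> F; split.
  case=> -[a [b [le eF]]] [x0 Fx0] FK.
  have le' w : dot a (place w) <= b by apply: le; apply: hull_pt; rewrite finset.in_setT.
  pose S := [set w | dot a (place w) == b]%SET.
  have FS : F = hull place S.
    rewrite eF; apply/seteqP; split=> x.
      case=> hx ex; have := hull_exposed (fun i _ => le' i) hx ex; apply: hullS.
      by apply/fintype.subsetP => w; rewrite !inE.
    case=> l wl ->; split; first by exists l => //; apply: weightsS wl; exact: finset.subsetT.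
    by apply: (dot_bary_eq wl) => w; rewrite inE => /eqP.
  pose l := [seq k <- iota 0 12 | (inord k : 'I_12) \in S].
  have Sl : S = labelled 12 l.
    by apply: labelled_mem => w; rewrite mem_filter inord_val mem_iota /= ltn_ord andbT.
  have sub : subseq l (iota 0 12) by exact: filter_subseq.
  (* For [a = 0] the exposed face, being nonempty, would be the whole hull. *)
  have a0 : a != 0.
    apply: contra_notN FK => /eqP a0; rewrite FS; congr hull; apply/setP => w; rewrite !inE.
    move: Fx0; rewrite eF a0 dotC dot0r => -[_ <-]; by rewrite dotC dot0r eqxx.
  have cl : clique l.
    apply: (exposed_clique le' sub _ a0) => k; rewrite mem_filter inE mem_iota => /andP[/eqP + hk].
    by rewrite /place /= inordK.
  have l0 : (0 < size l)%N.
    rewrite lt0n size_eq0; apply/eqP => l0; move: Fx0; rewrite FS Sl l0 => -[l' /weights0].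
    by move=> /set0Pn[w]; rewrite inE.
  have l4 : (size l < 4)%N.
    rewrite ltnNge; apply/negP => l4.
    have := mem_combs (subseq_trans (take_subseq l 4) sub); rewrite size_takel //.
    by move/(allP no_large_clique)/negP; apply; apply: (subseq_pairwise (take_subseq l 4)).
  have hn : size l \in [:: 1; 2; 3]%N by case: (size l) l0 l4 => [|[|[|[|]]]].
  have := allP (allP cliques_check _ hn) _ (mem_combs sub); rewrite cl => /hasP[t ht st].
  exists (labelled 12 t : {set vert icosahedron}); first by apply/ico_cellP; exists t.
  have /andP[_ lt] := allP exposes_check t ht.
  rewrite /ico_face ico_point_labelled // FS Sl; congr hull; apply/setP => w; rewrite !inE.
  case/andP: st => /allP st /allP ts; apply/idP/idP; [exact: st|exact: ts].
case=> c /ico_cellP[s hs ->] <-.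
have /andP[/hasP[cc hcc hex] ls] := allP exposes_check s hs.
rewrite /ico_face ico_point_labelled //; have hw := exposesP hex.
have eF : hull place (labelled 12 (map ico_label s)) =
    [set x | hull place [set: vert M]%SET x /\ dot (ivec R cc) x = (nth 0 cc 3)%:~R].
  apply/seteqP; split=> x.
    case=> l wl ->; split; first by exists l => //; apply: weightsS wl; exact: finset.subsetT.
    by apply: (dot_bary_eq wl) => w; rewrite inE; have [_ <-] := hw w => /eqP.
  case=> hx ex; have := hull_exposed (fun w _ => (hw w).1) hx ex; apply: hullS.
  by apply/fintype.subsetP => w; rewrite !inE (hw w).2.
have [k0 hk0 nk0] : exists2 k, (k < 12)%N & k \notin map ico_label s.
  have : ~~ all (mem (map ico_label s)) (iota 0 12).
    by have /andP[] := allP ico_cells_proper s hs.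
  by case/allPn => k; rewrite mem_iota => hk nk; exists k.
split.
- exists (ivec R cc), (nth 0 cc 3)%:~R; split=> // x [l wl ->].
  by apply: (dot_bary_le wl) => w _; case: (hw w).
- have : s != [::] by have := allP ico_cells_proper s hs => /andP[].
  case: s {hs hex hw eF nk0} ls => // k s /andP[hk _] _; exists (place (inord (ico_label k))).
  by apply: hull_pt; rewrite inE /= inordK ?ico_label_lt // mem_head.
move=> e; have : hull place (labelled 12 (map ico_label s)) (place (Ordinal hk0)).
  by rewrite e; apply: hull_pt; rewrite finset.in_setT.
move/(sphere_hull_mem (@place_sphere R) (@place_inj R)); rewrite inE; exact/negP.
Qed.

End Icosahedron.

Lemma triangle_map_counts (R : realType) :
  [/\ has_genus triangle_map 3, #|vert triangle_map| = 12%N, #|edges triangle_map| = 48%N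
    & #|face triangle_map| = 32%N].
Proof.
have dc := double_count (triangle_polyhedron R).
have e48 : #|edges triangle_map| = 48%N.
  apply/eqP; rewrite -(@eqn_pmul2r 2) // -dc.
  by rewrite (eq_bigr (fun=> 3%N)) => [|f _]; rewrite ?bdry_size // sum_nat_const card_ord.
by split; rewrite /has_genus ?e48 ?card_ord.
Qed.

Local Close Scope ring_scope.
Local Close Scope classical_set_scope.

Theorem theorem1p2 (R : realType) :
  exists M : map_data,
    [/\ tetrahedral_type R M,
        forall M' : map_data, tetrahedral_type R M' -> map_isomorphic M M',
        [/\ has_genus M 3, #|vert M| = 12, #|edges M| = 48 & #|face M| = 32],
        (forall f : face M, size (bdry f) = 3) /\
        (forall v : vert M, #|[pred f : face M | v \in bdry f]| = 8)
      & exists p : vert M -> 'rV[R]_3,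
          [/\ polyhedron p, vertex_transitive_tetrahedral p
            & combinatorially_isomorphic (convex_hull (body p)) icosahedron]].
Proof.
have [genus3 V E F] := triangle_map_counts R.
exists triangle_map; split.
- split; first by exists 3%N.
  by exists (@place R); split; [exact: triangle_polyhedron|exact: triangle_map_symmetric].
- exact: tetrahedral_type_unique.
- by [].
- by split; [exact: bdry_size|exact: triangle_degree].
by exists (@place R); split;
  [exact: triangle_polyhedron|exact: triangle_map_symmetric|exact: hull_icosahedron].
Qed.
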